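(* Let $\mathbb{D}=\{z\in\mathbb{C}:|z|<1\}$ and let $f=h+\overline{g}$ be a sense-preserving univalent harmonic mapping of $\mathbb{D}$ with $h(z)=z+\sum_{n=2}^\infty a_nz^n$ and $g(z)=\sum_{n=2}^\infty b_nz^n$ (so $f\in\mathcal{S}^0_H$), which is stable convex, i.e. $h+\mu\overline{g}$ is univalent and convex in $\mathbb{D}$ for every $|\mu|=1$. Let $m,p\in\mathbb{N}$, $\omega_m\in\mathcal{B}_m$, $\omega_p\in\mathcal{B}_p$, and let $N\ge2$ be an integer. Then $$|D^2f(\omega_m(z))|+\sum_{n=N}^{\infty}(|a_n|+|b_n|)|\omega_p(z)|^n\le d\big(f(0),\partial f(\mathbb{D})\big)\quad\text{and}\quad|\mathscr{D}^2f(\omega_m(z))|+\sum_{n=N}^{\infty}(|a_n|+|b_n|)|\omega_p(z)|^n\le d\big(f(0),\partial f(\mathbb{D})\big)$$ both hold for $|z|=r\le r_{8,m,p}$, where $r_{8,m,p}$ is the unique root in $(0,1)$ of $$\frac{r^m(1+r^m)}{(1-r^m)^3}+\frac{r^{pN}}{1-r^p}-\frac12=0.$$ The radius $r_{8,m,p}$ is best possible.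
   Context: For $n\in\mathbb{N}$, $\mathcal{B}_n$ denotes the set of analytic functions $\omega:\mathbb{D}\to\mathbb{C}$ with $|\omega(z)|\le1$ in $\mathbb{D}$, $\omega(0)=\omega'(0)=\cdots=\omega^{(n-1)}(0)=0$ and $\omega^{(n)}(0)\neq0$. For a harmonic $f$, $Df=zf_z-\overline{z}f_{\overline{z}}$ and $\mathscr{D}f=zf_z+\overline{z}f_{\overline{z}}$; $D^2f=D(Df)$ and $\mathscr{D}^2f=\mathscr{D}(\mathscr{D}f)$, and $D^2f(\omega_m(z))$ means $(D^2f)(\omega_m(z))$ (similarly for $\mathscr{D}^2$). $d(f(0),\partial f(\mathbb{D}))$ is the Euclidean distance from $f(0)$ to the boundary of $f(\mathbb{D})$. ''Best possible'' means that for every $r>r_{8,m,p}$ there exist such $f,\omega_m,\omega_p$ and $z$ with $|z|=r$ for which the inequality fails. *)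

(* Defs.v *)
From Stdlib Require Import Reals.
From Coquelicot Require Import Coquelicot.

Open Scope R_scope.

Definition inD (z : C) : Prop := Cmod z < 1.

Definition dx (F : C -> C) (z : C) : C :=
  (Derive (fun t : R => Re (F (Cplus z (RtoC t)))) 0,
   Derive (fun t : R => Im (F (Cplus z (RtoC t)))) 0).
Definition dy (F : C -> C) (z : C) : C :=
  (Derive (fun t : R => Re (F (Cplus z (Cmult Ci (RtoC t))))) 0,
   Derive (fun t : R => Im (F (Cplus z (Cmult Ci (RtoC t))))) 0).

Definition fz (F : C -> C) (z : C) : C :=
  Cmult (RtoC (/2)) (Cminus (dx F z) (Cmult Ci (dy F z))).
Definition fzbar (F : C -> C) (z : C) : C :=
  Cmult (RtoC (/2)) (Cplus (dx F z) (Cmult Ci (dy F z))).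

Definition Dop (F : C -> C) : C -> C :=
  fun z => Cminus (Cmult z (fz F z)) (Cmult (Cconj z) (fzbar F z)).
Definition scrD (F : C -> C) : C -> C :=
  fun z => Cplus (Cmult z (fz F z)) (Cmult (Cconj z) (fzbar F z)).

Definition univalent_D (F : C -> C) : Prop :=
  forall z1 z2, inD z1 -> inD z2 -> F z1 = F z2 -> z1 = z2.

(* sense-preserving: positive Jacobian J_F = |F_z|^2 - |F_zbar|^2 on the disk *)
Definition sense_preserving_D (F : C -> C) : Prop :=
  forall z, inD z -> Cmod (fzbar F z) < Cmod (fz F z).

Definition convex_image_D (F : C -> C) : Prop :=
  forall z1 z2 t, inD z1 -> inD z2 -> 0 <= t <= 1 ->
    exists z3, inD z3 /\
      F z3 = Cplus (Cmult (RtoC (1 - t)) (F z1)) (Cmult (RtoC t) (F z2)).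

Definition univalent_convex_D (F : C -> C) : Prop :=
  univalent_D F /\ convex_image_D F.

Definition stable_convex (h g : C -> C) : Prop :=
  forall mu : C, Cmod mu = 1 ->
    univalent_convex_D (fun z => Cplus (h z) (Cmult mu (Cconj (g z)))).

Definition SHC0 (a b : nat -> C) (h g : C -> C) : Prop :=
  (forall z, inD z -> is_series (fun n => Cmult (a n) (Cpow z n)) (h z)) /\
  (forall z, inD z -> is_series (fun n => Cmult (b n) (Cpow z n)) (g z)) /\
  a 0%nat = RtoC 0 /\ a 1%nat = RtoC 1 /\ b 0%nat = RtoC 0 /\ b 1%nat = RtoC 0 /\
  sense_preserving_D (fun z => Cplus (h z) (Cconj (g z))) /\
  univalent_D (fun z => Cplus (h z) (Cconj (g z))) /\
  stable_convex h g.

(* the class B_n: analytic self-maps of D (|w| <= 1) with a zero of order exactly n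
   at 0 ; w is given by its Taylor series, w^(k)(0) = k! c_k *)
Definition inB (n : nat) (w : C -> C) : Prop :=
  exists c : nat -> C,
    (forall z, inD z -> is_series (fun k => Cmult (c k) (Cpow z k)) (w z)) /\
    (forall z, inD z -> Cmod (w z) <= 1) /\
    (forall k, (k < n)%nat -> c k = RtoC 0) /\
    c n <> RtoC 0.

Definition closure_C (S : C -> Prop) (w : C) : Prop :=
  forall eps, 0 < eps -> exists s, S s /\ Cmod (Cminus s w) < eps.
Definition interior_C (S : C -> Prop) (w : C) : Prop :=
  exists eps, 0 < eps /\ forall s, Cmod (Cminus s w) < eps -> S s.
Definition boundary_C (S : C -> Prop) (w : C) : Prop :=
  closure_C S w /\ ~ interior_C S w.

(* image F(D) and d(F(0), boundary F(D)) (infimum, +oo if boundary empty) *)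
Definition image_D (F : C -> C) (w : C) : Prop := exists z, inD z /\ F z = w.
Definition dist_bd (F : C -> C) : Rbar :=
  Glb_Rbar (fun d => exists w, boundary_C (image_D F) w /\ d = Cmod (Cminus w (F (RtoC 0)))).

Definition bohr_ineq (Op : (C -> C) -> C -> C) (a b : nat -> C) (F wm wp : C -> C)
    (N : nat) (z : C) : Prop :=
  exists S : R,
    is_series (fun k => (Cmod (a (k + N)%nat) + Cmod (b (k + N)%nat)) * Cmod (wp z) ^ (k + N)) S /\
    Rbar_le (Finite (Cmod (Op (Op F) (wm z)) + S)) (dist_bd F).

Definition Phi8 (m p N : nat) (r : R) : R :=
  r ^ m * (1 + r ^ m) / (1 - r ^ m) ^ 3 + r ^ (p * N) / (1 - r ^ p) - / 2.

(* Main.v *)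
Require Import Defs.
From Stdlib Require Import Reals Lra Lia Arith ClassicalEpsilon Classical.
From Coquelicot Require Import Coquelicot.

(* Stability passes from h + mu conj(g) to the analytic maps h + lambda g, |lambda| = 1: they are
   injective, and convex by a shear argument.  For a convex analytic Phi = z + sum c_n z^n, the
   average of Phi over the n-th roots of unity is subordinate to Phi and starts with c_n z^n, so
   Schwarz's lemma gives |c_n| <= 1; a suitable lambda then yields |a_n| + |b_n| <= 1.  Averaging
   f = h + conj(g) with the weights 1 + cos t shows that f(D) contains the disk of radius 1/2,
   which bounds the distance to the boundary from below.  As D^2 f and the other second-order
   operator both equal sum n^2 a_n z^n + conj(sum n^2 b_n z^n), the inequalities follow from
   sum n^2 x^n = x (1 + x) / (1 - x)^3.  The half-plane map z / (1 - z) with omega_m = z^m and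
   omega_p = z^p is extremal.

   In place of Cauchy's theory, the only regularity used is a second-order Taylor expansion at
   each point, which suffices for the maximum principle. *)

(** * Complex series *)

(** In the coefficient bound the subordinating map phi = Phi^-1 o q is only picked pointwise, so no
    power series for it is at hand. What can be had is an expansion at each point, obtained from
    continuity (openness and injectivity of Phi) by matching coefficients. Order two is needed
    because the four-point average of |chi|^2 + eps |z|^2 gains eps rho^2, which must beat the error
    term. Dividing phi by z^n would need a removable singularity at 0; a high power of phi with one
    spare factor z avoids it.

    The constant 1/2 is the first Fourier coefficient of 1 + cos t. Averages over finitely many
    points only land near their target, so they give density of f(D) in the disk of radius 1/2;
    convexity then turns density into interior points. The half-plane map attains the coefficient
    bound and the distance bound at once: its coefficients are 1 and its image is Re w > -1/2. At z
    = r, with pure powers for the inner maps, every estimate becomes an equality. *)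

Definition csum (a : nat -> C) (l : C) : Prop := @is_series C_AbsRing C_NormedModule a l.

Lemma csum_eps (a : nat -> C) (l : C) :
  csum a l <-> forall eps, 0 < eps ->
    exists n0, forall n, (n0 <= n)%nat -> Cmod (sum_n a n - l)%C < eps.
Proof.
unfold csum, is_series; split.
- intros H eps He.
  apply filterlim_locally_ball_norm with (eps := mkposreal eps He) in H.
  destruct H as [n0 H]; exists n0; intros n Hn; exact (H n Hn).
- intros H; apply filterlim_locally_ball_norm; intros [eps He].
  destruct (H eps He) as [n0 H0]; exists n0; intros n Hn; exact (H0 n Hn).
Qed.

Lemma sum_n_C_S (a : nat -> C) n : sum_n a (S n) = (sum_n a n + a (S n))%C.
Proof. apply (@sum_Sn C_AbelianMonoid). Qed.

Lemma sum_n_Re (a : nat -> C) n : Re (sum_n a n) = sum_n (fun k => Re (a k)) n.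
Proof.
induction n as [|n IH]; [now rewrite !sum_O|].
rewrite sum_n_C_S, sum_Sn, <- IH; reflexivity.
Qed.

Lemma sum_n_Im (a : nat -> C) n : Im (sum_n a n) = sum_n (fun k => Im (a k)) n.
Proof.
induction n as [|n IH]; [now rewrite !sum_O|].
rewrite sum_n_C_S, sum_Sn, <- IH; reflexivity.
Qed.

Lemma im_le_Cmod (c : C) : Rabs (Im c) <= Cmod c.
Proof. eapply Rle_trans; [apply Rmax_r|apply Rmax_Cmod]. Qed.

Lemma Cmod_le_Re_Im (c : C) : Cmod c <= Rabs (Re c) + Rabs (Im c).
Proof.
replace c with (RtoC (Re c) + Ci * RtoC (Im c))%C at 1.
- eapply Rle_trans; [apply Cmod_triangle|].
  rewrite Cmod_mult, Cmod_Ci, !Cmod_R; lra.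
- apply injective_projections; simpl; unfold Re, Im; ring.
Qed.

Lemma csum_Re_Im (a : nat -> C) (l : C) :
  csum a l <-> is_series (fun n => Re (a n)) (Re l) /\ is_series (fun n => Im (a n)) (Im l).
Proof.
rewrite csum_eps; split.
- intros H; split; apply (proj2 (filterlim_locally_ball_norm (F := eventually) _ _));
    intros [eps He]; destruct (H eps He) as [n0 H0]; exists n0; intros n Hn;
    unfold ball_norm; simpl; unfold norm, minus, plus, opp; simpl; unfold abs; simpl.
  + rewrite <- sum_n_Re.
    eapply Rle_lt_trans; [|exact (H0 n Hn)].
    apply (re_le_Cmod (sum_n a n - l)%C).
  + rewrite <- sum_n_Im.
    eapply Rle_lt_trans; [|exact (H0 n Hn)].
    apply (im_le_Cmod (sum_n a n - l)%C).
- intros [H1 H2] eps He.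
  assert (He2 : 0 < eps / 2) by lra.
  apply filterlim_locally_ball_norm with (eps := mkposreal _ He2) in H1.
  apply filterlim_locally_ball_norm with (eps := mkposreal _ He2) in H2.
  destruct H1 as [n1 H1]; destruct H2 as [n2 H2]; exists (max n1 n2); intros n Hn.
  specialize (H1 n ltac:(lia)); specialize (H2 n ltac:(lia)).
  unfold ball_norm in H1, H2; simpl in H1, H2.
  unfold norm, minus, plus, opp in H1, H2; simpl in H1, H2; unfold abs in H1, H2; simpl in H1, H2.
  rewrite <- sum_n_Re in H1; rewrite <- sum_n_Im in H2.
  eapply Rle_lt_trans; [apply Cmod_le_Re_Im|].
  change (Re (sum_n a n - l)) with (Re (sum_n a n) + - Re l).
  change (Im (sum_n a n - l)) with (Im (sum_n a n) + - Im l).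
  lra.
Qed.

Lemma csum_ext (a b : nat -> C) (l : C) : (forall n, a n = b n) -> csum a l -> csum b l.
Proof. apply is_series_ext. Qed.

Lemma csum_plus (a b : nat -> C) (la lb : C) :
  csum a la -> csum b lb -> csum (fun n => a n + b n)%C (la + lb)%C.
Proof. apply (is_series_plus (V := C_NormedModule)). Qed.

Lemma csum_scal (c : C) (a : nat -> C) (l : C) :
  csum a l -> csum (fun n => c * a n)%C (c * l)%C.
Proof. apply (is_series_scal (V := C_NormedModule)). Qed.

Lemma csum_opp (a : nat -> C) (l : C) : csum a l -> csum (fun n => - a n)%C (- l)%C.
Proof. apply (is_series_opp (V := C_NormedModule)). Qed.

Lemma csum_minus (a b : nat -> C) (la lb : C) :
  csum a la -> csum b lb -> csum (fun n => a n - b n)%C (la - lb)%C.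
Proof. intros Ha Hb; apply csum_plus; [exact Ha|apply csum_opp, Hb]. Qed.

Lemma csum_unique (a : nat -> C) (l l' : C) : csum a l -> csum a l' -> l = l'.
Proof.
rewrite !csum_Re_Im; intros [H1 H2] [H3 H4].
apply is_series_unique in H1, H2, H3, H4.
apply injective_projections; unfold Re, Im in *; congruence.
Qed.

Lemma csum_le (a : nat -> C) (b : nat -> R) (l : C) (s : R) :
  csum a l -> (forall n, Cmod (a n) <= b n) -> is_series b s -> Cmod l <= s.
Proof.
intros Ha Hab Hb.
assert (Hp : forall n, Cmod (sum_n a n) <= s).
{ intros n; apply Rle_trans with (sum_n b n).
  - induction n as [|n IH]; [rewrite !sum_O; apply Hab|].
    rewrite sum_n_C_S, sum_Sn; eapply Rle_trans; [apply Cmod_triangle|].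
    specialize (Hab (S n)); unfold plus; simpl; lra.
  - apply (is_lim_seq_incr_compare (sum_n b)); [exact Hb|].
    intros k; rewrite sum_Sn; unfold plus; simpl.
    specialize (Hab (S k)); pose proof (Cmod_ge_0 (a (S k))); lra. }
apply Rnot_lt_le; intros Hlt.
destruct (proj1 (csum_eps a l) Ha (Cmod l - s) ltac:(lra)) as [n0 H0].
specialize (H0 n0 (Nat.le_refl _)).
assert (H := Cmod_triangle (sum_n a n0) (l - sum_n a n0)%C).
replace (sum_n a n0 + (l - sum_n a n0))%C with l in H by ring.
replace (l - sum_n a n0)%C with (- (sum_n a n0 - l))%C in H by ring.
rewrite Cmod_opp in H; specialize (Hp n0); lra.
Qed.

Lemma csum_ex (a : nat -> C) (b : nat -> R) :
  (forall n, Cmod (a n) <= b n) -> ex_series b -> exists l, csum a l.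
Proof.
intros Hab Hb.
destruct (ex_series_le (V := R_CompleteNormedModule) (fun n => Re (a n)) b) as [l1 H1]; [|exact Hb|].
{ intros n; eapply Rle_trans; [apply (re_le_Cmod (a n))|apply Hab]. }
destruct (ex_series_le (V := R_CompleteNormedModule) (fun n => Im (a n)) b) as [l2 H2]; [|exact Hb|].
{ intros n; eapply Rle_trans; [apply (im_le_Cmod (a n))|apply Hab]. }
exists (l1, l2); apply csum_Re_Im; split; assumption.
Qed.

Lemma csum_bounded_terms (a : nat -> C) (l : C) :
  csum a l -> exists K, forall n, Cmod (a n) <= K.
Proof.
intros H.
destruct (proj1 (csum_eps a l) H 1 Rlt_0_1) as [n0 H0].
assert (Hsmall : forall n, (S n0 <= n)%nat -> Cmod (a n) <= 2).
{ intros n Hn; destruct n as [|n]; [lia|].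
  pose proof (H0 n ltac:(lia)) as H1; pose proof (H0 (S n) ltac:(lia)) as H2.
  rewrite sum_n_C_S in H2.
  pose proof (Cmod_triangle (sum_n a n + a (S n) - l)%C (- (sum_n a n - l))%C) as H3.
  rewrite Cmod_opp in H3.
  replace (sum_n a n + a (S n) - l + - (sum_n a n - l))%C with (a (S n)) in H3 by ring; lra. }
assert (Hfin : forall m, exists K, forall n, (n <= m)%nat -> Cmod (a n) <= K).
{ induction m as [|m [K HK]].
  - exists (Cmod (a 0%nat)); intros n Hn; replace n with 0%nat by lia; lra.
  - exists (Rmax K (Cmod (a (S m)))); intros n Hn.
    destruct (Nat.eq_dec n (S m)) as [->|]; [apply Rmax_r|].
    eapply Rle_trans; [apply HK; lia|apply Rmax_l]. }
destruct (Hfin n0) as [K HK]; exists (Rmax K 2); intros n.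
destruct (le_lt_dec n n0) as [Hn|Hn].
- eapply Rle_trans; [apply HK; lia|apply Rmax_l].
- eapply Rle_trans; [apply Hsmall; lia|apply Rmax_r].
Qed.

Definition PS (a : nat -> C) (h : C -> C) : Prop :=
  forall z, inD z -> csum (fun n => Cmult (a n) (Cpow z n)) (h z).

Lemma ex_series_scal_geom (K q : R) : 0 <= q < 1 -> ex_series (fun n => K * q ^ n).
Proof.
intros Hq; exists (K * / (1 - q)).
apply (is_series_scal (V := R_NormedModule) K (fun n => q ^ n)).
apply is_series_geom; rewrite Rabs_pos_eq; lra.
Qed.

(** Convergence at the midpoint q of r and 1 bounds |a_n| q^n, which leaves a geometric series of
    ratio r / q at radius r. *)
Lemma PS_abs (a : nat -> C) (h : C -> C) (r : R) :
  PS a h -> 0 <= r < 1 -> ex_series (fun n => Cmod (a n) * r ^ n).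
Proof.
intros Hh Hr.
assert (Hq : 0 < (1 + r) / 2 < 1) by lra; set (q := (1 + r) / 2) in *.
assert (HD : inD (RtoC q)).
{ unfold inD; rewrite Cmod_R, Rabs_pos_eq; lra. }
destruct (csum_bounded_terms _ _ (Hh _ HD)) as [K HK].
apply (ex_series_le (V := R_CompleteNormedModule) _ (fun n => K * (r / q) ^ n)).
- intros n; unfold norm; simpl; unfold abs; simpl.
  rewrite Rabs_pos_eq by (apply Rmult_le_pos; [apply Cmod_ge_0|apply pow_le; lra]).
  specialize (HK n); rewrite Cmod_mult, Cmod_pow, Cmod_R, Rabs_pos_eq in HK by lra.
  replace (r ^ n) with (q ^ n * (r / q) ^ n)
    by (rewrite <- Rpow_mult_distr; f_equal; field; lra).
  rewrite <- Rmult_assoc; apply Rmult_le_compat_r; [|exact HK].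
  apply pow_le; apply Rmult_le_pos; [lra|apply Rlt_le, Rinv_0_lt_compat; lra].
- apply ex_series_scal_geom; split.
  + apply Rmult_le_pos; [lra|apply Rlt_le, Rinv_0_lt_compat; lra].
  + apply (Rmult_lt_reg_r q); [lra|]; replace (r / q * q) with r by (field; lra).
    unfold q; lra.
Qed.

(** * Compactness of closed disks *)

(** A Lebesgue-number form of compactness: d stands for the smallest radius in a finite subcover, so
    local estimates valid within [delta u] become uniform. *)
Lemma disk_compact (c : C) (r : R) (delta : C -> R) :
  (forall u, Cmod (u - c)%C <= r -> 0 < delta u) ->
  exists d, 0 < d /\ forall z, Cmod (z - c)%C <= r ->
    exists u, Cmod (u - c)%C <= r /\ Cmod (z - u)%C < delta u /\ d <= delta u.
Proof.
intros Hd.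
(* The covering lives on a square. Outside the disk the gauge is half the distance to it, so no such
   centre captures a point of the disk. Inside, halving pays for |c| <= |Re c| + |Im c|. *)
pose (dl := fun x y : R => if Rle_dec (Cmod ((x, y) - c)%C) r then delta (x, y) / 2
                           else (Cmod ((x, y) - c)%C - r) / 2).
assert (Hdl : forall x y, 0 < dl x y).
{ intros x y; unfold dl; destruct (Rle_dec _ _) as [H|H]; [specialize (Hd _ H); lra|lra]. }
destruct (compactness_value_2d (Re c - r) (Re c + r) (Im c - r) (Im c + r)
            (fun x y => mkposreal _ (Hdl x y))) as [[d Hd0] H].
exists d; split; [exact Hd0|]; intros z Hz.
pose proof (re_le_Cmod (z - c)%C) as Hre; pose proof (im_le_Cmod (z - c)%C) as Him.
change (Re (z - c)) with (Re z + - Re c) in Hre.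
change (Im (z - c)) with (Im z + - Im c) in Him.
assert (Hre' := proj1 (Rabs_le_between _ _) (Rle_trans _ _ _ Hre Hz)).
assert (Him' := proj1 (Rabs_le_between _ _) (Rle_trans _ _ _ Him Hz)).
specialize (H (Re z) (Im z) ltac:(lra) ltac:(lra)).
apply NNPP in H; destruct H as (x & y & Hx & Hy & H1 & H2 & H3); simpl in H1, H2, H3.
assert (H4 : Cmod (z - (x, y))%C < 2 * dl x y).
{ eapply Rle_lt_trans; [apply Cmod_le_Re_Im|].
  change (Re (z - (x, y))) with (Re z + - x); change (Im (z - (x, y))) with (Im z + - y).
  unfold Rminus in H1, H2; lra. }
exists (x, y); unfold dl in H3, H4; destruct (Rle_dec _ _) as [H|H].
- repeat split; [exact H|lra|]; specialize (Hd _ H); lra.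
- exfalso; pose proof (Cmod_triangle (z - c)%C (- (z - (x, y)))%C) as H5.
  rewrite Cmod_opp in H5; replace (z - c + - (z - (x, y)))%C with ((x, y) - c)%C in H5 by ring.
  lra.
Qed.

(** Upper semicontinuity is enough: for boundedness and then for attainment, the gauge is made to
    record the wanted estimate, and compactness bounds it below uniformly. *)
Lemma disk_max (c : C) (r : R) (V : C -> R) :
  0 <= r ->
  (forall u, Cmod (u - c)%C <= r -> forall eps, 0 < eps ->
     exists d, 0 < d /\ forall z, Cmod (z - u)%C < d -> Cmod (z - c)%C <= r -> V z < V u + eps) ->
  exists u, Cmod (u - c)%C <= r /\ forall z, Cmod (z - c)%C <= r -> V z <= V u.
Proof.
intros Hr Husc.
assert (Hc : Cmod (c - c)%C <= r).
{ replace (c - c)%C with (RtoC 0) by ring; rewrite Cmod_0; exact Hr. }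
pose (E := fun x => exists z, Cmod (z - c)%C <= r /\ V z = x).
assert (Hb : bound E).
(* Besides the local bound, the radius satisfies [V u <= / d], so a uniform lower bound on the radii
   is an upper bound for V. *)
{ pose (P := fun u d => 0 < d /\ forall z, Cmod (z - u)%C < d -> Cmod (z - c)%C <= r ->
                V z < V u + 1 /\ V u <= / d).
  assert (HP : forall u, Cmod (u - c)%C <= r -> exists d, P u d).
  { intros u Hu; destruct (Husc u Hu 1 Rlt_0_1) as (d & Hd & H).
    assert (Hm : 0 < / (Rmax 1 (V u))) by (apply Rinv_0_lt_compat; pose proof (Rmax_l 1 (V u)); lra).
    exists (Rmin d (/ Rmax 1 (V u))); split; [now apply Rmin_glb_lt|].
    intros z Hz1 Hz2; split.
    - apply H; [|exact Hz2]; eapply Rlt_le_trans; [exact Hz1|apply Rmin_l].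
    - apply Rle_trans with (Rmax 1 (V u)); [apply Rmax_r|].
      rewrite <- (Rinv_inv (Rmax 1 (V u))) at 1.
      apply Rinv_le_contravar; [now apply Rmin_glb_lt|apply Rmin_r]. }
  (* The gauge must be a total function; off the disk it takes the arbitrary value 1. *)
  pose (delta := fun u => match excluded_middle_informative (exists d, P u d) with
                 | left H => proj1_sig (constructive_indefinite_description _ H)
                 | right _ => 1 end).
  assert (Hdelta : forall u, Cmod (u - c)%C <= r -> P u (delta u)).
  { intros u Hu; unfold delta; destruct (excluded_middle_informative _) as [H|H].
    - exact (proj2_sig (constructive_indefinite_description _ H)).
    - exfalso; apply H, HP, Hu. }
  destruct (disk_compact c r delta (fun u Hu => proj1 (Hdelta u Hu))) as (d & Hd & H).
  exists (/ d + 1); intros x (z & Hz & <-).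
  destruct (H z Hz) as (u & Hu & Hzu & Hdu).
  destruct (Hdelta u Hu) as (_ & Hu2); destruct (Hu2 z Hzu Hz) as [H3 H4].
  assert (/ delta u <= / d) by (apply Rinv_le_contravar; assumption); lra. }
destruct (completeness E Hb) as [M [HM1 HM2]]; [exists (V c), c; auto|].
apply NNPP; intros Hno.
assert (Hlt : forall u, Cmod (u - c)%C <= r -> V u < M).
{ intros u Hu; destruct (Rle_lt_or_eq_dec (V u) M) as [|He]; [apply HM1; exists u; auto|assumption|].
  exfalso; apply Hno; exists u; split; [exact Hu|]; intros z Hz; rewrite He; apply HM1; exists z; auto. }
(* If M is not attained, the radius can double as a local gap below M; a uniform gap contradicts
   that M is the least upper bound. *)
pose (P := fun u d => 0 < d /\ forall z, Cmod (z - u)%C < d -> Cmod (z - c)%C <= r -> V z < M - d).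
assert (HP : forall u, Cmod (u - c)%C <= r -> exists d, P u d).
{ intros u Hu; pose proof (Hlt u Hu); destruct (Husc u Hu ((M - V u) / 2)) as (d & Hd & H0); [lra|].
  exists (Rmin d ((M - V u) / 2)); split; [apply Rmin_glb_lt; lra|].
  intros z Hz1 Hz2; specialize (H0 z (Rlt_le_trans _ _ _ Hz1 (Rmin_l _ _)) Hz2).
  pose proof (Rmin_r d ((M - V u) / 2)); lra. }
pose (delta := fun u => match excluded_middle_informative (exists d, P u d) with
               | left H => proj1_sig (constructive_indefinite_description _ H)
               | right _ => 1 end).
assert (Hdelta : forall u, Cmod (u - c)%C <= r -> P u (delta u)).
{ intros u Hu; unfold delta; destruct (excluded_middle_informative _) as [H|H].
  - exact (proj2_sig (constructive_indefinite_description _ H)).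
  - exfalso; apply H, HP, Hu. }
destruct (disk_compact c r delta (fun u Hu => proj1 (Hdelta u Hu))) as (d & Hd & H).
assert (M <= M - d); [|lra].
apply HM2; intros x (z & Hz & <-).
destruct (H z Hz) as (u & Hu & Hzu & Hdu).
pose proof (proj2 (Hdelta u Hu) z Hzu Hz); lra.
Qed.

(** * Taylor expansions of power series *)

(* [pd1 z n] and [pd2 z n] are the coefficients of [t] and [t^2] in [(z + t)^n]; the
   recursive form avoids the exponents [n - 1] and [n - 2]. *)
Fixpoint pd1 (z : C) (n : nat) : C :=
  match n with O => RtoC 0 | S n => (z * pd1 z n + z ^ n)%C end.
Fixpoint pd2 (z : C) (n : nat) : C :=
  match n with O => RtoC 0 | S n => (z * pd2 z n + pd1 z n)%C end.
Fixpoint rd1 (s : R) (n : nat) : R :=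
  match n with O => 0 | S n => s * rd1 s n + s ^ n end.
Fixpoint rd2 (s : R) (n : nat) : R :=
  match n with O => 0 | S n => s * rd2 s n + rd1 s n end.
(** The cubic remainder of (s + t)^n, by its own recursion so that its nonnegativity is
    immediate. *)
Fixpoint rrem (s t : R) (n : nat) : R :=
  match n with O => 0 | S n => (s + t) * rrem s t n + rd2 s n * t ^ 3 end.

Lemma pd1_mult z n : (z * pd1 z n)%C = (RtoC (INR n) * z ^ n)%C.
Proof.
induction n as [|n IH]; [simpl; ring|].
rewrite S_INR, RtoC_plus; simpl; rewrite IH; ring.
Qed.

Lemma rd_nonneg s n : 0 <= s -> 0 <= rd1 s n /\ 0 <= rd2 s n.
Proof.
intros Hs; induction n as [|n [H1 H2]]; [simpl; lra|].
pose proof (pow_le s n Hs); simpl; split; nra.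
Qed.

Lemma rrem_nonneg s t n : 0 <= s -> 0 <= t -> 0 <= rrem s t n.
Proof.
intros Hs Ht; induction n as [|n IH]; [simpl; lra|].
destruct (rd_nonneg s n Hs) as [_ H]; pose proof (pow_le t 3 Ht).
cbn [rrem]; apply Rplus_le_le_0_compat; apply Rmult_le_pos; lra.
Qed.

Lemma pow_expand s t n :
  (s + t) ^ n = s ^ n + rd1 s n * t + rd2 s n * t ^ 2 + rrem s t n.
Proof.
induction n as [|n IH]; [simpl; ring|].
simpl pow at 1; rewrite IH; cbn [rd1 rd2 rrem]; simpl; ring.
Qed.

Lemma pd1_bound z n : Cmod (pd1 z n) <= rd1 (Cmod z) n.
Proof.
induction n as [|n IH]; [simpl; rewrite Cmod_0; lra|].
cbn [pd1 rd1]; eapply Rle_trans; [apply Cmod_triangle|].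
rewrite Cmod_mult, Cmod_pow; pose proof (Cmod_ge_0 z); nra.
Qed.

Lemma pd2_bound z n : Cmod (pd2 z n) <= rd2 (Cmod z) n.
Proof.
induction n as [|n IH]; [simpl; rewrite Cmod_0; lra|].
cbn [pd2 rd2]; eapply Rle_trans; [apply Cmod_triangle|].
rewrite Cmod_mult; pose proof (Cmod_ge_0 z); pose proof (pd1_bound z n); nra.
Qed.

Definition prem (z t : C) (n : nat) : C :=
  ((z + t) ^ n - z ^ n - pd1 z n * t - pd2 z n * t ^ 2)%C.

(** The remainder is t^3 times a polynomial in z and t with nonnegative coefficients, so after
    division by t^3 one may pass to moduli and enlarge |t| to tau. Cross-multiplying by tau^3 spares
    the case t = 0. *)
Lemma prem_bound z t tau n :
  0 < tau -> Cmod t <= tau ->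
  Cmod (prem z t n) * tau ^ 3 <= Cmod t ^ 3 * rrem (Cmod z) tau n.
Proof.
intros H0 Ht; induction n as [|n IH].
- replace (prem z t 0) with (RtoC 0) by (unfold prem; simpl; ring).
  rewrite Cmod_0; simpl; lra.
- replace (prem z t (S n)) with ((z + t) * prem z t n + pd2 z n * t ^ 3)%C
    by (unfold prem; simpl; ring).
  pose proof (Cmod_ge_0 z) as Hz; pose proof (Cmod_ge_0 t) as Ht0.
  assert (H1 : Cmod ((z + t) * prem z t n + pd2 z n * t ^ 3)%C
      <= (Cmod z + tau) * Cmod (prem z t n) + rd2 (Cmod z) n * Cmod t ^ 3).
  { eapply Rle_trans; [apply Cmod_triangle|]; rewrite !Cmod_mult, Cmod_pow.
    apply Rplus_le_compat; apply Rmult_le_compat_r.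
    - apply Cmod_ge_0.
    - eapply Rle_trans; [apply Cmod_triangle|]; lra.
    - apply pow_le; lra.
    - apply pd2_bound. }
  assert (H2 : 0 < tau ^ 3) by (apply pow_lt; lra).
  cbn [rrem].
  eapply Rle_trans; [apply Rmult_le_compat_r; [lra|exact H1]|].
  replace (((Cmod z + tau) * Cmod (prem z t n) + rd2 (Cmod z) n * Cmod t ^ 3) * tau ^ 3)
    with ((Cmod z + tau) * (Cmod (prem z t n) * tau ^ 3) + Cmod t ^ 3 * (rd2 (Cmod z) n * tau ^ 3))
    by ring.
  rewrite Rmult_plus_distr_l; apply Rplus_le_compat_r.
  replace (Cmod t ^ 3 * ((Cmod z + tau) * rrem (Cmod z) tau n))
    with ((Cmod z + tau) * (Cmod t ^ 3 * rrem (Cmod z) tau n)) by ring.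
  apply Rmult_le_compat_l; [lra|exact IH].
Qed.

(** All terms in the expansion of (|z| + tau)^n are nonnegative, so each is at most the whole power:
    Cauchy estimates for monomials. *)
Lemma pd_pow_bounds z tau n :
  0 < tau ->
  Cmod (pd1 z n) <= (Cmod z + tau) ^ n / tau /\
  Cmod (pd2 z n) <= (Cmod z + tau) ^ n / tau ^ 2.
Proof.
intros Ht; pose proof (Cmod_ge_0 z) as Hz.
destruct (rd_nonneg (Cmod z) n Hz) as [H1 H2].
pose proof (rrem_nonneg (Cmod z) tau n Hz (Rlt_le _ _ Ht)) as H3.
pose proof (pow_le _ n Hz) as H4.
pose proof (pow_expand (Cmod z) tau n) as H5.
assert (H6 : 0 <= rd1 (Cmod z) n * tau) by (apply Rmult_le_pos; lra).
assert (H7 : 0 < tau ^ 2) by (apply pow_lt; lra).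
assert (H8 : 0 <= rd2 (Cmod z) n * tau ^ 2) by (apply Rmult_le_pos; lra).
split; (eapply Rle_trans; [first [apply pd1_bound|apply pd2_bound]|]);
  [apply (Rmult_le_reg_r tau)|apply (Rmult_le_reg_r (tau ^ 2))]; try lra;
  unfold Rdiv; rewrite Rmult_assoc, Rinv_l by lra; lra.
Qed.

Definition jet2_at (f : C -> C) (z A B : C) : Prop :=
  exists K d, 0 <= K /\ 0 < d /\ forall t, Cmod t < d ->
    Cmod (f (z + t) - (f z + A * t + B * t ^ 2))%C <= K * Cmod t ^ 3.

Lemma PS_jet2 (a : nat -> C) (h : C -> C) (z : C) :
  PS a h -> inD z ->
  exists A B, csum (fun n => a n * pd1 z n)%C A /\ jet2_at h z A B.
Proof.
intros Hh Hz; unfold inD in Hz; pose proof (Cmod_ge_0 z) as Hz0.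
(* Half the distance to the circle: |z| + tau < 1, and up to powers of 1 / tau the one series sum
   |a_n| (|z| + tau)^n majorises those for A, B and the remainder. *)
set (tau := (1 - Cmod z) / 2); assert (Htau : 0 < tau) by (unfold tau; lra).
assert (Hr : 0 <= Cmod z + tau < 1) by (unfold tau; lra).
pose proof (PS_abs a h _ Hh Hr) as Habs.
set (u := fun n => Cmod (a n) * (Cmod z + tau) ^ n) in *.
assert (Hsc : forall c, ex_series (fun n => c * u n)).
{ intros c; destruct Habs as [l Hl]; exists (c * l).
  apply (is_series_scal (V := R_NormedModule) c u l Hl). }
destruct (csum_ex (fun n => a n * pd1 z n)%C (fun n => / tau * u n)) as [A HA]; [|apply Hsc|].
{ intros n; rewrite Cmod_mult; destruct (pd_pow_bounds z tau n Htau) as [H _].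
  unfold u; replace (/ tau * (Cmod (a n) * (Cmod z + tau) ^ n))
    with (Cmod (a n) * ((Cmod z + tau) ^ n / tau)) by (unfold Rdiv; ring).
  apply Rmult_le_compat_l; [apply Cmod_ge_0|exact H]. }
destruct (csum_ex (fun n => a n * pd2 z n)%C (fun n => / tau ^ 2 * u n)) as [B HB]; [|apply Hsc|].
{ intros n; rewrite Cmod_mult; destruct (pd_pow_bounds z tau n Htau) as [_ H].
  unfold u; replace (/ tau ^ 2 * (Cmod (a n) * (Cmod z + tau) ^ n))
    with (Cmod (a n) * ((Cmod z + tau) ^ n / tau ^ 2)) by (unfold Rdiv; ring).
  apply Rmult_le_compat_l; [apply Cmod_ge_0|exact H]. }
exists A, B; split; [exact HA|].
assert (Hu : forall n, 0 <= u n).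
{ intros n; apply Rmult_le_pos; [apply Cmod_ge_0|apply pow_le; lra]. }
assert (Ht3 : 0 < tau ^ 3) by (apply pow_lt; lra).
assert (HS : 0 <= Series u).
{ rewrite <- (Rmult_0_l (Series (fun _ => 0))), <- Series_scal_l.
  apply Series_le; [|exact Habs]; intros n; specialize (Hu n); lra. }
exists (Series u / tau ^ 3), tau; split; [|split; [exact Htau|]].
{ apply Rmult_le_pos; [exact HS|apply Rlt_le, Rinv_0_lt_compat; lra]. }
intros t Ht.
assert (HD : inD (z + t)%C).
{ unfold inD; eapply Rle_lt_trans; [apply Cmod_triangle|]; lra. }
assert (Hsum : csum (fun n => a n * prem z t n)%C
                 (h (z + t) - (h z + A * t + B * t ^ 2))%C).
{ assert (H := csum_minus _ _ _ _ (Hh _ HD) (csum_plus _ _ _ _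
     (csum_plus _ _ _ _ (Hh _ Hz) (csum_scal t _ _ HA)) (csum_scal (t ^ 2)%C _ _ HB))).
  replace (h (z + t) - (h z + A * t + B * t ^ 2))%C
    with (h (z + t)%C - (h z + t * A + t ^ 2 * B))%C by ring.
  eapply csum_ext; [|exact H]; intros n; unfold prem; simpl; ring. }
replace (Series u / tau ^ 3 * Cmod t ^ 3)
  with (Cmod t ^ 3 / tau ^ 3 * Series u) by (unfold Rdiv; ring).
apply (csum_le _ (fun n => Cmod t ^ 3 / tau ^ 3 * u n) _ _ Hsum).
2: { apply (is_series_scal (V := R_NormedModule) (Cmod t ^ 3 / tau ^ 3)).
     apply Series_correct, Habs. }
intros n; rewrite Cmod_mult; unfold u.
replace (Cmod t ^ 3 / tau ^ 3 * (Cmod (a n) * (Cmod z + tau) ^ n))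
  with (Cmod (a n) * (Cmod t ^ 3 * (Cmod z + tau) ^ n / tau ^ 3)) by (unfold Rdiv; ring).
apply Rmult_le_compat_l; [apply Cmod_ge_0|].
apply (Rmult_le_reg_r (tau ^ 3)); [lra|].
replace (Cmod t ^ 3 * (Cmod z + tau) ^ n / tau ^ 3 * tau ^ 3)
  with (Cmod t ^ 3 * (Cmod z + tau) ^ n) by (field; lra).
eapply Rle_trans; [apply prem_bound; lra|].
apply Rmult_le_compat_l; [apply pow_le, Cmod_ge_0|].
rewrite pow_expand.
destruct (rd_nonneg (Cmod z) n Hz0) as [H1 H2].
assert (0 <= rd1 (Cmod z) n * tau) by (apply Rmult_le_pos; lra).
assert (0 < tau ^ 2) by (apply pow_lt; lra).
assert (0 <= rd2 (Cmod z) n * tau ^ 2) by (apply Rmult_le_pos; lra).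
pose proof (pow_le _ n Hz0); lra.
Qed.

(** * First-order real jets; A and B are the Wirtinger derivatives *)

Definition hjet (F : C -> C) (z A B : C) : Prop :=
  exists K d, 0 <= K /\ 0 < d /\ forall t, Cmod t < d ->
    Cmod (F (z + t) - (F z + A * t + B * Cconj t))%C <= K * Cmod t ^ 2.

Lemma jet2_hjet f z A B : jet2_at f z A B -> hjet f z A (RtoC 0).
Proof.
intros (K & d & HK & Hd & H).
exists (K + Cmod B), (Rmin d 1); split; [pose proof (Cmod_ge_0 B); lra|].
split; [apply Rmin_glb_lt; lra|]; intros t Ht.
assert (Ht1 : Cmod t < d) by (eapply Rlt_le_trans; [exact Ht|apply Rmin_l]).
assert (Ht2 : Cmod t < 1) by (eapply Rlt_le_trans; [exact Ht|apply Rmin_r]).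
specialize (H t Ht1).
replace (f (z + t) - (f z + A * t + RtoC 0 * Cconj t))%C
  with (f (z + t)%C - (f z + A * t + B * t ^ 2) + B * t ^ 2)%C by ring.
eapply Rle_trans; [apply Cmod_triangle|]; rewrite Cmod_mult, Cmod_pow.
pose proof (Cmod_ge_0 t).
assert (K * Cmod t ^ 3 <= K * Cmod t ^ 2); [|lra].
apply Rmult_le_compat_l; [exact HK|]; simpl; nra.
Qed.

Lemma hjet_plus F G z A B A' B' :
  hjet F z A B -> hjet G z A' B' -> hjet (fun w => F w + G w)%C z (A + A')%C (B + B')%C.
Proof.
intros (K & d & HK & Hd & H) (K' & d' & HK' & Hd' & H').
exists (K + K'), (Rmin d d'); split; [lra|]; split; [now apply Rmin_glb_lt|].
intros t Ht.
specialize (H t (Rlt_le_trans _ _ _ Ht (Rmin_l _ _))).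
specialize (H' t (Rlt_le_trans _ _ _ Ht (Rmin_r _ _))).
replace (F (z + t) + G (z + t) - (F z + G z + (A + A') * t + (B + B') * Cconj t))%C
  with ((F (z + t)%C - (F z + A * t + B * Cconj t)) + (G (z + t)%C - (G z + A' * t + B' * Cconj t)))%C
  by ring.
eapply Rle_trans; [apply Cmod_triangle|]; lra.
Qed.

Lemma hjet_scal F z A B c :
  hjet F z A B -> hjet (fun w => c * F w)%C z (c * A)%C (c * B)%C.
Proof.
intros (K & d & HK & Hd & H).
exists (Cmod c * K), d; split; [apply Rmult_le_pos; [apply Cmod_ge_0|exact HK]|].
split; [exact Hd|]; intros t Ht; specialize (H t Ht).
replace (c * F (z + t) - (c * F z + c * A * t + c * B * Cconj t))%C
  with (c * (F (z + t)%C - (F z + A * t + B * Cconj t)))%C by ring.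
rewrite Cmod_mult, Rmult_assoc; apply Rmult_le_compat_l; [apply Cmod_ge_0|exact H].
Qed.

Lemma hjet_conj F z A B :
  hjet F z A B -> hjet (fun w => Cconj (F w)) z (Cconj B) (Cconj A).
Proof.
intros (K & d & HK & Hd & H); exists K, d; split; [exact HK|]; split; [exact Hd|].
intros t Ht; specialize (H t Ht).
rewrite <- Cmod_conj in H; rewrite Cminus_conj, !Cplus_conj, !Cmult_conj, Cconj_conj in H.
replace (Cconj (F (z + t)) - (Cconj (F z) + Cconj B * t + Cconj A * Cconj t))%C
  with (Cconj (F (z + t)) - (Cconj (F z) + Cconj A * Cconj t + Cconj B * t))%C by ring.
exact H.
Qed.

Lemma hjet_ext F G z A B :
  (forall w, inD w -> F w = G w) -> inD z -> hjet F z A B -> hjet G z A B.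
Proof.
intros HFG Hz (K & d & HK & Hd & H); unfold inD in Hz.
exists K, (Rmin d (1 - Cmod z)); split; [exact HK|].
split; [apply Rmin_glb_lt; lra|]; intros t Ht.
specialize (H t (Rlt_le_trans _ _ _ Ht (Rmin_l _ _))).
rewrite <- !HFG; [exact H|exact Hz|].
unfold inD; eapply Rle_lt_trans; [apply Cmod_triangle|].
pose proof (Rlt_le_trans _ _ _ Ht (Rmin_r _ _)); lra.
Qed.

Lemma hjet_cont F z A B :
  hjet F z A B -> exists L d, 0 <= L /\ 0 < d /\ forall w, Cmod (w - z)%C < d ->
    Cmod (F w - F z)%C <= L * Cmod (w - z)%C.
Proof.
intros (K & d & HK & Hd & H).
pose proof (Cmod_ge_0 A); pose proof (Cmod_ge_0 B).
exists (K + Cmod A + Cmod B), (Rmin d 1); split; [lra|].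
split; [apply Rmin_glb_lt; lra|]; intros w Hw; set (t := (w - z)%C) in *.
specialize (H t (Rlt_le_trans _ _ _ Hw (Rmin_l _ _))).
pose proof (Rlt_le_trans _ _ _ Hw (Rmin_r _ _)) as Ht1.
replace (z + t)%C with w in H by (unfold t; ring).
replace (F w - F z)%C with (F w - (F z + A * t + B * Cconj t) + (A * t + B * Cconj t))%C by ring.
eapply Rle_trans; [apply Cmod_triangle|].
assert (Cmod (A * t + B * Cconj t)%C <= Cmod A * Cmod t + Cmod B * Cmod t).
{ eapply Rle_trans; [apply Cmod_triangle|]; rewrite !Cmod_mult, Cmod_conj; lra. }
pose proof (Cmod_ge_0 t).
assert (K * Cmod t ^ 2 <= K * Cmod t); [|lra].
apply Rmult_le_compat_l; [exact HK|]; simpl; nra.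
Qed.

Lemma Derive_quadratic_error (u : R -> R) (l K d : R) :
  0 < d -> (forall t, Rabs t < d -> Rabs (u t - (u 0 + l * t)) <= K * t ^ 2) ->
  Derive u 0 = l.
Proof.
intros Hd H; apply is_derive_unique; apply is_derive_Reals.
intros eps He.
assert (HK : 0 < Rabs K + 1) by (pose proof (Rabs_pos K); lra).
assert (Hd' : 0 < Rmin d (eps / (Rabs K + 1))).
{ apply Rmin_glb_lt; [exact Hd|]; apply Rdiv_lt_0_compat; lra. }
exists (mkposreal _ Hd'); simpl; intros t Ht0 Ht; rewrite Rplus_0_l.
specialize (H t (Rlt_le_trans _ _ _ Ht (Rmin_l _ _))).
pose proof (Rlt_le_trans _ _ _ Ht (Rmin_r _ _)) as Ht2.
replace ((u t - u 0) / t - l) with ((u t - (u 0 + l * t)) / t) by (field; exact Ht0).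
unfold Rdiv; rewrite Rabs_mult, Rabs_inv.
pose proof (Rabs_pos_lt t Ht0) as Ht1.
apply (Rmult_lt_reg_r (Rabs t)); [exact Ht1|].
rewrite Rmult_assoc, Rinv_l, Rmult_1_r by lra.
eapply Rle_lt_trans; [exact H|].
replace (t ^ 2) with (Rabs t * Rabs t) by (rewrite <- Rabs_mult, Rabs_pos_eq; [ring|nra]).
rewrite <- Rmult_assoc; apply Rmult_lt_compat_r; [exact Ht1|].
apply (Rmult_lt_compat_l (Rabs K + 1)) in Ht2; [|exact HK].
replace ((Rabs K + 1) * (eps / (Rabs K + 1))) with eps in Ht2 by (field; lra).
pose proof (Rle_abs K); nra.
Qed.

Lemma hjet_fz F z A B : hjet F z A B -> fz F z = A /\ fzbar F z = B.
Proof.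
intros (K & d & HK & Hd & H).
assert (Hx : dx F z = (A + B)%C).
{ unfold dx; apply injective_projections; simpl;
    apply (Derive_quadratic_error _ _ K d Hd); intros t Ht;
    (assert (Hm : Cmod (RtoC t) < d) by now rewrite Cmod_R);
    specialize (H _ Hm); rewrite Cmod_R, pow2_abs in H;
    (eapply Rle_trans; [|exact H]);
    replace (z + RtoC 0)%C with z by ring;
    [eapply Rle_trans; [|apply re_le_Cmod]|eapply Rle_trans; [|apply im_le_Cmod]];
    apply Req_le; apply f_equal; unfold Re, Im; simpl; ring. }
assert (Hy : dy F z = (Ci * (A - B))%C).
{ unfold dy; apply injective_projections; simpl;
    apply (Derive_quadratic_error _ _ K d Hd); intros t Ht;
    (assert (Hm : Cmod (Ci * RtoC t)%C < d) by now rewrite Cmod_mult, Cmod_Ci, Rmult_1_l, Cmod_R);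
    specialize (H _ Hm); rewrite Cmod_mult, Cmod_Ci, Rmult_1_l, Cmod_R, pow2_abs in H;
    (eapply Rle_trans; [|exact H]);
    replace (z + Ci * RtoC 0)%C with z by ring;
    [eapply Rle_trans; [|apply re_le_Cmod]|eapply Rle_trans; [|apply im_le_Cmod]];
    apply Req_le; apply f_equal; unfold Re, Im; simpl; ring. }
unfold fz, fzbar; rewrite Hx, Hy.
split; apply injective_projections; simpl; field.
Qed.

(* The minimiser of |F - w| over a small disk is interior, and there the invertible
   differential allows a step towards w unless F = w already. *)
Lemma hjet_open (F : C -> C) (z0 : C) (eps : R) :
  (forall z, inD z -> exists A B, hjet F z A B /\ Cmod B < Cmod A) ->
  inD z0 -> 0 < eps ->
  exists d, 0 < d /\ forall w, Cmod (w - F z0)%C < d ->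
    exists z, inD z /\ Cmod (z - z0)%C < eps /\ F z = w.
Proof.
intros HF Hz0 Heps.
destruct (HF z0 Hz0) as (A & B & (K & d & HK & Hd & HJ) & HAB).
set (k := Cmod A - Cmod B); assert (Hk : 0 < k) by (unfold k; lra).
unfold inD in Hz0.
(* On |z - z0| = e the linear part has modulus at least k e and the error is at most K e^2 <= k e /
   2, so F moves by at least k e / 2. *)
assert (exists e, 0 < e /\ e < d /\ e < eps /\ e < 1 - Cmod z0 /\ K * e < k / 2) as (e & He0 & He1 & He2 & He3 & He4).
{ assert (0 < k / 2 / (K + 1)) by (apply Rdiv_lt_0_compat; lra).
  exists (Rmin (Rmin d eps) (Rmin (1 - Cmod z0) (k / 2 / (K + 1))) / 2).
  set (M := Rmin (Rmin d eps) (Rmin (1 - Cmod z0) (k / 2 / (K + 1)))).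
  assert (HM : 0 < M) by (repeat apply Rmin_glb_lt; lra).
  assert (M <= Rmin d eps) by apply Rmin_l.
  assert (M <= Rmin (1 - Cmod z0) (k / 2 / (K + 1))) by apply Rmin_r.
  pose proof (Rmin_l d eps); pose proof (Rmin_r d eps).
  pose proof (Rmin_l (1 - Cmod z0) (k / 2 / (K + 1))).
  pose proof (Rmin_r (1 - Cmod z0) (k / 2 / (K + 1))).
  repeat split; try lra.
  apply Rle_lt_trans with ((K + 1) * (M / 2)); [apply Rmult_le_compat_r; lra|].
  apply Rlt_le_trans with ((K + 1) * (k / 2 / (K + 1))); [apply Rmult_lt_compat_l; lra|].
  apply Req_le; field; lra. }
(* With w this close to F z0, the centre beats every point of the circle |z - z0| = e, so the
   minimiser of |F - w| is interior. *)
exists (k * e / 4); split; [nra|]; intros w Hw.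
assert (HinD : forall z, Cmod (z - z0)%C <= e -> inD z).
{ intros z Hz; unfold inD; replace z with (z0 + (z - z0))%C by ring.
  eapply Rle_lt_trans; [apply Cmod_triangle|]; lra. }
destruct (disk_max z0 e (fun z => - Cmod (F z - w)%C)) as (z & Hz & Hmax); [lra| |].
{ intros u Hu ep Hep; destruct (HF u (HinD u Hu)) as (A' & B' & HJu & _).
  destruct (hjet_cont _ _ _ _ HJu) as (L & dl & HL & Hdl & HLip).
  exists (Rmin dl (ep / (L + 1))); split.
  { apply Rmin_glb_lt; [exact Hdl|apply Rdiv_lt_0_compat; lra]. }
  intros v Hv _; specialize (HLip v (Rlt_le_trans _ _ _ Hv (Rmin_l _ _))).
  pose proof (Rlt_le_trans _ _ _ Hv (Rmin_r _ _)) as Hv2.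
  apply (Rmult_lt_compat_l (L + 1)) in Hv2; [|lra].
  replace ((L + 1) * (ep / (L + 1))) with ep in Hv2 by (field; lra).
  pose proof (Cmod_ge_0 (v - u)%C).
  pose proof (Cmod_triangle (F v - w)%C (- (F v - F u))%C) as Htr.
  rewrite Cmod_opp in Htr.
  replace (F v - w + - (F v - F u))%C with (F u - w)%C in Htr by ring.
  nra. }
assert (Hval : Cmod (F z - w)%C < k * e / 4).
{ specialize (Hmax z0); replace (z0 - z0)%C with (RtoC 0) in Hmax by ring.
  rewrite Cmod_0 in Hmax; specialize (Hmax (Rlt_le _ _ He0)).
  replace (w - F z0)%C with (- (F z0 - w))%C in Hw by ring; rewrite Cmod_opp in Hw; lra. }
assert (Hzlt : Cmod (z - z0)%C < e).
{ destruct (Rle_lt_or_eq_dec _ _ Hz) as [|Heq]; [assumption|exfalso].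
  set (t := (z - z0)%C) in *; specialize (HJ t ltac:(lra)).
  replace (z0 + t)%C with z in HJ by (unfold t; ring).
  pose proof (Cmod_triangle (A * t + B * Cconj t)%C (- (B * Cconj t))%C) as H1.
  replace (A * t + B * Cconj t + - (B * Cconj t))%C with (A * t)%C in H1 by ring.
  rewrite Cmod_opp, !Cmod_mult, Cmod_conj, Heq in H1.
  pose proof (Cmod_triangle (F z - F z0)%C (- (F z - (F z0 + A * t + B * Cconj t)))%C) as H2.
  replace (F z - F z0 + - (F z - (F z0 + A * t + B * Cconj t)))%C
    with (A * t + B * Cconj t)%C in H2 by ring.
  rewrite Cmod_opp in H2; rewrite Heq in HJ.
  pose proof (Cmod_triangle (F z - w)%C (w - F z0)%C) as H3.
  replace (F z - w + (w - F z0))%C with (F z - F z0)%C in H3 by ring.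
  assert (Cmod A * e - Cmod B * e = k * e) by (unfold k; ring).
  assert (K * e ^ 2 <= k / 2 * e) by (simpl; nra).
  lra. }
exists z; split; [apply HinD, Hz|]; split; [lra|].
apply NNPP; intros Hne.
set (v := (w - F z)%C).
assert (Hv : 0 < Cmod v).
{ apply Cmod_gt_0; intros H0; apply Hne; unfold v in H0.
  replace w with (w - F z + F z)%C by ring; rewrite H0; ring. }
destruct (HF z (HinD z Hz)) as (A' & B' & (K' & d' & HK' & Hd' & HJ') & HAB').
(* D is the Jacobian at the minimiser; [t0] below solves A' t + B' conj(t) = v by Cramer's rule. *)
set (D := Cmod A' ^ 2 - Cmod B' ^ 2).
assert (HD : 0 < D).
{ unfold D; pose proof (Cmod_ge_0 B'); simpl; nra. }
set (t0 := ((Cconj A' * v - B' * Cconj v) / RtoC D)%C).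
assert (Ht0 : (A' * t0 + B' * Cconj t0 = v)%C).
{ assert (HDC : RtoC D = (A' * Cconj A' - B' * Cconj B')%C).
  { unfold D; rewrite RtoC_minus, !Cmod2_conj; reflexivity. }
  assert (HDn : RtoC D <> RtoC 0) by (intros H0; apply RtoC_inj in H0; lra).
  assert (HDr : Cconj (RtoC D) = RtoC D).
  { apply injective_projections; simpl; ring. }
  unfold t0; rewrite Cdiv_conj by exact HDn.
  rewrite HDr, Cminus_conj, !Cmult_conj, !Cconj_conj.
  replace (A' * ((Cconj A' * v - B' * Cconj v) / RtoC D) +
           B' * ((A' * Cconj v - Cconj B' * v) / RtoC D))%C
    with ((A' * Cconj A' - B' * Cconj B') / RtoC D * v)%C by (field; exact HDn).
  rewrite <- HDC; field; exact HDn. }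
pose proof (Cmod_ge_0 t0) as Ht0p.
set (Q := K' * Cmod t0 ^ 2).
assert (HQ : 0 <= Q) by (apply Rmult_le_pos; [exact HK'|apply pow2_ge_0]).
(* The step s t0 leaves distance (1 - s) |v| to w up to an error s^2 Q, so s Q < |v| makes it
   strictly closer, against minimality. *)
assert (exists s, 0 < s /\ s < 1 /\ s * Cmod t0 < d' /\ s * Cmod t0 < e - Cmod (z - z0)%C
          /\ s * Q < Cmod v) as (s & Hs0 & Hs1 & Hs2 & Hs3 & Hs4).
{ set (m := Rmin d' (Rmin (e - Cmod (z - z0)%C) (Cmod v))).
  assert (Hm : 0 < m) by (repeat apply Rmin_glb_lt; lra).
  assert (Hm1 : m <= d') by apply Rmin_l.
  assert (Hm2 : m <= e - Cmod (z - z0)%C) by (eapply Rle_trans; [apply Rmin_r|apply Rmin_l]).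
  assert (Hm3 : m <= Cmod v) by (eapply Rle_trans; [apply Rmin_r|apply Rmin_r]).
  exists (m / (m + Cmod t0 + Q + 1)).
  assert (Hden : 0 < m + Cmod t0 + Q + 1) by lra.
  assert (Hsm : m / (m + Cmod t0 + Q + 1) * (m + Cmod t0 + Q + 1) = m) by (field; lra).
  assert (Hs : 0 < m / (m + Cmod t0 + Q + 1)) by (apply Rdiv_lt_0_compat; lra).
  set (s := m / (m + Cmod t0 + Q + 1)) in *.
  repeat split; nra. }
assert (Hst : Cmod (RtoC s * t0)%C = s * Cmod t0) by (rewrite Cmod_mult, Cmod_R, Rabs_pos_eq; lra).
assert (Hin : Cmod (z + RtoC s * t0 - z0)%C <= e).
{ replace (z + RtoC s * t0 - z0)%C with (z - z0 + RtoC s * t0)%C by ring.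
  eapply Rle_trans; [apply Cmod_triangle|]; lra. }
specialize (Hmax _ Hin); specialize (HJ' (RtoC s * t0)%C ltac:(lra)).
assert (Hlin : (A' * (RtoC s * t0) + B' * Cconj (RtoC s * t0) = RtoC s * v)%C).
{ rewrite <- Ht0, Cmult_conj.
  replace (Cconj (RtoC s)) with (RtoC s) by (apply injective_projections; simpl; ring).
  ring. }
pose proof (Cmod_triangle (F (z + RtoC s * t0) - (F z + A' * (RtoC s * t0) + B' * Cconj (RtoC s * t0)))%C
             (- (RtoC (1 - s) * v))%C) as H1.
replace (F z + A' * (RtoC s * t0) + B' * Cconj (RtoC s * t0))%C
  with (F z + (A' * (RtoC s * t0) + B' * Cconj (RtoC s * t0)))%C in H1, HJ' by ring.
rewrite Hlin in H1, HJ'.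
replace (F (z + RtoC s * t0) - (F z + RtoC s * v) + - (RtoC (1 - s) * v))%C
  with (F (z + RtoC s * t0) - w)%C in H1 by (unfold v; rewrite RtoC_minus; ring).
rewrite Cmod_opp, (Cmod_mult (RtoC (1 - s))), Cmod_R, (Rabs_pos_eq (1 - s)) in H1 by lra.
replace (F z - w)%C with (- v)%C in Hmax by (unfold v; ring).
rewrite Cmod_opp in Hmax.
rewrite Hst in HJ'.
replace (K' * (s * Cmod t0) ^ 2) with (s * (s * Q)) in HJ' by (unfold Q; ring).
nra.
Qed.

(** * Stable convex maps *)

Lemma choose_fun {T U : Type} (P : T -> U -> Prop) :
  (forall x, exists y, P x y) -> exists f, forall x, P x (f x).
Proof.
intros H; exists (fun x => proj1_sig (constructive_indefinite_description _ (H x))).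
intros x; exact (proj2_sig (constructive_indefinite_description _ (H x))).
Qed.

Lemma Cconj_R (x : R) : Cconj (RtoC x) = RtoC x.
Proof. apply injective_projections; simpl; ring. Qed.

Lemma Cmod1_conj (e : C) : Cmod e = 1 -> (e * Cconj e)%C = RtoC 1.
Proof. intros H; rewrite <- Cmod2_conj, H; apply f_equal; ring. Qed.

Lemma Re_Im_eq (x y : C) : Re x = Re y -> Im x = Im y -> x = y.
Proof. intros; apply injective_projections; assumption. Qed.

(** Translates [sense_preserving_D], stated through [fz] and [fzbar], into |g'| < |h'| for the
    derivatives given by the series. *)
Lemma pair_jets (a b : nat -> C) (h g : C -> C) (z : C) :
  PS a h -> PS b g -> sense_preserving_D (fun z => h z + Cconj (g z))%C -> inD z ->
  exists A B A2 B2, csum (fun n => a n * pd1 z n)%C A /\ csum (fun n => b n * pd1 z n)%C B /\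
    jet2_at h z A A2 /\ jet2_at g z B B2 /\ Cmod B < Cmod A.
Proof.
intros Hh Hg Hsp Hz.
destruct (PS_jet2 a h z Hh Hz) as (A & A2 & HA & HjA).
destruct (PS_jet2 b g z Hg Hz) as (B & B2 & HB & HjB).
exists A, B, A2, B2; repeat (split; [assumption|]).
assert (HJ := hjet_plus _ _ _ _ _ _ _ (jet2_hjet _ _ _ _ HjA) (hjet_conj _ _ _ _ (jet2_hjet _ _ _ _ HjB))).
destruct (hjet_fz _ _ _ _ HJ) as [H1 H2].
specialize (Hsp z Hz); rewrite H1, H2 in Hsp.
rewrite Cconj_R, Cplus_0_r, Cplus_0_l, Cmod_conj in Hsp; exact Hsp.
Qed.

Lemma stable_harmonic_jet (a b : nat -> C) (h g : C -> C) (mu : C) :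
  PS a h -> PS b g -> sense_preserving_D (fun z => h z + Cconj (g z))%C -> Cmod mu = 1 ->
  forall z, inD z -> exists A B, hjet (fun z => h z + mu * Cconj (g z))%C z A B /\ Cmod B < Cmod A.
Proof.
intros Hh Hg Hsp Hmu z Hz.
destruct (pair_jets a b h g z Hh Hg Hsp Hz) as (A & B & A2 & B2 & _ & _ & HA & HB & HAB).
exists (A + mu * Cconj (RtoC 0))%C, (RtoC 0 + mu * Cconj B)%C; split.
- apply (hjet_plus h (fun z => mu * Cconj (g z))%C); [eapply jet2_hjet, HA|].
  apply hjet_scal, hjet_conj; eapply jet2_hjet, HB.
- rewrite Cconj_R, Cmult_0_r, Cplus_0_r, Cplus_0_l, Cmod_mult, Cmod_conj, Hmu; lra.
Qed.

(** The derivative h' + la g' cannot vanish because |g'| < |h'| and |la| = 1. *)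
Lemma stable_analytic_jet (a b : nat -> C) (h g : C -> C) (la : C) :
  PS a h -> PS b g -> sense_preserving_D (fun z => h z + Cconj (g z))%C -> Cmod la = 1 ->
  forall z, inD z -> exists A A2, jet2_at (fun z => h z + la * g z)%C z A A2 /\ A <> RtoC 0.
Proof.
intros Hh Hg Hsp Hla z Hz.
destruct (pair_jets a b h g z Hh Hg Hsp Hz) as (A & B & A2 & B2 & _ & _ & HA & HB & HAB).
exists (A + la * B)%C, (A2 + la * B2)%C; split.
- destruct HA as (K & d & HK & Hd & H); destruct HB as (K' & d' & HK' & Hd' & H').
  exists (K + K'), (Rmin d d'); split; [lra|]; split; [now apply Rmin_glb_lt|].
  intros t Ht.
  specialize (H t (Rlt_le_trans _ _ _ Ht (Rmin_l _ _))).
  specialize (H' t (Rlt_le_trans _ _ _ Ht (Rmin_r _ _))).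
  replace (h (z + t) + la * g (z + t) - (h z + la * g z + (A + la * B) * t + (A2 + la * B2) * t ^ 2))%C
    with ((h (z + t)%C - (h z + A * t + A2 * t ^ 2)) + la * (g (z + t)%C - (g z + B * t + B2 * t ^ 2)))%C
    by ring.
  eapply Rle_trans; [apply Cmod_triangle|]; rewrite Cmod_mult, Hla; lra.
- intros H0; assert (HA0 : A = (- (la * B))%C).
  { replace A with (A + la * B - la * B)%C by ring; rewrite H0; ring. }
  rewrite HA0, Cmod_opp, Cmod_mult, Hla in HAB; lra.
Qed.

(** If h + la g takes equal values at z1 and z2, then h changes by - la v, where v is the change of
    g. For v different from 0 the unimodular mu = la v / conj(v) satisfies mu conj(v) = la v, so h +
    mu conj(g) takes equal values there too. *)
Lemma stable_analytic_injective (h g : C -> C) (la : C) :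
  stable_convex h g -> Cmod la = 1 -> univalent_D (fun z => h z + la * g z)%C.
Proof.
intros Hst Hla z1 z2 Hz1 Hz2 Heq.
set (v := (g z1 - g z2)%C).
assert (Hu : (h z1 - h z2 = - (la * v))%C).
{ unfold v; replace (h z1 - h z2)%C with ((h z1 + la * g z1) - (h z2 + la * g z2) - la * (g z1 - g z2))%C by ring.
  rewrite Heq; ring. }
destruct (classic (v = RtoC 0)) as [Hv|Hv].
- apply (proj1 (Hst (RtoC 1) Cmod_1) z1 z2 Hz1 Hz2); cbv beta.
  assert (Hg12 : g z1 = g z2) by (replace (g z1) with (v + g z2)%C by (unfold v; ring); rewrite Hv; ring).
  assert (Hh12 : h z1 = h z2).
  { replace (h z1) with (h z1 - h z2 + h z2)%C by ring; rewrite Hu, Hv; ring. }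
  rewrite Hg12, Hh12; reflexivity.
- assert (Hcv : Cconj v <> RtoC 0).
  { intros H0; apply Hv; rewrite <- (Cconj_conj v), H0; apply Cconj_R. }
  set (mu := (la * v / Cconj v)%C).
  assert (Hmu : Cmod mu = 1).
  { unfold mu; rewrite Cmod_div, Cmod_mult, Cmod_conj, Hla by exact Hcv.
    apply Cmod_gt_0 in Hv; field; lra. }
  apply (proj1 (Hst mu Hmu) z1 z2 Hz1 Hz2); cbv beta.
  assert (H0 : (h z1 - h z2 + mu * Cconj v = 0)%C).
  { rewrite Hu; unfold mu; field; exact Hcv. }
  unfold v in H0; rewrite Cminus_conj in H0; fold v in H0.
  replace (h z1 + mu * Cconj (g z1))%C
    with (h z1 - h z2 + mu * (Cconj (g z1) - Cconj (g z2)) + (h z2 + mu * Cconj (g z2)))%C by ring.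
  rewrite H0; ring.
Qed.

(* Shear construction: for a unit vector e and mu = - e^2 conj(lambda), the maps
   conj(e) (h + mu conj(g)) and conj(e) (h + lambda g) have the same imaginary part.
   Pulling back a segment of direction e in the convex image of the former gives a path
   in the disk on which the latter moves along a line of direction e. *)
Lemma stable_analytic_convex (a b : nat -> C) (h g : C -> C) (la : C) :
  PS a h -> PS b g -> sense_preserving_D (fun z => h z + Cconj (g z))%C ->
  stable_convex h g -> Cmod la = 1 -> convex_image_D (fun z => h z + la * g z)%C.
Proof.
intros Hh Hg Hsp Hst Hla z1 z2 t Hz1 Hz2 Ht.
set (Phi := fun z => (h z + la * g z)%C).
destruct (classic (Phi z1 = Phi z2)) as [Heq|Hne].
{ exists z1; split; [exact Hz1|]; fold (Phi z1) (Phi z2); rewrite <- Heq.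
  rewrite RtoC_minus; ring. }
set (v := (Phi z2 - Phi z1)%C).
assert (Hv : 0 < Cmod v).
{ apply Cmod_gt_0; intros H0; apply Hne.
  replace (Phi z2) with (v + Phi z1)%C by (unfold v; ring); rewrite H0; ring. }
set (e := (v / RtoC (Cmod v))%C).
assert (HvC : RtoC (Cmod v) <> RtoC 0) by (intros H0; apply RtoC_inj in H0; lra).
assert (He : Cmod e = 1).
{ unfold e; rewrite Cmod_div, Cmod_R, Rabs_pos_eq by (exact HvC || lra); field; lra. }
assert (Hev : v = (e * RtoC (Cmod v))%C) by (unfold e; field; exact HvC).
assert (Hee := Cmod1_conj e He).
set (mu := (- (e ^ 2 * Cconj la))%C).
assert (Hmu : Cmod mu = 1).
{ unfold mu; rewrite Cmod_opp, Cmod_mult, Cmod_pow, Cmod_conj, He, Hla; ring. }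
set (G := fun z => (h z + mu * Cconj (g z))%C).
destruct (Hst mu Hmu) as [HGinj HGconv].
assert (HIm : forall z, Im (Cconj e * G z) = Im (Cconj e * Phi z)).
{ intros z.
  replace (Cconj e * G z)%C with (Cconj e * h z - Cconj (Cconj e * la * g z))%C.
  - unfold Phi; replace (Cconj e * (h z + la * g z))%C with (Cconj e * h z + Cconj e * la * g z)%C by ring.
    unfold Im; simpl; ring.
  - unfold G, mu; rewrite !Cmult_conj, Cconj_conj.
    replace (Cconj e * (h z + - (e ^ 2 * Cconj la) * Cconj (g z)))%C
      with (Cconj e * h z - (e * Cconj e) * (e * Cconj la * Cconj (g z)))%C by ring.
    rewrite Hee; ring. }
(* Clamping to [0, 1] extends the path to all of R, as [IVT_gen] asks for continuity everywhere. *)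
set (cl := fun s => Rmax 0 (Rmin 1 s)).
assert (Hcl : forall s, 0 <= cl s <= 1).
{ intros s; unfold cl; split; [apply Rmax_l|]; apply Rmax_lub; [lra|apply Rmin_l]. }
assert (HclL : forall s s', Rabs (cl s - cl s') <= Rabs (s - s')).
{ intros s s'; unfold cl, Rmax, Rmin; repeat destruct (Rle_dec _ _);
    unfold Rabs; repeat destruct (Rcase_abs _); lra. }
destruct (choose_fun (fun s z => inD z /\
   G z = (RtoC (1 - cl s) * G z1 + RtoC (cl s) * G z2)%C)) as (Z & HZ).
{ intros s; apply (HGconv z1 z2 (cl s) Hz1 Hz2 (Hcl s)). }
set (u := fun s => Re (Cconj e * Phi (Z s))).
assert (Hu0 : Z 0 = z1).
{ apply HGinj; [apply HZ|exact Hz1|]; destruct (HZ 0) as [_ H]; unfold G in H; rewrite H.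
  replace (cl 0) with 0 by (unfold cl, Rmax, Rmin; repeat destruct (Rle_dec _ _); lra).
  rewrite Rminus_0_r; ring. }
assert (Hu1 : Z 1 = z2).
{ apply HGinj; [apply HZ|exact Hz2|]; destruct (HZ 1) as [_ H]; unfold G in H; rewrite H.
  replace (cl 1) with 1 by (unfold cl, Rmax, Rmin; repeat destruct (Rle_dec _ _); lra).
  replace (1 - 1) with 0 by ring; ring. }
(* Along the segment Z inverts the injective open map G, hence is continuous. *)
assert (Hcont : continuity u).
{ intros s0 eps Heps; destruct (HZ s0) as [HD0 HG0].
  destruct (stable_analytic_jet a b h g la Hh Hg Hsp Hla (Z s0) HD0) as (A & A2 & HA & _).
  destruct (hjet_cont _ _ _ _ (jet2_hjet _ _ _ _ HA)) as (L & d & HL & Hd & HLip).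
  assert (Heps' : 0 < Rmin d (eps / (L + 1))).
  { apply Rmin_glb_lt; [exact Hd|apply Rdiv_lt_0_compat; lra]. }
  destruct (hjet_open G (Z s0) _ (stable_harmonic_jet a b h g mu Hh Hg Hsp Hmu) HD0 Heps') as (dl & Hdl & Hopen).
  set (M := Cmod (G z2 - G z1)%C); assert (HM : 0 <= M) by apply Cmod_ge_0.
  exists (dl / (M + 1)); split; [apply Rdiv_lt_0_compat; lra|].
  intros s [_ Hs]; simpl in Hs |- *; unfold R_dist, Rdist in Hs |- *.
  destruct (HZ s) as [HDs HGs].
  destruct (Hopen (G (Z s))) as (z & HDz & Hzs & HGz).
  { rewrite HGs, HG0.
    replace (RtoC (1 - cl s) * G z1 + RtoC (cl s) * G z2 - (RtoC (1 - cl s0) * G z1 + RtoC (cl s0) * G z2))%C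
      with (RtoC (cl s - cl s0) * (G z2 - G z1))%C by (rewrite !RtoC_minus; ring).
    rewrite Cmod_mult, Cmod_R; fold M.
    pose proof (HclL s s0) as H1; pose proof (Rabs_pos (cl s - cl s0)).
    apply (Rmult_lt_compat_r (M + 1)) in Hs; [|lra].
    replace (dl / (M + 1) * (M + 1)) with dl in Hs by (field; lra).
    nra. }
  assert (Hzeq : z = Z s) by (apply HGinj; assumption).
  rewrite Hzeq in Hzs.
  specialize (HLip (Z s) (Rlt_le_trans _ _ _ Hzs (Rmin_l _ _))).
  pose proof (Rlt_le_trans _ _ _ Hzs (Rmin_r _ _)) as Hz2'.
  apply (Rmult_lt_compat_l (L + 1)) in Hz2'; [|lra].
  replace ((L + 1) * (eps / (L + 1))) with eps in Hz2' by (field; lra).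
  fold (Phi (Z s)) in HLip; fold (Phi (Z s0)) in HLip.
  pose proof (re_le_Cmod (Cconj e * (Phi (Z s) - Phi (Z s0)))%C) as H1.
  rewrite Cmod_mult, Cmod_conj, He in H1.
  replace (u s - u s0) with (Re (Cconj e * (Phi (Z s) - Phi (Z s0)))%C)
    by (unfold u, Re; simpl; ring).
  pose proof (Cmod_ge_0 (Z s - Z s0)%C); nra. }
(* After rotation by conj(e), Phi z1 and Phi z2 have the same imaginary part and the path keeps it,
   so only the real part remains to be matched. *)
set (x := (1 - t) * u 0 + t * u 1).
destruct (IVT_gen u 0 1 x Hcont) as (s & _ & Hs).
{ unfold x, Rmin, Rmax; repeat destruct (Rle_dec _ _); nra. }
exists (Z s); split; [apply HZ|].
fold (Phi (Z s)) (Phi z1) (Phi z2).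
assert (Hce : (Cconj e * v)%C = RtoC (Cmod v)).
{ rewrite Hev at 1; replace (Cconj e * (e * RtoC (Cmod v)))%C with (e * Cconj e * RtoC (Cmod v))%C by ring.
  rewrite Hee; ring. }
assert (HIm12 : Im (Cconj e * Phi z2) = Im (Cconj e * Phi z1)).
{ assert (H := f_equal Im Hce); unfold v, Im in H; simpl in H; unfold Im; simpl; lra. }
assert (Hmain : (Cconj e * Phi (Z s))%C =
                (Cconj e * (RtoC (1 - t) * Phi z1 + RtoC t * Phi z2))%C).
{ apply Re_Im_eq.
  - fold (u s); rewrite Hs; unfold x, u; rewrite Hu0, Hu1; unfold Re; simpl; ring.
  - rewrite <- HIm, (proj2 (HZ s)).
    replace (Im (Cconj e * (RtoC (1 - cl s) * G z1 + RtoC (cl s) * G z2))%C)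
      with ((1 - cl s) * Im (Cconj e * G z1) + cl s * Im (Cconj e * G z2)) by (unfold Im; simpl; ring).
    replace (Im (Cconj e * (RtoC (1 - t) * Phi z1 + RtoC t * Phi z2))%C)
      with ((1 - t) * Im (Cconj e * Phi z1) + t * Im (Cconj e * Phi z2)) by (unfold Im; simpl; ring).
    rewrite !HIm, HIm12; ring. }
apply (f_equal (Cmult e)) in Hmain; rewrite !Cmult_assoc, Hee, !Cmult_1_l in Hmain; exact Hmain.
Qed.

(** * Maximum principle and Schwarz's lemma *)

Definition has_jet2 (f : C -> C) (z : C) : Prop := exists A B, jet2_at f z A B.

Lemma jet2_mult f f' z : has_jet2 f z -> has_jet2 f' z -> has_jet2 (fun w => f w * f' w)%C z.
Proof.
intros (A & B & K & d & HK & Hd & H) (A' & B' & K' & d' & HK' & Hd' & H').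
exists (A * f' z + f z * A')%C, (B * f' z + A * A' + f z * B')%C.
set (W := Cmod (f z) + Cmod A + Cmod B); set (W' := Cmod (f' z) + Cmod A' + Cmod B').
pose proof (Cmod_ge_0 (f z)); pose proof (Cmod_ge_0 A); pose proof (Cmod_ge_0 B).
pose proof (Cmod_ge_0 (f' z)); pose proof (Cmod_ge_0 A'); pose proof (Cmod_ge_0 B').
assert (HW : 0 <= W) by (unfold W; lra). assert (HW' : 0 <= W') by (unfold W'; lra).
exists (2 * (W * W') + W * K' + K * W' + K * K'), (Rmin 1 (Rmin d d')).
split; [pose proof (Rmult_le_pos _ _ HW HW'); pose proof (Rmult_le_pos _ _ HW HK');
        pose proof (Rmult_le_pos _ _ HK HW'); pose proof (Rmult_le_pos _ _ HK HK'); lra|].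
split; [repeat apply Rmin_glb_lt; lra|]; intros t Ht.
pose proof (Rlt_le_trans _ _ _ Ht (Rmin_l _ _)) as Ht1.
assert (Htd := Rlt_le_trans _ _ _ Ht (Rmin_r _ _)).
specialize (H t (Rlt_le_trans _ _ _ Htd (Rmin_l _ _))).
specialize (H' t (Rlt_le_trans _ _ _ Htd (Rmin_r _ _))).
set (E := (f (z + t) - (f z + A * t + B * t ^ 2))%C) in *.
set (E' := (f' (z + t) - (f' z + A' * t + B' * t ^ 2))%C) in *.
set (P := (f z + A * t + B * t ^ 2)%C) in *.
set (P' := (f' z + A' * t + B' * t ^ 2)%C) in *.
set (x := Cmod t) in *; assert (Hx : 0 <= x) by apply Cmod_ge_0.
assert (HP : forall a b c w, Cmod a + Cmod b + Cmod c = w -> Cmod (a + b * t + c * t ^ 2)%C <= w).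
{ intros a b c w <-; eapply Rle_trans; [apply Cmod_triangle|]; apply Rplus_le_compat.
  - eapply Rle_trans; [apply Cmod_triangle|]; rewrite Cmod_mult; fold x.
    pose proof (Cmod_ge_0 b); nra.
  - rewrite Cmod_mult, Cmod_pow; fold x; pose proof (Cmod_ge_0 c).
    rewrite <- (Rmult_1_r (Cmod c)) at 2; apply Rmult_le_compat_l; [lra|simpl; nra]. }
assert (HPW : Cmod P <= W) by (apply HP; reflexivity).
assert (HPW' : Cmod P' <= W') by (apply HP; reflexivity).
replace (f (z + t) * f' (z + t) - (f z * f' z + (A * f' z + f z * A') * t +
          (B * f' z + A * A' + f z * B') * t ^ 2))%C
  with ((A * B' + B * A' + B * B' * t) * t ^ 3 + P * E' + E * P' + E * E')%C
  by (unfold E, E', P, P'; ring).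
assert (Hx3 : 0 <= x ^ 3 <= 1).
{ split; [apply pow_le, Hx|]; rewrite <- (pow1 3); apply pow_incr; lra. }
assert (T1 : Cmod ((A * B' + B * A' + B * B' * t) * t ^ 3)%C <= 2 * (W * W') * x ^ 3).
{ rewrite Cmod_mult, Cmod_pow; fold x; apply Rmult_le_compat_r; [lra|].
  eapply Rle_trans; [apply Cmod_triangle|]; rewrite !Cmod_mult; fold x.
  eapply Rle_trans; [apply Rplus_le_compat_r, Cmod_triangle|]; rewrite !Cmod_mult.
  unfold W, W'.
  assert (Cmod B * Cmod B' * x <= Cmod B * Cmod B').
  { rewrite <- (Rmult_1_r (Cmod B * Cmod B')) at 2; apply Rmult_le_compat_l; [|lra].
    now apply Rmult_le_pos. }
  nra. }
assert (T2 : Cmod (P * E')%C <= W * K' * x ^ 3).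
{ rewrite Cmod_mult, Rmult_assoc; apply Rmult_le_compat; try apply Cmod_ge_0; assumption. }
assert (T3 : Cmod (E * P')%C <= K * W' * x ^ 3).
{ rewrite Cmod_mult; replace (K * W' * x ^ 3) with (K * x ^ 3 * W') by ring.
  apply Rmult_le_compat; try apply Cmod_ge_0; assumption. }
assert (T4 : Cmod (E * E')%C <= K * K' * x ^ 3).
{ rewrite Cmod_mult; apply Rle_trans with (K * x ^ 3 * (K' * x ^ 3)).
  - apply Rmult_le_compat; try apply Cmod_ge_0; assumption.
  - replace (K * x ^ 3 * (K' * x ^ 3)) with (K * K' * x ^ 3 * x ^ 3) by ring.
    rewrite <- (Rmult_1_r (K * K' * x ^ 3)) at 2; apply Rmult_le_compat_l; [|lra].
    apply Rmult_le_pos; [now apply Rmult_le_pos|lra]. }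
eapply Rle_trans; [apply Cmod_triangle|].
eapply Rle_trans; [apply Rplus_le_compat_r, Cmod_triangle|].
eapply Rle_trans; [apply Rplus_le_compat_r, Rplus_le_compat_r, Cmod_triangle|].
lra.
Qed.

Lemma jet2_const c z : has_jet2 (fun _ => c) z.
Proof.
exists (RtoC 0), (RtoC 0), 0, 1; repeat split; try lra; intros t _.
replace (c - (c + RtoC 0 * t + RtoC 0 * t ^ 2))%C with (RtoC 0) by ring; rewrite Cmod_0; lra.
Qed.

Lemma jet2_id z : has_jet2 (fun w => w) z.
Proof.
exists (RtoC 1), (RtoC 0), 0, 1; repeat split; try lra; intros t _.
replace (z + t - (z + RtoC 1 * t + RtoC 0 * t ^ 2))%C with (RtoC 0) by ring; rewrite Cmod_0; lra.
Qed.

Lemma jet2_pow f n z : has_jet2 f z -> has_jet2 (fun w => f w ^ n)%C z.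
Proof.
intros H; induction n as [|n IH]; [exact (jet2_const (RtoC 1) z)|].
apply (jet2_mult f (fun w => f w ^ n)%C); assumption.
Qed.

Lemma jet2_inv z : z <> RtoC 0 -> has_jet2 Cinv z.
Proof.
intros Hz; pose proof (proj1 (Cmod_gt_0 z) Hz) as Hz0.
exists (- / z ^ 2)%C, (/ z ^ 3)%C, (2 / Cmod z ^ 4), (Cmod z / 2).
assert (0 < Cmod z ^ 4) by (apply pow_lt; lra).
split; [apply Rlt_le, Rdiv_lt_0_compat; lra|]; split; [lra|]; intros t Ht.
assert (Hzt : Cmod z / 2 <= Cmod (z + t)%C).
{ pose proof (Cmod_triangle (z + t)%C (- t)%C) as H1.
  rewrite Cmod_opp in H1; replace (z + t + - t)%C with z in H1 by ring; lra. }
assert (Hztn : (z + t)%C <> RtoC 0) by (apply Cmod_gt_0; lra).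
replace (/ (z + t) - (/ z + - / z ^ 2 * t + / z ^ 3 * t ^ 2))%C
  with (- (t ^ 3 / (z ^ 3 * (z + t))))%C by (field; split; assumption).
assert (Hz3 : (z ^ 3)%C <> RtoC 0) by now apply Cpow_nz.
rewrite Cmod_opp, Cmod_div by now apply Cmult_neq_0.
rewrite Cmod_mult, !Cmod_pow.
assert (0 < Cmod z ^ 3) by (apply pow_lt; lra).
unfold Rdiv; rewrite Rmult_comm; apply Rmult_le_compat_r; [apply pow_le, Cmod_ge_0|].
apply Rle_trans with (/ (Cmod z ^ 3 * (Cmod z / 2))).
- apply Rinv_le_contravar; [apply Rmult_lt_0_compat; lra|apply Rmult_le_compat_l; lra].
- apply Req_le; field; lra.
Qed.

Lemma has_jet2_cont f z eps : has_jet2 f z -> 0 < eps ->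
  exists d, 0 < d /\ forall w, Cmod (w - z)%C < d -> Cmod (f w - f z)%C < eps.
Proof.
intros (A & B & H) Heps; apply jet2_hjet, hjet_cont in H.
destruct H as (L & d & HL & Hd & H).
exists (Rmin d (eps / (L + 1))); split.
{ apply Rmin_glb_lt; [exact Hd|apply Rdiv_lt_0_compat; lra]. }
intros w Hw; specialize (H w (Rlt_le_trans _ _ _ Hw (Rmin_l _ _))).
pose proof (Rlt_le_trans _ _ _ Hw (Rmin_r _ _)) as Hw2.
apply (Rmult_lt_compat_l (L + 1)) in Hw2; [|lra].
replace ((L + 1) * (eps / (L + 1))) with eps in Hw2 by (field; lra).
pose proof (Cmod_ge_0 (w - z)%C); nra.
Qed.

(* |chi|^2 + eps |z|^2 strictly exceeds its value at the centre on average over the four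
   points z + rho i^k, because the cross terms of the 2-jet cancel. *)
Lemma jet2_not_local_max (chi : C -> C) (z : C) (eps d : R) :
  has_jet2 chi z -> 0 < eps -> 0 < d ->
  exists t, Cmod t < d /\
    Cmod (chi z) ^ 2 + eps * Cmod z ^ 2 < Cmod (chi (z + t)%C) ^ 2 + eps * Cmod (z + t)%C ^ 2.
Proof.
intros (A & B & K & d' & HK & Hd' & H) Heps Hd.
apply NNPP; intros Hno.
assert (Hle : forall t, Cmod t < d -> Cmod (chi (z + t)%C) ^ 2 + eps * Cmod (z + t)%C ^ 2 <=
   Cmod (chi z) ^ 2 + eps * Cmod z ^ 2).
{ intros t Ht; apply Rnot_lt_le; intros Hlt; apply Hno; exists t; auto. }
set (W := Cmod (chi z) + Cmod A + Cmod B).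
pose proof (Cmod_ge_0 (chi z)); pose proof (Cmod_ge_0 A); pose proof (Cmod_ge_0 B).
assert (HW : 0 <= W) by (unfold W; lra).
assert (HWK : 0 <= W * K) by now apply Rmult_le_pos.
(* Chosen so that the cubic error 2 W K rho^3 at each point stays below the gain eps rho^2 of the
   perturbation. *)
set (rho := Rmin (Rmin 1 (eps / (2 * (W * K) + 1))) (Rmin d d') / 2).
assert (Hm : 0 < Rmin (Rmin 1 (eps / (2 * (W * K) + 1))) (Rmin d d')).
{ repeat apply Rmin_glb_lt; try lra; apply Rdiv_lt_0_compat; lra. }
assert (Hr0 : 0 < rho) by (unfold rho; lra).
assert (Hr1 : rho < 1 /\ rho < eps / (2 * (W * K) + 1) /\ rho < d /\ rho < d').
{ unfold rho; set (M := Rmin _ _) in *.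
  assert (M <= Rmin 1 (eps / (2 * (W * K) + 1))) by apply Rmin_l.
  assert (M <= Rmin d d') by apply Rmin_r.
  pose proof (Rmin_l 1 (eps / (2 * (W * K) + 1))); pose proof (Rmin_r 1 (eps / (2 * (W * K) + 1))).
  pose proof (Rmin_l d d'); pose proof (Rmin_r d d'); repeat split; lra. }
destruct Hr1 as (Hr1 & Hr2 & Hr3 & Hr4).
assert (Hr5 : 2 * (W * K) * rho < eps).
{ apply (Rmult_lt_compat_l (2 * (W * K) + 1)) in Hr2; [|lra].
  replace ((2 * (W * K) + 1) * (eps / (2 * (W * K) + 1))) with eps in Hr2 by (field; lra).
  lra. }
assert (Hlow : forall t, Cmod t = rho ->
   Cmod (chi z + A * t + B * t ^ 2)%C ^ 2 - 2 * (W * K) * rho ^ 3 + eps * Cmod (z + t)%C ^ 2 <=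
   Cmod (chi z) ^ 2 + eps * Cmod z ^ 2).
{ intros t Ht; eapply Rle_trans; [|apply (Hle t); lra]; apply Rplus_le_compat_r.
  specialize (H t ltac:(lra)); rewrite Ht in H.
  set (P := (chi z + A * t + B * t ^ 2)%C) in *.
  pose proof (Cmod_triangle (chi (z + t)%C) (- (chi (z + t)%C - P))%C) as HPt.
  rewrite Cmod_opp in HPt; replace (chi (z + t) + - (chi (z + t) - P))%C with P in HPt by ring.
  assert (HP : Cmod P <= W).
  { unfold P, W; eapply Rle_trans; [apply Cmod_triangle|].
    eapply Rle_trans; [apply Rplus_le_compat_r, Cmod_triangle|].
    rewrite !Cmod_mult, Cmod_pow, Ht.
    assert (Hrr : rho ^ 2 <= 1) by (simpl; nra).
    assert (Cmod A * rho <= Cmod A * 1) by (apply Rmult_le_compat_l; lra).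
    assert (Cmod B * rho ^ 2 <= Cmod B * 1) by (apply Rmult_le_compat_l; lra).
    lra. }
  pose proof (Cmod_ge_0 P); pose proof (Cmod_ge_0 (chi (z + t)%C)).
  pose proof (Cmod_ge_0 (chi (z + t)%C - P)%C).
  assert (Hr6 : 0 <= rho ^ 3) by (apply pow_le; lra).
  assert (HE : Cmod P * (K * rho ^ 3) <= W * (K * rho ^ 3)).
  { apply Rmult_le_compat_r; [now apply Rmult_le_pos|exact HP]. }
  (* Squaring |P| - K rho^3 <= |chi (z + t)| needs a nonnegative left side; otherwise |P|^2 <= W K
     rho^3 and the claim is trivial. *)
  destruct (Rle_lt_dec (Cmod P) (K * rho ^ 3)); simpl in *; nra. }
assert (Hmod : Cmod (RtoC rho) = rho) by (rewrite Cmod_R, Rabs_pos_eq; lra).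
pose proof (Hlow (RtoC rho) Hmod) as L1.
pose proof (Hlow (- RtoC rho)%C ltac:(now rewrite Cmod_opp)) as L2.
pose proof (Hlow (Ci * RtoC rho)%C ltac:(now rewrite Cmod_mult, Cmod_Ci, Hmod, Rmult_1_l)) as L3.
pose proof (Hlow (- (Ci * RtoC rho))%C
  ltac:(now rewrite Cmod_opp, Cmod_mult, Cmod_Ci, Hmod, Rmult_1_l)) as L4.
assert (Hsum :
  Cmod (chi z + A * RtoC rho + B * RtoC rho ^ 2)%C ^ 2 +
  Cmod (chi z + A * - RtoC rho + B * (- RtoC rho) ^ 2)%C ^ 2 +
  Cmod (chi z + A * (Ci * RtoC rho) + B * (Ci * RtoC rho) ^ 2)%C ^ 2 +
  Cmod (chi z + A * - (Ci * RtoC rho) + B * (- (Ci * RtoC rho)) ^ 2)%C ^ 2 =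
  4 * (Cmod (chi z) ^ 2 + Cmod A ^ 2 * rho ^ 2 + Cmod B ^ 2 * rho ^ 4)).
{ rewrite !Cmod2_alt; generalize (chi z); intros c; unfold Re, Im; simpl; ring. }
assert (Hsum2 :
  Cmod (z + RtoC rho)%C ^ 2 + Cmod (z + - RtoC rho)%C ^ 2 +
  Cmod (z + Ci * RtoC rho)%C ^ 2 + Cmod (z + - (Ci * RtoC rho))%C ^ 2 =
  4 * (Cmod z ^ 2 + rho ^ 2)).
{ rewrite !Cmod2_alt; unfold Re, Im; simpl; ring. }
assert (Hp1 : 0 <= Cmod A ^ 2 * rho ^ 2) by (apply Rmult_le_pos; apply pow2_ge_0).
assert (Hp2 : 0 <= Cmod B ^ 2 * rho ^ 4)
  by (apply Rmult_le_pos; [apply pow2_ge_0|apply pow_le; lra]).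
assert (Hp3 : 0 < rho ^ 2) by (apply pow_lt; lra).
assert (Hp4 : 2 * (W * K) * rho ^ 3 < eps * rho ^ 2).
{ replace (2 * (W * K) * rho ^ 3) with (2 * (W * K) * rho * rho ^ 2) by ring.
  now apply Rmult_lt_compat_r. }
nra.
Qed.

(** At a point violating the bound |chi| > M >= 0, so jets are demanded only where chi does not
    vanish. A zero of chi, such as the one at 0 in [schwarz], needs mere continuity. *)
Lemma max_modulus (chi : C -> C) (r M : R) :
  0 <= r -> 0 <= M ->
  (forall u, Cmod u <= r -> forall eps, 0 < eps ->
     exists d, 0 < d /\ forall z, Cmod (z - u)%C < d -> Cmod (chi z - chi u)%C < eps) ->
  (forall z, Cmod z < r -> chi z <> RtoC 0 -> has_jet2 chi z) ->
  (forall z, Cmod z = r -> Cmod (chi z) <= M) ->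
  forall z, Cmod z <= r -> Cmod (chi z) <= M.
Proof.
intros Hr HM Hcont Hjet Hbd z0 Hz0; apply Rnot_lt_le; intros Hlt.
(* The term eps |z|^2 is at most eps r^2, too small to close the gap between M^2 and |chi z0|^2; so
   the maximiser of the perturbed function still has |chi| > M and lies off the circle. *)
set (eps := (Cmod (chi z0) ^ 2 - M ^ 2) / (2 * (r ^ 2 + 1))).
pose proof (pow2_ge_0 r) as Hr2.
assert (HM2 : M ^ 2 < Cmod (chi z0) ^ 2) by (simpl; nra).
assert (Heps : 0 < eps) by (apply Rdiv_lt_0_compat; lra).
assert (Hepsr : M ^ 2 + eps * r ^ 2 < Cmod (chi z0) ^ 2).
{ assert (eps * (2 * (r ^ 2 + 1)) = Cmod (chi z0) ^ 2 - M ^ 2) by (unfold eps; field; lra). nra. }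
assert (HCr : forall z : C, (z - RtoC 0)%C = z) by (intros z; ring).
destruct (disk_max (RtoC 0) r (fun z => Cmod (chi z) ^ 2 + eps * Cmod z ^ 2)) as (u & Hu & Hmax);
  [exact Hr| |].
{ intros u Hu ep Hep; rewrite HCr in Hu.
  set (w := Cmod (chi u)); assert (Hw : 0 <= w) by apply Cmod_ge_0.
  pose proof (Cmod_ge_0 u) as Hu0.
  set (dl := Rmin 1 (ep / (2 * (2 * w + 1 + eps * (2 * Cmod u + 1))))).
  assert (HS : 0 < 2 * (2 * w + 1 + eps * (2 * Cmod u + 1))) by nra.
  assert (Hdl : 0 < dl) by (apply Rmin_glb_lt; [lra|apply Rdiv_lt_0_compat; lra]).
  assert (Hdl1 : dl <= 1) by apply Rmin_l.
  assert (Hdl2 : dl * (2 * (2 * w + 1 + eps * (2 * Cmod u + 1))) <= ep).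
  { apply Rle_trans with (ep / (2 * (2 * w + 1 + eps * (2 * Cmod u + 1))) *
      (2 * (2 * w + 1 + eps * (2 * Cmod u + 1)))).
    - apply Rmult_le_compat_r; [lra|apply Rmin_r].
    - apply Req_le; field; lra. }
  destruct (Hcont u Hu dl Hdl) as (d & Hd & H).
  exists (Rmin d dl); split; [now apply Rmin_glb_lt|]; intros z Hz _.
  specialize (H z (Rlt_le_trans _ _ _ Hz (Rmin_l _ _))).
  pose proof (Rlt_le_trans _ _ _ Hz (Rmin_r _ _)) as Hz1.
  assert (Hc1 : Cmod (chi z) <= w + dl).
  { replace (chi z) with (chi u + (chi z - chi u))%C by ring.
    eapply Rle_trans; [apply Cmod_triangle|]; unfold w; lra. }
  assert (Hc2 : Cmod z <= Cmod u + dl).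
  { replace z with (u + (z - u))%C at 1 by ring.
    eapply Rle_trans; [apply Cmod_triangle|]; lra. }
  assert (Hq1 : Cmod (chi z) ^ 2 <= (w + dl) ^ 2) by (apply pow_incr; split; [apply Cmod_ge_0|exact Hc1]).
  assert (Hq2 : Cmod z ^ 2 <= (Cmod u + dl) ^ 2) by (apply pow_incr; split; [apply Cmod_ge_0|exact Hc2]).
  assert (Hq3 : (w + dl) ^ 2 <= w ^ 2 + dl * (2 * w + 1)) by (simpl; nra).
  assert (Hq4 : (Cmod u + dl) ^ 2 <= Cmod u ^ 2 + dl * (2 * Cmod u + 1)) by (simpl; nra).
  apply (Rmult_le_compat_l eps) in Hq2; [|lra]; apply (Rmult_le_compat_l eps) in Hq4; [|lra].
  lra. }
rewrite HCr in Hu.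
assert (Hz0' := Hmax z0); rewrite HCr in Hz0'; specialize (Hz0' Hz0).
assert (Hu2 : Cmod u ^ 2 <= r ^ 2) by (apply pow_incr; split; [apply Cmod_ge_0|exact Hu]).
assert (Hchi : M ^ 2 < Cmod (chi u) ^ 2).
{ apply (Rmult_le_compat_l eps) in Hu2; [|lra].
  pose proof (Rmult_le_pos eps (Cmod z0 ^ 2) (Rlt_le _ _ Heps) (pow2_ge_0 _)); lra. }
assert (HMchi : M < Cmod (chi u)).
{ apply Rnot_le_lt; intros Hle.
  assert (Cmod (chi u) ^ 2 <= M ^ 2) by (apply pow_incr; split; [apply Cmod_ge_0|exact Hle]); lra. }
assert (Hult : Cmod u < r).
{ destruct (Rle_lt_or_eq_dec _ _ Hu) as [|Heq]; [assumption|]; specialize (Hbd u Heq); lra. }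
assert (Hju : has_jet2 chi u) by (apply Hjet; [exact Hult|apply Cmod_gt_0; lra]).
destruct (jet2_not_local_max chi u eps (r - Cmod u) Hju Heps ltac:(lra)) as (t & Ht & Hgt).
specialize (Hmax (u + t)%C); rewrite HCr in Hmax.
assert (Cmod (u + t)%C <= r) by (eapply Rle_trans; [apply Cmod_triangle|]; lra).
specialize (Hmax H); lra.
Qed.

Lemma bernoulli_one_minus (x : R) (n : nat) : 0 <= x <= 1 -> 1 - INR n * x <= (1 - x) ^ n.
Proof.
intros Hx; induction n as [|n IH]; [simpl; lra|].
rewrite S_INR; simpl pow; pose proof (pos_INR n).
apply Rle_trans with ((1 - x) * (1 - INR n * x)); [nra|].
apply Rmult_le_compat_l; lra.
Qed.

(** Bernoulli's inequality at 1 - 1 / (2 (n + 1)). It allows a circle to be chosen after the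
    exponent, with the power on it still bounded below. *)
Lemma exists_pow_ge_half (n : nat) : exists s, 0 < s < 1 /\ forall x, s <= x -> / 2 <= x ^ n.
Proof.
pose proof (pos_INR n) as Hn.
assert (Hi : 0 < / (2 * (INR n + 1)) <= / 2).
{ split; [apply Rinv_0_lt_compat; lra|apply Rinv_le_contravar; lra]. }
exists (1 - / (2 * (INR n + 1))); split; [lra|]; intros x Hx.
apply Rle_trans with ((1 - / (2 * (INR n + 1))) ^ n); [|apply pow_incr; lra].
eapply Rle_trans; [|apply bernoulli_one_minus; lra].
assert (INR n * / (2 * (INR n + 1)) <= / 2); [|lra].
apply (Rmult_le_reg_r (2 * (INR n + 1))); [lra|].
rewrite Rmult_assoc, Rinv_l by lra; lra.
Qed.

(* Maximum principle for phi^k z / z^(m k), which vanishes at 0, followed by k -> infinity. *)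
Lemma schwarz (phi : C -> C) (m : nat) (C0 d0 : R) :
  (1 <= m)%nat -> 0 < d0 ->
  (forall z, inD z -> Cmod (phi z) <= 1) ->
  (forall z, Cmod z < d0 -> Cmod (phi z) <= C0 * Cmod z ^ m) ->
  (forall z, inD z -> has_jet2 phi z) ->
  forall z, inD z -> Cmod (phi z) <= Cmod z ^ m.
Proof.
intros Hm Hd0 Hb H0 Hjet z0 Hz0; apply Rnot_lt_le; intros Hlt.
assert (Hz0n : z0 <> RtoC 0).
{ intros ->; specialize (H0 (RtoC 0)); rewrite Cmod_0 in H0, Hlt; specialize (H0 Hd0).
  rewrite pow_i in H0, Hlt by lia; lra. }
pose proof (proj1 (Cmod_gt_0 z0) Hz0n) as Hz0p; unfold inD in Hz0.
assert (Hzm : 0 < Cmod z0 ^ m) by now apply pow_lt.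
set (q := Cmod (phi z0) / Cmod z0 ^ m).
assert (Hq : 1 < q).
{ apply (Rmult_lt_reg_r (Cmod z0 ^ m)); [exact Hzm|]; unfold q, Rdiv.
  rewrite Rmult_assoc, Rinv_l by lra; lra. }
(* The excess ratio q at z0 exceeds 1, so some k gives |chi z0| = q^k |z0| >= 3. On a circle where
   |z|^(m k) >= 1/2 one has |chi| <= 2, and these clash. *)
destruct (Pow_x_infinity q ltac:(rewrite Rabs_pos_eq; lra) (3 / Cmod z0)) as [k Hk].
specialize (Hk k (Nat.le_refl k)).
rewrite Rabs_pos_eq in Hk by (apply pow_le; lra).
assert (Hk2 : 3 <= q ^ k * Cmod z0).
{ apply Rge_le, (Rmult_le_compat_r (Cmod z0)) in Hk; [|lra].
  unfold Rdiv in Hk; rewrite Rmult_assoc, Rinv_l in Hk by lra; lra. }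
destruct (exists_pow_ge_half (m * k)) as (s & Hs & Hpow).
set (r := Rmax s (Cmod z0)).
assert (Hr : s <= r /\ Cmod z0 <= r /\ r < 1).
{ split; [apply Rmax_l|split; [apply Rmax_r|apply Rmax_lub_lt; lra]]. }
(* The spare factor z gives |chi z| <= C0^k |z| near 0 and forces chi 0 = 0 whatever [/ 0] is, so
   chi is continuous there. *)
set (chi := fun z => (phi z ^ k * z * (/ z) ^ (m * k))%C).
assert (Hchi0 : chi (RtoC 0) = RtoC 0) by (unfold chi; ring).
assert (Hchi : forall z, z <> RtoC 0 ->
  Cmod (chi z) = Cmod (phi z) ^ k * Cmod z / (Cmod z ^ m) ^ k).
{ intros z Hz; unfold chi; rewrite !Cmod_mult, !Cmod_pow, Cmod_inv by exact Hz.
  apply Cmod_gt_0 in Hz; rewrite pow_inv, <- pow_mult; reflexivity. }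
assert (Hchijet : forall z, inD z -> z <> RtoC 0 -> has_jet2 chi z).
{ intros z Hz Hzn; unfold chi.
  apply (jet2_mult (fun z => phi z ^ k * z)%C (fun z => (/ z) ^ (m * k))%C).
  - apply (jet2_mult (fun z => phi z ^ k)%C (fun z => z)); [apply jet2_pow, Hjet, Hz|apply jet2_id].
  - apply jet2_pow, jet2_inv, Hzn. }
assert (Hmax : Cmod (chi z0) <= 2).
{ apply (max_modulus chi r 2); try lra.
  - intros u Hu eps Heps; destruct (classic (u = RtoC 0)) as [->|Hun].
    + rewrite Hchi0.
      set (D := Rmax 1 (C0 ^ k)); assert (HD : 1 <= D) by apply Rmax_l.
      exists (Rmin d0 (eps / D)); split; [apply Rmin_glb_lt; [exact Hd0|apply Rdiv_lt_0_compat; lra]|].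
      intros z Hz; replace (z - RtoC 0)%C with z in Hz by ring.
      replace (chi z - RtoC 0)%C with (chi z) by ring.
      destruct (classic (z = RtoC 0)) as [->|Hzn]; [rewrite Hchi0, Cmod_0; exact Heps|].
      rewrite Hchi by exact Hzn; apply Cmod_gt_0 in Hzn.
      specialize (H0 z (Rlt_le_trans _ _ _ Hz (Rmin_l _ _))).
      pose proof (Rlt_le_trans _ _ _ Hz (Rmin_r _ _)) as Hz2.
      assert (Hzmk : 0 < (Cmod z ^ m) ^ k) by now repeat apply pow_lt.
      apply Rle_lt_trans with (D * Cmod z).
      * apply (Rmult_le_reg_r ((Cmod z ^ m) ^ k)); [exact Hzmk|].
        unfold Rdiv; rewrite (Rmult_assoc (_ * _)), Rinv_l, Rmult_1_r by lra.
        replace (D * Cmod z * (Cmod z ^ m) ^ k) with (D * (Cmod z ^ m) ^ k * Cmod z) by ring.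
        apply Rmult_le_compat_r; [lra|].
        apply Rle_trans with ((C0 * Cmod z ^ m) ^ k).
        { apply pow_incr; split; [apply Cmod_ge_0|exact H0]. }
        rewrite Rpow_mult_distr; apply Rmult_le_compat_r; [lra|apply Rmax_r].
      * apply (Rmult_lt_compat_l D) in Hz2; [|lra].
        replace (D * (eps / D)) with eps in Hz2 by (field; lra); exact Hz2.
    + apply has_jet2_cont; [apply Hchijet; [unfold inD; lra|exact Hun]|exact Heps].
  - intros z Hz Hcz; apply Hchijet; [unfold inD; lra|]; intros ->; apply Hcz, Hchi0.
  - intros z Hz.
    assert (Hzn : z <> RtoC 0) by (apply Cmod_gt_0; lra).
    rewrite Hchi, Hz, <- pow_mult by exact Hzn.
    specialize (Hpow r ltac:(lra)).
    apply (Rmult_le_reg_r (r ^ (m * k))); [lra|].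
    unfold Rdiv; rewrite Rmult_assoc, Rinv_l, Rmult_1_r by lra.
    specialize (Hb z ltac:(unfold inD; lra)).
    assert (Cmod (phi z) ^ k <= 1).
    { rewrite <- (pow1 k); apply pow_incr; split; [apply Cmod_ge_0|exact Hb]. }
    nra. }
rewrite Hchi in Hmax by exact Hz0n.
replace (Cmod (phi z0) ^ k * Cmod z0 / (Cmod z0 ^ m) ^ k) with (q ^ k * Cmod z0) in Hmax; [lra|].
unfold q, Rdiv; rewrite Rpow_mult_distr, pow_inv; ring.
Qed.

(** Inverse function theorem at the level of 2-jets. Continuity makes the increment s of phi small,
    which yields |s| <= L |t|; feeding this back gives |s - s1 t| <= L2 |t|^2, and once more gives
    the cubic error. *)
Lemma jet2_inverse (Phi q phi : C -> C) (z0 : C) (d1 : R) :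
  (exists A A2, jet2_at Phi (phi z0) A A2 /\ A <> RtoC 0) -> has_jet2 q z0 ->
  0 < d1 -> (forall z, Cmod (z - z0)%C < d1 -> Phi (phi z) = q z) ->
  (forall eps, 0 < eps -> exists d, 0 < d /\ forall z, Cmod (z - z0)%C < d -> Cmod (phi z - phi z0)%C < eps) ->
  has_jet2 phi z0.
Proof.
intros (al & be & (K & d & HK & Hd & H) & Hal) (ga & de & K' & d' & HK' & Hd' & H') Hd1 Heq Hcont.
pose proof (proj1 (Cmod_gt_0 al) Hal) as Hal0.
pose proof (Cmod_ge_0 be) as Hbe; pose proof (Cmod_ge_0 ga) as Hga; pose proof (Cmod_ge_0 de) as Hde.
set (L := 2 * (Cmod ga + Cmod de + K') / Cmod al).
assert (HL : 0 <= L) by (apply Rmult_le_pos; [lra|apply Rlt_le, Rinv_0_lt_compat, Hal0]).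
set (L2 := (Cmod de + K' + Cmod be * L ^ 2 + K * L ^ 3) / Cmod al).
assert (HL2' : 0 <= Cmod de + K' + Cmod be * L ^ 2 + K * L ^ 3).
{ pose proof (Rmult_le_pos _ _ Hbe (pow_le L 2 HL)); pose proof (Rmult_le_pos _ _ HK (pow_le L 3 HL)); lra. }
assert (HL2 : 0 <= L2) by (apply Rmult_le_pos; [lra|apply Rlt_le, Rinv_0_lt_compat, Hal0]).
(* Found by matching the coefficients of t and t^2 in al s + be s^2 = ga t + de t^2. *)
set (s1 := (ga / al)%C); set (s2 := ((de - be * s1 ^ 2) / al)%C).
pose proof (Cmod_ge_0 s1) as Hs1.
assert (HS : 0 < Cmod be + K + 1) by lra.
(* For |s| below this threshold the terms |be| |s|^2 + K |s|^3 are absorbed by |al| |s| / 2. *)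
set (sm := Rmin 1 (Rmin d (Cmod al / 2 / (Cmod be + K + 1)))).
assert (Hsm : 0 < sm) by (repeat apply Rmin_glb_lt; try lra; apply Rdiv_lt_0_compat; lra).
destruct (Hcont sm Hsm) as (d2 & Hd2 & Hc).
exists s1, s2, ((K' + K * L ^ 3 + Cmod be * (L2 * (L + Cmod s1))) / Cmod al),
  (Rmin (Rmin 1 d') (Rmin d1 d2)).
assert (HC : 0 <= K' + K * L ^ 3 + Cmod be * (L2 * (L + Cmod s1))).
{ pose proof (Rmult_le_pos _ _ HK (pow_le L 3 HL)).
  assert (0 <= L2 * (L + Cmod s1)) by (apply Rmult_le_pos; lra).
  pose proof (Rmult_le_pos _ _ Hbe H1); lra. }
split; [apply Rmult_le_pos; [exact HC|apply Rlt_le, Rinv_0_lt_compat, Hal0]|].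
split; [repeat apply Rmin_glb_lt; lra|]; intros t Ht.
pose proof (Rlt_le_trans _ _ _ Ht (Rmin_l _ _)) as Hta.
pose proof (Rlt_le_trans _ _ _ Ht (Rmin_r _ _)) as Htb.
pose proof (Rlt_le_trans _ _ _ Hta (Rmin_l _ _)) as Ht1.
pose proof (Rlt_le_trans _ _ _ Hta (Rmin_r _ _)) as Ht2.
pose proof (Rlt_le_trans _ _ _ Htb (Rmin_l _ _)) as Ht3.
pose proof (Rlt_le_trans _ _ _ Htb (Rmin_r _ _)) as Ht4.
assert (Htt : (z0 + t - z0)%C = t) by ring.
specialize (Hc (z0 + t)%C); rewrite Htt in Hc; specialize (Hc Ht4).
set (s := (phi (z0 + t)%C - phi z0)%C) in *.
assert (Hs_1 : Cmod s < 1) by (eapply Rlt_le_trans; [exact Hc|apply Rmin_l]).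
assert (Hs_d : Cmod s < d) by (eapply Rlt_le_trans; [exact Hc|eapply Rle_trans; [apply Rmin_r|apply Rmin_l]]).
assert (Hs_a : Cmod s * (Cmod be + K + 1) <= Cmod al / 2).
{ assert (Hx : Cmod s <= Cmod al / 2 / (Cmod be + K + 1)).
  { apply Rlt_le; eapply Rlt_le_trans; [exact Hc|eapply Rle_trans; [apply Rmin_r|apply Rmin_r]]. }
  apply (Rmult_le_compat_r (Cmod be + K + 1)) in Hx; [|lra].
  replace (Cmod al / 2 / (Cmod be + K + 1) * (Cmod be + K + 1)) with (Cmod al / 2) in Hx by (field; lra).
  exact Hx. }
specialize (H s Hs_d); specialize (H' t Ht2).
assert (Hphi : (phi z0 + s)%C = phi (z0 + t)%C) by (unfold s; ring).
rewrite Hphi, (Heq (z0 + t)%C) in H by (rewrite Htt; exact Ht3).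
assert (Hz00 : Phi (phi z0) = q z0).
{ apply Heq; replace (z0 - z0)%C with (RtoC 0) by ring; rewrite Cmod_0; exact Hd1. }
rewrite Hz00 in H.
set (E := (q (z0 + t)%C - (q z0 + al * s + be * s ^ 2))%C) in *.
set (E' := (q (z0 + t)%C - (q z0 + ga * t + de * t ^ 2))%C) in *.
assert (Hrel : (al * s = ga * t + de * t ^ 2 + E' - be * s ^ 2 - E)%C) by (unfold E, E'; ring).
set (x := Cmod t) in *; set (y := Cmod s) in *.
assert (Hx : 0 <= x) by apply Cmod_ge_0; assert (Hy : 0 <= y) by apply Cmod_ge_0.
assert (Hx2 : 0 <= x ^ 2) by apply pow2_ge_0.
assert (Htri4 : forall a b c e : C, Cmod (a + b - c - e)%C <= Cmod a + Cmod b + Cmod c + Cmod e).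
{ intros a b c e; unfold Cminus.
  eapply Rle_trans; [apply Cmod_triangle|]; rewrite Cmod_opp; apply Rplus_le_compat_r.
  eapply Rle_trans; [apply Cmod_triangle|]; rewrite Cmod_opp; apply Rplus_le_compat_r.
  apply Cmod_triangle. }
assert (Hx3 : x ^ 3 <= x ^ 2) by (simpl; nra).
assert (Hx21 : x ^ 2 <= x) by (simpl; nra).
assert (Hyx : y <= L * x).
{ assert (Hm : Cmod al * y <= (Cmod ga + Cmod de + K') * x + y * (Cmod al / 2)).
  { unfold y at 1; rewrite <- Cmod_mult, Hrel.
    replace (ga * t + de * t ^ 2 + E' - be * s ^ 2 - E)%C
      with ((ga * t + de * t ^ 2) + E' - be * s ^ 2 - E)%C by ring.
    eapply Rle_trans; [apply Htri4|].
    assert (Cmod (ga * t + de * t ^ 2)%C <= (Cmod ga + Cmod de) * x).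
    { eapply Rle_trans; [apply Cmod_triangle|]; rewrite !Cmod_mult, Cmod_pow; fold x; nra. }
    assert (K' * x ^ 3 <= K' * x) by (apply Rmult_le_compat_l; lra).
    rewrite Cmod_mult, Cmod_pow; fold y.
    assert (K * y ^ 3 <= y * (y * K)).
    { replace (K * y ^ 3) with (K * (y * y) * y) by ring.
      replace (y * (y * K)) with (K * (y * y) * 1) by ring.
      apply Rmult_le_compat_l; [|lra]; apply Rmult_le_pos; [exact HK|nra]. }
    assert (y * (y * (Cmod be + K + 1)) <= y * (Cmod al / 2)) by (apply Rmult_le_compat_l; lra).
    assert (0 <= y * y) by nra.
    replace (Cmod be * y ^ 2) with (y * (y * Cmod be)) by ring.
    nra. }
  apply (Rmult_le_reg_l (Cmod al / 2)); [lra|].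
  replace (Cmod al / 2 * (L * x)) with ((Cmod ga + Cmod de + K') * x) by (unfold L; field; lra).
  lra. }
assert (Hy2 : y ^ 2 <= L ^ 2 * x ^ 2) by (rewrite <- Rpow_mult_distr; apply pow_incr; lra).
assert (Hy3 : y ^ 3 <= L ^ 3 * x ^ 3) by (rewrite <- Rpow_mult_distr; apply pow_incr; lra).
assert (HKy3 : K * y ^ 3 <= K * L ^ 3 * x ^ 3).
{ rewrite Rmult_assoc; apply Rmult_le_compat_l; assumption. }
assert (Hst : Cmod (s - s1 * t)%C <= L2 * x ^ 2).
{ apply (Rmult_le_reg_l (Cmod al)); [exact Hal0|].
  replace (Cmod al * (L2 * x ^ 2)) with ((Cmod de + K' + Cmod be * L ^ 2 + K * L ^ 3) * x ^ 2)
    by (unfold L2; field; lra).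
  rewrite <- Cmod_mult.
  replace (al * (s - s1 * t))%C with (de * t ^ 2 + E' - be * s ^ 2 - E)%C.
  2: { replace (al * (s - s1 * t))%C with (al * s - ga * t)%C by (unfold s1; field; exact Hal).
       rewrite Hrel; ring. }
  eapply Rle_trans; [apply Htri4|]; rewrite !Cmod_mult, !Cmod_pow; fold x y.
  assert (Cmod be * y ^ 2 <= Cmod be * (L ^ 2 * x ^ 2)) by (apply Rmult_le_compat_l; assumption).
  assert (K' * x ^ 3 <= K' * x ^ 2) by (apply Rmult_le_compat_l; assumption).
  assert (K * L ^ 3 * x ^ 3 <= K * L ^ 3 * x ^ 2).
  { apply Rmult_le_compat_l; [apply Rmult_le_pos; [exact HK|apply pow_le, HL]|exact Hx3]. }
  lra. }
apply (Rmult_le_reg_l (Cmod al)); [exact Hal0|].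
replace (Cmod al * ((K' + K * L ^ 3 + Cmod be * (L2 * (L + Cmod s1))) / Cmod al * x ^ 3))
  with ((K' + K * L ^ 3 + Cmod be * (L2 * (L + Cmod s1))) * x ^ 3) by (field; lra).
rewrite <- Cmod_mult, <- Hphi.
replace (al * (phi z0 + s - (phi z0 + s1 * t + s2 * t ^ 2)))%C
  with (RtoC 0 + E' - E - be * ((s - s1 * t) * (s + s1 * t)))%C.
2: { replace (al * (phi z0 + s - (phi z0 + s1 * t + s2 * t ^ 2)))%C
       with (al * s - ga * t - (de - be * s1 ^ 2) * t ^ 2)%C by (unfold s2, s1; field; exact Hal).
     rewrite Hrel; ring. }
eapply Rle_trans; [apply Htri4|]; rewrite Cmod_0, !Cmod_mult.
assert (Hss : Cmod (s + s1 * t)%C <= (L + Cmod s1) * x).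
{ eapply Rle_trans; [apply Cmod_triangle|]; rewrite Cmod_mult; fold x y; lra. }
assert (Hprod : Cmod (s - s1 * t)%C * Cmod (s + s1 * t)%C <= L2 * x ^ 2 * ((L + Cmod s1) * x)).
{ apply Rmult_le_compat; try apply Cmod_ge_0; assumption. }
apply (Rmult_le_compat_l (Cmod be)) in Hprod; [|exact Hbe].
replace (L2 * x ^ 2 * ((L + Cmod s1) * x)) with (L2 * (L + Cmod s1) * x ^ 3) in Hprod by ring.
lra.
Qed.

(** For |z| <= 1/2 and k >= n, |z|^k <= |z|^n (1/2)^(k - n), so the absolute sum at radius 1/2
    controls everything at the cost of 2^n. *)
Lemma PS_order (a : nat -> C) (h : C -> C) (n : nat) :
  PS a h -> (forall k, (k < n)%nat -> a k = RtoC 0) ->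
  exists K, 0 <= K /\ forall z, Cmod z <= / 2 -> Cmod (h z) <= K * Cmod z ^ n.
Proof.
intros Hh Hlow.
destruct (PS_abs a h (/ 2) Hh ltac:(lra)) as [l Hl].
exists (2 ^ n * l); split.
{ apply Rmult_le_pos; [apply pow_le; lra|].
  apply Rle_trans with (Cmod (h (RtoC (/ 2)))); [apply Cmod_ge_0|].
  assert (Hhalf : Cmod (RtoC (/ 2)) = / 2) by (rewrite Cmod_R, Rabs_pos_eq; lra).
  apply (csum_le _ _ _ _ (Hh (RtoC (/ 2)) ltac:(unfold inD; lra))) with (2 := Hl).
  intros k; rewrite Cmod_mult, Cmod_pow, Hhalf; lra. }
intros z Hz.
replace (2 ^ n * l * Cmod z ^ n) with (2 ^ n * Cmod z ^ n * l) by ring.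
apply (csum_le _ (fun k => 2 ^ n * Cmod z ^ n * (Cmod (a k) * (/ 2) ^ k)) _ _ (Hh z ltac:(unfold inD; lra))).
- intros k; rewrite Cmod_mult, Cmod_pow.
  destruct (le_lt_dec n k) as [Hk|Hk].
  + replace k with (n + (k - n))%nat by lia; set (j := (k - n)%nat).
    rewrite !pow_add.
    replace (2 ^ n * Cmod z ^ n * (Cmod (a (n + j)%nat) * ((/ 2) ^ n * (/ 2) ^ j)))
      with (Cmod (a (n + j)%nat) * (Cmod z ^ n * (/ 2) ^ j) * (2 * / 2) ^ n)
      by (rewrite (Rpow_mult_distr 2); ring).
    replace (2 * / 2) with 1 by field; rewrite pow1, Rmult_1_r.
    apply Rmult_le_compat_l; [apply Cmod_ge_0|].
    apply Rmult_le_compat_l; [apply pow_le, Cmod_ge_0|].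
    apply pow_incr; split; [apply Cmod_ge_0|exact Hz].
  + rewrite (Hlow k Hk), Cmod_0; lra.
- apply (is_series_scal (V := R_NormedModule)), Hl.
Qed.

Lemma csum_single (n : nat) (c : C) :
  csum (fun k => if Nat.eqb k n then c else RtoC 0) c.
Proof.
apply csum_eps; intros eps Heps; exists n; intros k Hk.
assert (H : forall j, @sum_n C_AbelianMonoid (fun k => if Nat.eqb k n then c else RtoC 0) j
          = if le_lt_dec n j then c else RtoC 0).
{ induction j as [|j IH].
  - rewrite sum_O; destruct (le_lt_dec n 0); destruct (Nat.eqb_spec 0 n); try reflexivity; lia.
  - rewrite sum_n_C_S, IH; destruct (le_lt_dec n j); destruct (le_lt_dec n (S j));
      destruct (Nat.eqb_spec (S j) n); try lia;
      match goal with |- ?x = ?y => change (@eq C x y) end; ring. }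
rewrite H; destruct (le_lt_dec n k); [|lia].
replace (c - c)%C with (RtoC 0) by ring; rewrite Cmod_0; exact Heps.
Qed.

Lemma PS_leading (a : nat -> C) (h : C -> C) (n : nat) :
  PS a h -> (forall k, (k < n)%nat -> a k = RtoC 0) ->
  exists K, 0 <= K /\ forall z, Cmod z <= / 2 -> Cmod (h z - a n * z ^ n)%C <= K * Cmod z ^ S n.
Proof.
intros Hh Hlow.
apply (PS_order (fun k => if Nat.eqb k n then RtoC 0 else a k) (fun z => h z - a n * z ^ n)%C).
- intros z Hz.
  eapply csum_ext; [|apply (csum_minus _ _ _ _ (Hh z Hz) (csum_single n (a n * z ^ n)%C))].
  intros k; cbv beta; destruct (Nat.eqb_spec k n) as [->|]; ring.
- intros k Hk; cbv beta; destruct (Nat.eqb_spec k n); [reflexivity|apply Hlow; lia].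
Qed.

(** * Averages over roots of unity *)

Definition Csum_n (p : nat -> C) (n : nat) : C := @sum_n C_AbelianMonoid p n.

Lemma Csum_O p : Csum_n p 0 = p 0%nat.
Proof. apply (@sum_O C_AbelianMonoid). Qed.

Lemma Csum_S p n : Csum_n p (S n) = (Csum_n p n + p (S n))%C.
Proof. apply sum_n_C_S. Qed.

Lemma Csum_ext p q n : (forall k, (k <= n)%nat -> p k = q k) -> Csum_n p n = Csum_n q n.
Proof. apply (@sum_n_ext_loc C_AbelianMonoid). Qed.

Lemma Csum_scal c p n : Csum_n (fun k => c * p k)%C n = (c * Csum_n p n)%C.
Proof.
induction n as [|n IH]; [now rewrite !Csum_O|]; rewrite !Csum_S, IH; ring.
Qed.

Lemma Csum_plus p q n : Csum_n (fun k => p k + q k)%C n = (Csum_n p n + Csum_n q n)%C.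
Proof.
induction n as [|n IH]; [now rewrite !Csum_O|]; rewrite !Csum_S, IH; ring.
Qed.

Lemma Csum_conj p n : Cconj (Csum_n p n) = Csum_n (fun k => Cconj (p k)) n.
Proof.
induction n as [|n IH]; [now rewrite !Csum_O|]; rewrite !Csum_S, Cplus_conj, IH; reflexivity.
Qed.

Lemma Csum_const c n : Csum_n (fun _ => c) n = (RtoC (INR (S n)) * c)%C.
Proof.
induction n as [|n IH]; [rewrite Csum_O; simpl; ring|].
rewrite Csum_S, IH, (S_INR (S n)), RtoC_plus; ring.
Qed.

Definition convex_set (S : C -> Prop) : Prop :=
  forall x y t, S x -> S y -> 0 <= t <= 1 -> S (RtoC (1 - t) * x + RtoC t * y)%C.

Lemma convex_image_set F : convex_image_D F -> convex_set (image_D F).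
Proof.
intros H x y t (z1 & Hz1 & <-) (z2 & Hz2 & <-) Ht.
destruct (H z1 z2 t Hz1 Hz2 Ht) as (z3 & Hz3 & Heq); exists z3; auto.
Qed.

(** Induction on partial sums divided by their partial weight. A positive first weight keeps the
    divisor nonzero while later weights may vanish, as the weights 1 + cos t can. *)
Lemma convex_combination (S0 : C -> Prop) (w : nat -> R) (p : nat -> C) (n : nat) :
  convex_set S0 -> 0 < w 0%nat -> (forall k, (k <= n)%nat -> 0 <= w k) ->
  (forall k, (k <= n)%nat -> S0 (p k)) ->
  Csum_n (fun k => RtoC (w k)) n = RtoC 1 ->
  S0 (Csum_n (fun k => RtoC (w k) * p k)%C n).
Proof.
intros Hconv Hw0 Hw Hp H1.
assert (Hgen : forall m, (m <= n)%nat -> exists W, 0 < W /\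
   Csum_n (fun k => RtoC (w k)) m = RtoC W /\
   S0 (Csum_n (fun k => RtoC (w k) * p k)%C m / RtoC W)%C).
{ induction m as [|m IH]; intros Hm.
  - exists (w 0%nat); rewrite !Csum_O; repeat split; [exact Hw0|].
    replace (RtoC (w 0%nat) * p 0%nat / RtoC (w 0%nat))%C with (p 0%nat); [apply Hp; lia|].
    field; intros H0; apply RtoC_inj in H0; lra.
  - destruct (IH ltac:(lia)) as (W & HW & HWs & HS).
    pose proof (Hw (S m) Hm) as Hws.
    exists (W + w (S m)); rewrite !Csum_S, HWs, RtoC_plus; split; [lra|]; split; [reflexivity|].
    assert (HWn : RtoC W <> RtoC 0) by (intros H0; apply RtoC_inj in H0; lra).
    assert (HWn2 : (RtoC W + RtoC (w (S m)))%C <> RtoC 0).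
    { rewrite <- RtoC_plus; intros H0; apply RtoC_inj in H0; lra. }
    set (t := w (S m) / (W + w (S m))).
    assert (Ht : 0 <= t <= 1).
    { unfold t; split.
      - apply Rmult_le_pos; [lra|apply Rlt_le, Rinv_0_lt_compat; lra].
      - apply (Rmult_le_reg_r (W + w (S m))); [lra|].
        unfold Rdiv; rewrite Rmult_assoc, Rinv_l by lra; lra. }
    assert (HtC : RtoC t = (RtoC (w (S m)) / (RtoC W + RtoC (w (S m))))%C).
    { unfold t; rewrite RtoC_div, RtoC_plus; [reflexivity|lra]. }
    specialize (Hconv _ _ t HS (Hp (S m) Hm) Ht).
    rewrite RtoC_minus, HtC in Hconv.
    match goal with |- S0 ?x => match type of Hconv with S0 ?y => replace x with y end end;
      [exact Hconv|].
    field; split; assumption. }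
destruct (Hgen n (Nat.le_refl n)) as (W & HW & HWs & HS).
rewrite H1 in HWs; apply RtoC_inj in HWs; rewrite <- HWs in HS.
match goal with |- S0 ?x => replace x with (x / RtoC 1)%C by field end; exact HS.
Qed.

(** A primitive root of unity of order n + 1, the number of terms in a sum from 0 to n. *)
Definition zeta (n : nat) : C :=
  (cos (2 * PI / INR (S n)), sin (2 * PI / INR (S n))).

Lemma zeta_pow n k :
  (zeta n ^ k)%C = (cos (INR k * (2 * PI / INR (S n))), sin (INR k * (2 * PI / INR (S n)))).
Proof.
induction k as [|k IH].
- simpl; rewrite Rmult_0_l, cos_0, sin_0; reflexivity.
- rewrite Cpow_S, IH, (S_INR k), Rmult_plus_distr_r, Rmult_1_l, cos_plus, sin_plus.
  unfold zeta; apply injective_projections; simpl fst; simpl snd; ring.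
Qed.

Lemma zeta_mod n : Cmod (zeta n) = 1.
Proof.
unfold Cmod, zeta, fst, snd.
assert (H := sin2_cos2 (2 * PI / INR (S n))); unfold Rsqr in H.
rewrite <- sqrt_1; apply f_equal; etransitivity; [|exact H]; ring.
Qed.

(** The conjugate is the inverse, and zeta^(n + 1) = 1 makes the inverse an n-th power; conjugates
    thus stay within natural exponents. *)
Lemma zeta_conj n k : Cconj (zeta n ^ k)%C = (zeta n ^ (n * k))%C.
Proof.
assert (Hn : (zeta n ^ S n)%C = RtoC 1).
{ rewrite zeta_pow; replace (INR (S n) * (2 * PI / INR (S n))) with (2 * PI)
    by (field; apply not_0_INR; lia).
  rewrite cos_2PI, sin_2PI; reflexivity. }
assert (H1 : (zeta n ^ k * Cconj (zeta n ^ k))%C = RtoC 1).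
{ apply Cmod1_conj; rewrite Cmod_pow, zeta_mod, pow1; reflexivity. }
assert (H2 : (zeta n ^ k * zeta n ^ (n * k))%C = RtoC 1).
{ rewrite <- Cpow_add_r; replace (k + n * k)%nat with (S n * k)%nat by lia.
  rewrite Cpow_mult_r, Hn, Cpow_1_l; reflexivity. }
replace (Cconj (zeta n ^ k)) with (Cconj (zeta n ^ k) * (zeta n ^ k * zeta n ^ (n * k)))%C
  by (rewrite H2; ring).
replace (Cconj (zeta n ^ k) * (zeta n ^ k * zeta n ^ (n * k)))%C
  with ((zeta n ^ k * Cconj (zeta n ^ k)) * zeta n ^ (n * k))%C by ring.
rewrite H1; ring.
Qed.

Lemma zeta_root n j : (zeta n ^ (S n * j))%C = RtoC 1.
Proof.
rewrite Cpow_mult_r, zeta_pow.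
replace (INR (S n) * (2 * PI / INR (S n))) with (2 * PI) by (field; apply not_0_INR; lia).
rewrite cos_2PI, sin_2PI; change (1, 0) with (RtoC 1); apply Cpow_1_l.
Qed.

(** The real part is 1 - 2 sin^2 x with x strictly between 0 and pi. *)
Lemma zeta_neq_1 n j : (0 < j < S n)%nat -> (zeta n ^ j)%C <> RtoC 1.
Proof.
intros Hj H; rewrite zeta_pow in H.
set (x := INR j * (PI / INR (S n))).
replace (INR j * (2 * PI / INR (S n))) with (2 * x) in H by (unfold x; field; apply not_0_INR; lia).
apply (f_equal fst) in H; simpl in H; rewrite cos_2a_sin in H.
assert (Hn : 0 < INR (S n)) by (apply lt_0_INR; lia).
assert (Hj0 : 0 < INR j) by (apply lt_0_INR; lia).
assert (Hjn : INR j < INR (S n)) by (apply lt_INR; lia).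
pose proof PI_RGT_0 as Hpi.
assert (Hx : 0 < x < PI).
{ unfold x; split.
  - apply Rmult_lt_0_compat; [exact Hj0|apply Rdiv_lt_0_compat; assumption].
  - apply (Rmult_lt_reg_r (INR (S n))); [exact Hn|].
    replace (INR j * (PI / INR (S n)) * INR (S n)) with (INR j * PI) by (field; lra).
    rewrite (Rmult_comm PI); apply Rmult_lt_compat_r; assumption. }
pose proof (sin_gt_0 x (proj1 Hx) (proj2 Hx)); nra.
Qed.

Lemma Csum_geom x n : ((x - RtoC 1) * Csum_n (fun k => x ^ k) n)%C = (x ^ S n - RtoC 1)%C.
Proof.
induction n as [|n IH]; [rewrite Csum_O; simpl; ring|].
rewrite Csum_S, Cmult_plus_distr_l, IH; simpl; ring.
Qed.

Lemma zeta_sum n j : (zeta n ^ j)%C <> RtoC 1 -> Csum_n (fun k => (zeta n ^ j) ^ k)%C n = RtoC 0.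
Proof.
intros Hj; assert (H := Csum_geom (zeta n ^ j)%C n).
rewrite <- Cpow_mult_r, Nat.mul_comm, zeta_root in H.
replace (RtoC 1 - RtoC 1)%C with (RtoC 0) in H by ring.
assert (Hn : (zeta n ^ j - RtoC 1)%C <> RtoC 0).
{ intros H0; apply Hj; replace (zeta n ^ j)%C with (zeta n ^ j - RtoC 1 + RtoC 1)%C by ring.
  rewrite H0; ring. }
replace (Csum_n (fun k => (zeta n ^ j) ^ k)%C n)
  with ((zeta n ^ j - RtoC 1) * Csum_n (fun k => (zeta n ^ j) ^ k) n / (zeta n ^ j - RtoC 1))%C
  by (field; exact Hn).
rewrite H; field; exact Hn.
Qed.

Lemma zeta_sum_1 n j : (zeta n ^ j)%C = RtoC 1 ->
  Csum_n (fun k => (zeta n ^ j) ^ k)%C n = RtoC (INR (S n)).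
Proof.
intros ->; rewrite (Csum_ext _ (fun _ => RtoC 1)) by (intros; apply Cpow_1_l).
rewrite Csum_const; ring.
Qed.

(** Averaging over rotations multiplies the j-th coefficient by the discrete Fourier transform of
    the weights. Arbitrary weights let it serve both the uniform and the 1 + cos t average. *)
Lemma PS_average (c : nat -> C) (F : C -> C) (w : nat -> C) (x : C) (n : nat) :
  PS c F -> Cmod x = 1 ->
  PS (fun j => c j * Csum_n (fun k => w k * (x ^ j) ^ k) n)%C
     (fun z => Csum_n (fun k => w k * F (x ^ k * z)) n)%C.
Proof.
intros HF Hx z Hz.
assert (HD : forall k, inD (x ^ k * z)%C).
{ intros k; unfold inD; rewrite Cmod_mult, Cmod_pow, Hx, pow1, Rmult_1_l; exact Hz. }
assert (Hterm : forall k, csum (fun j => c j * (w k * (x ^ j) ^ k) * z ^ j)%C (w k * F (x ^ k * z))%C).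
{ intros k; eapply csum_ext; [|apply csum_scal, HF, HD].
  intros j; cbv beta; rewrite Cpow_mult_l, <- !Cpow_mult_r, (Nat.mul_comm k j); ring. }
induction n as [|n IH].
- rewrite Csum_O; eapply csum_ext; [|apply Hterm]; intros j; cbv beta; now rewrite Csum_O.
- rewrite Csum_S; eapply csum_ext; [|apply csum_plus; [exact IH|apply (Hterm (S n))]].
  intros j; cbv beta; rewrite Csum_S; ring.
Qed.

(* The average of Phi over the n-th roots of unity is c_n z^n + O(z^(n+1)) and takes values
   in the convex set Phi(D), so it is subordinate to Phi. *)
Lemma convex_coeff_bound (c : nat -> C) (Phi : C -> C) (n : nat) :
  PS c Phi -> c 0%nat = RtoC 0 -> c 1%nat = RtoC 1 ->
  univalent_D Phi -> convex_image_D Phi ->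
  (forall z, inD z -> exists A A2, jet2_at Phi z A A2 /\ A <> RtoC 0) ->
  Cmod (c (S n)) <= 1.
Proof.
intros HPS Hc0 Hc1 Hinj Hconv Hjet.
set (q := fun z => Csum_n (fun k => RtoC (/ INR (S n)) * Phi (zeta n ^ k * z))%C n).
assert (HN : 0 < INR (S n)) by (apply lt_0_INR; lia).
assert (HNi : 0 < / INR (S n)) by now apply Rinv_0_lt_compat.
assert (HNN : (RtoC (/ INR (S n)) * RtoC (INR (S n)))%C = RtoC 1).
{ rewrite <- RtoC_mult; f_equal; field; lra. }
assert (Hq := PS_average c Phi (fun _ => RtoC (/ INR (S n))) (zeta n) n HPS (zeta_mod n)).
fold q in Hq.
set (cq := fun j => (c j * Csum_n (fun k => RtoC (/ INR (S n)) * (zeta n ^ j) ^ k) n)%C) in Hq.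
assert (Hcqlow : forall j, (j < S n)%nat -> cq j = RtoC 0).
{ intros j Hj; unfold cq; destruct j as [|j]; [rewrite Hc0; ring|].
  rewrite Csum_scal, zeta_sum by (apply zeta_neq_1; lia); ring. }
assert (Hcqn : cq (S n) = c (S n)).
{ unfold cq; rewrite Csum_scal, zeta_sum_1, HNN; [ring|].
  replace (S n) with (S n * 1)%nat by lia; apply zeta_root. }
assert (HDz : forall k z, inD z -> inD (zeta n ^ k * z)%C).
{ intros k z Hz; unfold inD; rewrite Cmod_mult, Cmod_pow, zeta_mod, pow1, Rmult_1_l; exact Hz. }
assert (Himg : forall z, inD z -> image_D Phi (q z)).
{ intros z Hz; unfold q.
  apply (convex_combination (image_D Phi) (fun _ => / INR (S n)) (fun k => Phi (zeta n ^ k * z)%C)).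
  - apply convex_image_set, Hconv.
  - exact HNi.
  - intros; lra.
  - intros k _; exists (zeta n ^ k * z)%C; split; [apply HDz, Hz|reflexivity].
  - rewrite Csum_const, Cmult_comm; exact HNN. }
(* The subordination phi = Phi^-1 o q, with arbitrary values off the disk. *)
destruct (choose_fun (fun z y => inD z -> inD y /\ Phi y = q z)) as (phi & Hphi).
{ intros z; destruct (classic (inD z)) as [Hz|Hz].
  - destruct (Himg z Hz) as (y & Hy); exists y; auto.
  - exists z; intros H; contradiction. }
assert (Hopen : forall z, inD z -> exists A B, hjet Phi z A B /\ Cmod B < Cmod A).
{ intros z Hz; destruct (Hjet z Hz) as (A & A2 & HA & HAn).
  exists A, (RtoC 0); split; [eapply jet2_hjet, HA|]; rewrite Cmod_0; now apply Cmod_gt_0. }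
assert (Hqjet : forall z, inD z -> has_jet2 q z).
{ intros z Hz; destruct (PS_jet2 _ _ z Hq Hz) as (A & B & _ & H); exists A, B; exact H. }
(* Openness of Phi at phi z gives a nearby preimage of q z', and injectivity identifies it with phi
   z'. *)
assert (Hcont : forall z, inD z -> forall eps, 0 < eps -> exists d, 0 < d /\
   forall z', Cmod (z' - z)%C < d -> Cmod (phi z' - phi z)%C < eps).
{ intros z Hz eps Heps; destruct (Hphi z Hz) as [HDphi Heq].
  destruct (hjet_open Phi (phi z) eps Hopen HDphi Heps) as (d & Hd & H).
  destruct (has_jet2_cont q z d (Hqjet z Hz) Hd) as (d' & Hd' & H').
  unfold inD in Hz; exists (Rmin d' (1 - Cmod z)); split; [apply Rmin_glb_lt; lra|].
  intros z' Hz'.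
  assert (HDz' : inD z').
  { unfold inD; replace z' with (z + (z' - z))%C by ring.
    eapply Rle_lt_trans; [apply Cmod_triangle|].
    pose proof (Rlt_le_trans _ _ _ Hz' (Rmin_r _ _)); lra. }
  specialize (H' z' (Rlt_le_trans _ _ _ Hz' (Rmin_l _ _))).
  destruct (Hphi z' HDz') as [HDphi' Heq'].
  destruct (H (q z')) as (y & Hy & Hyd & Hyq); [rewrite Heq; exact H'|].
  replace (phi z') with y; [exact Hyd|]; apply Hinj; [exact Hy|exact HDphi'|congruence]. }
assert (Hphijet : forall z, inD z -> has_jet2 phi z).
{ intros z Hz; destruct (Hphi z Hz) as [HDphi Heq].
  apply (jet2_inverse Phi q phi z (1 - Cmod z)).
  - apply Hjet, HDphi.
  - apply Hqjet, Hz.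
  - unfold inD in Hz; lra.
  - intros z' Hz'; apply Hphi; unfold inD; replace z' with (z + (z' - z))%C by ring.
    eapply Rle_lt_trans; [apply Cmod_triangle|]; lra.
  - apply Hcont, Hz. }
destruct (PS_order cq q (S n) Hq Hcqlow) as (Kq & HKq & Hqo).
destruct (PS_leading cq q (S n) Hq Hcqlow) as (Kl & HKl & Hql).
destruct (PS_leading c Phi 1 HPS) as (KP & HKP & HPo).
{ intros k Hk; replace k with 0%nat by lia; exact Hc0. }
assert (HD0 : inD (RtoC 0)) by (unfold inD; rewrite Cmod_0; lra).
assert (Hphi0 : phi (RtoC 0) = RtoC 0).
{ apply Hinj; [apply Hphi, HD0|exact HD0|]; rewrite (proj2 (Hphi _ HD0)).
  pose proof (Hqo (RtoC 0)) as H; rewrite Cmod_0, pow_i, Rmult_0_r in H by lia.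
  specialize (H ltac:(lra)).
  pose proof (HPo (RtoC 0)) as H'; rewrite Cmod_0, pow_i, Rmult_0_r, Hc1 in H' by lia.
  specialize (H' ltac:(lra)).
  replace (Phi (RtoC 0) - RtoC 1 * RtoC 0 ^ 1)%C with (Phi (RtoC 0)) in H' by (simpl; ring).
  rewrite (Cmod_eq_0 (q (RtoC 0))) by (apply Rle_antisym; [exact H|apply Cmod_ge_0]).
  symmetry; apply Cmod_eq_0, Rle_antisym; [exact H'|apply Cmod_ge_0]. }
assert (HPhi1 : forall s, Cmod s <= / 2 -> Cmod (Phi s - s)%C <= KP * Cmod s ^ 2).
{ intros s Hs; specialize (HPo s Hs); rewrite Hc1 in HPo.
  replace (RtoC 1 * s ^ 1)%C with s in HPo by (simpl; ring); exact HPo. }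
assert (Hschwarz : forall z, inD z -> Cmod (phi z) <= Cmod z ^ S n).
(* Where |phi| < ep, the quadratic error KP |phi|^2 is at most |phi| / 2, so |phi| <= 2 |q| =
   O(|z|^(n + 1)), the local hypothesis of [schwarz]. *)
{ set (ep := Rmin (/ 2) (/ (2 * (KP + 1)))).
  assert (Hep : 0 < ep) by (apply Rmin_glb_lt; [lra|apply Rinv_0_lt_compat; lra]).
  destruct (Hcont _ HD0 ep Hep) as (d & Hd & Hc).
  apply (schwarz phi (S n) (2 * Kq) (Rmin d (/ 2))).
  - lia.
  - apply Rmin_glb_lt; lra.
  - intros z Hz; apply Rlt_le, Hphi, Hz.
  - intros z Hz.
    pose proof (Rlt_le_trans _ _ _ Hz (Rmin_l _ _)) as Hz1.
    pose proof (Rlt_le_trans _ _ _ Hz (Rmin_r _ _)) as Hz2.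
    specialize (Hc z); rewrite Hphi0 in Hc.
    replace (z - RtoC 0)%C with z in Hc by ring.
    replace (phi z - RtoC 0)%C with (phi z) in Hc by ring.
    specialize (Hc Hz1).
    pose proof (Rlt_le_trans _ _ _ Hc (Rmin_l _ _)) as Hs1.
    pose proof (Rlt_le_trans _ _ _ Hc (Rmin_r _ _)) as Hs2.
    apply (Rmult_lt_compat_r (2 * (KP + 1))) in Hs2; [|lra]; rewrite Rinv_l in Hs2 by lra.
    specialize (HPhi1 (phi z) ltac:(lra)).
    specialize (Hqo z ltac:(lra)).
    rewrite <- (proj2 (Hphi z ltac:(unfold inD; lra))) in Hqo.
    pose proof (Cmod_triangle (Phi (phi z)) (- (Phi (phi z) - phi z))%C) as Htr.
    rewrite Cmod_opp in Htr; replace (Phi (phi z) + - (Phi (phi z) - phi z))%C with (phi z) in Htr by ring.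
    pose proof (Cmod_ge_0 (phi z)).
    assert (KP * Cmod (phi z) ^ 2 <= / 2 * Cmod (phi z)) by (simpl; nra).
    lra.
  - exact Hphijet. }
apply Rnot_lt_le; intros Hlt.
(* At a small positive x the leading term of q gives |c_(n+1)| x^(n+1) <= x^(n+1) (1 + (KP + Kl) x);
   x is chosen so that this cannot reach an excess ga over 1. *)
set (ga := Cmod (c (S n)) - 1); assert (Hga : 0 < ga) by (unfold ga; lra).
set (x := Rmin (/ 2) (ga / (2 * (KP + Kl + 1)))).
assert (Hx : 0 < x) by (apply Rmin_glb_lt; [lra|apply Rdiv_lt_0_compat; lra]).
assert (Hx1 : x <= / 2) by apply Rmin_l.
assert (Hx2 : (KP + Kl) * x < ga).
{ assert (H : x <= ga / (2 * (KP + Kl + 1))) by apply Rmin_r.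
  apply (Rmult_le_compat_r (2 * (KP + Kl + 1))) in H; [|lra].
  replace (ga / (2 * (KP + Kl + 1)) * (2 * (KP + Kl + 1))) with ga in H by (field; lra). nra. }
assert (Hmx : Cmod (RtoC x) = x) by (rewrite Cmod_R, Rabs_pos_eq; lra).
assert (HDx : inD (RtoC x)) by (unfold inD; lra).
specialize (Hql (RtoC x) ltac:(lra)); rewrite Hcqn, Hmx in Hql.
specialize (Hschwarz _ HDx); rewrite Hmx in Hschwarz.
assert (Hxn : 0 < x ^ S n) by now apply pow_lt.
assert (Hxnx : x ^ S n <= x).
{ simpl; rewrite <- (Rmult_1_r x) at 3; apply Rmult_le_compat_l; [lra|].
  rewrite <- (pow1 n); apply pow_incr; lra. }
specialize (HPhi1 (phi (RtoC x)) ltac:(lra)).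
rewrite (proj2 (Hphi _ HDx)) in HPhi1.
assert (Hq2 : Cmod (phi (RtoC x)) ^ 2 <= x ^ S n * x).
{ simpl pow at 1; rewrite Rmult_1_r; apply Rmult_le_compat; try apply Cmod_ge_0; lra. }
apply (Rmult_le_compat_l KP) in Hq2; [|exact HKP].
pose proof (Cmod_triangle (q (RtoC x) - phi (RtoC x))%C (phi (RtoC x))) as T1.
replace (q (RtoC x) - phi (RtoC x) + phi (RtoC x))%C with (q (RtoC x)) in T1 by ring.
pose proof (Cmod_triangle (q (RtoC x)) (- (q (RtoC x) - c (S n) * RtoC x ^ S n))%C) as T2.
rewrite Cmod_opp in T2.
replace (q (RtoC x) + - (q (RtoC x) - c (S n) * RtoC x ^ S n))%C
  with (c (S n) * RtoC x ^ S n)%C in T2 by ring.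
rewrite Cmod_mult, Cmod_pow, Hmx in T2.
replace (Kl * x ^ S (S n)) with (Kl * (x ^ S n * x)) in Hql by (simpl; ring).
assert (Cmod (c (S n)) * x ^ S n = x ^ S n + ga * x ^ S n) by (unfold ga; ring).
assert ((KP + Kl) * x * x ^ S n < ga * x ^ S n) by (apply Rmult_lt_compat_r; assumption).
nra.
Qed.

(** * The image contains a disk of radius 1/2 *)

Lemma aligning_unit (x y : C) : exists la, Cmod la = 1 /\ Cmod (x + la * y)%C = Cmod x + Cmod y.
Proof.
destruct (classic (x = RtoC 0)) as [->|Hx].
{ exists (RtoC 1); split; [apply Cmod_1|]; rewrite Cmod_0, Rplus_0_l; f_equal; ring. }
destruct (classic (y = RtoC 0)) as [->|Hy].
{ exists (RtoC 1); split; [apply Cmod_1|]; rewrite Cmod_0, Rplus_0_r; f_equal; ring. }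
pose proof (proj1 (Cmod_gt_0 x) Hx) as Hx0; pose proof (proj1 (Cmod_gt_0 y) Hy) as Hy0.
assert (Hmx : RtoC (Cmod x) <> RtoC 0) by (intros H; apply RtoC_inj in H; lra).
exists (x / RtoC (Cmod x) * (RtoC (Cmod y) / y))%C; split.
- rewrite Cmod_mult, !Cmod_div, !Cmod_R, !Rabs_pos_eq by (assumption || lra); field; lra.
- replace (x + x / RtoC (Cmod x) * (RtoC (Cmod y) / y) * y)%C
    with (x * RtoC (1 + Cmod y / Cmod x))%C.
  + rewrite Cmod_mult, Cmod_R, Rabs_pos_eq; [field; lra|].
    assert (0 < Cmod y / Cmod x) by (apply Rdiv_lt_0_compat; lra); lra.
  + rewrite RtoC_plus, RtoC_div by lra; field; split; assumption.
Qed.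

(** Stability covers every unimodular factor, so it may be chosen anew for each n to align a_n with
    b_n. *)
Lemma SHC0_coeff_bound (a b : nat -> C) (h g : C -> C) (n : nat) :
  SHC0 a b h g -> Cmod (a n) + Cmod (b n) <= 1.
Proof.
intros (Hh & Hg & Ha0 & Ha1 & Hb0 & Hb1 & Hsp & _ & Hst).
destruct n as [|n]; [rewrite Ha0, Hb0, Cmod_0; lra|].
destruct (aligning_unit (a (S n)) (b (S n))) as (la & Hla & <-).
apply (convex_coeff_bound (fun k => a k + la * b k)%C (fun z => h z + la * g z)%C).
- intros z Hz; eapply csum_ext; [|apply csum_plus; [apply Hh, Hz|apply csum_scal, (Hg z Hz)]].
  intros k; cbv beta; ring.
- rewrite Ha0, Hb0; ring.
- rewrite Ha1, Hb1; ring.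
- exact (stable_analytic_injective h g la Hst Hla).
- exact (stable_analytic_convex a b h g la Hh Hg Hsp Hst Hla).
- exact (stable_analytic_jet a b h g la Hh Hg Hsp Hla).
Qed.

(** The Fejer kernel 1 + cos t sampled at the roots of unity: nonnegative, with Fourier coefficients
    1 at 0, 1/2 at 1 and -1, and 0 elsewhere. *)
Definition fejer_weight (n k : nat) : R := (1 + Re (zeta n ^ k)) / INR (S n).

(** Writes the cosine as half of zeta^k plus its conjugate; the conjugate being an n-th power, the
    exponent j - 1 appears as j + n. *)
Lemma fejer_weight_C n k j :
  (RtoC (fejer_weight n k) * (zeta n ^ j) ^ k)%C =
  (RtoC (/ INR (S n)) * ((zeta n ^ j) ^ k + (RtoC (/ 2) * (zeta n ^ S j) ^ k
     + RtoC (/ 2) * (zeta n ^ (j + n)) ^ k)))%C.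
Proof.
assert (HN : INR (S n) <> 0) by (apply not_0_INR; lia).
unfold fejer_weight, Rdiv.
rewrite RtoC_mult, RtoC_plus, re_alt, zeta_conj.
rewrite <- !Cpow_mult_r.
replace (S j * k)%nat with (k + j * k)%nat by lia.
replace ((j + n) * k)%nat with (n * k + j * k)%nat by lia.
rewrite !Cpow_add_r, !RtoC_inv by (assumption || lra).
field.
intros H; apply RtoC_inj in H; contradiction.
Qed.

Lemma fejer_sum n j :
  Csum_n (fun k => RtoC (fejer_weight n k) * (zeta n ^ j) ^ k)%C n =
  (RtoC (/ INR (S n)) * (Csum_n (fun k => (zeta n ^ j) ^ k) n
     + (RtoC (/ 2) * Csum_n (fun k => (zeta n ^ S j) ^ k) n
     + RtoC (/ 2) * Csum_n (fun k => (zeta n ^ (j + n)) ^ k) n)))%C.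
Proof.
rewrite (Csum_ext _ _ n (fun k _ => fejer_weight_C n k j)).
rewrite Csum_scal, Csum_plus, Csum_plus, !Csum_scal; reflexivity.
Qed.

Lemma zeta_shift n j : (zeta n ^ (S j + n))%C = (zeta n ^ j)%C.
Proof.
replace (S j + n)%nat with (S n * 1 + j)%nat by lia.
rewrite Cpow_add_r, zeta_root; ring.
Qed.

Lemma RtoC_INR_S_inv n : (RtoC (/ INR (S n)) * RtoC (INR (S n)))%C = RtoC 1.
Proof. rewrite <- RtoC_mult; f_equal; field; apply not_0_INR; lia. Qed.

Lemma fejer_sum_0 n : (2 <= n)%nat -> Csum_n (fun k => RtoC (fejer_weight n k)) n = RtoC 1.
Proof.
intros Hn; rewrite (Csum_ext _ (fun k => RtoC (fejer_weight n k) * (zeta n ^ 0) ^ k)%C).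
- rewrite fejer_sum, zeta_sum_1 by reflexivity.
  rewrite !zeta_sum by (apply zeta_neq_1; lia).
  rewrite !Cmult_0_r, !Cplus_0_r; apply RtoC_INR_S_inv.
- intros k _; simpl; rewrite Cpow_1_l; ring.
Qed.

Lemma fejer_sum_1 n : (2 <= n)%nat ->
  Csum_n (fun k => RtoC (fejer_weight n k) * (zeta n ^ 1) ^ k)%C n = RtoC (/ 2).
Proof.
intros Hn; rewrite fejer_sum, (zeta_sum_1 n (1 + n)).
2: { rewrite zeta_shift; reflexivity. }
rewrite !zeta_sum by (apply zeta_neq_1; lia).
rewrite Cmult_0_r, !Cplus_0_l.
replace (RtoC (/ INR (S n)) * (RtoC (/ 2) * RtoC (INR (S n))))%C
  with (RtoC (/ INR (S n)) * RtoC (INR (S n)) * RtoC (/ 2))%C by ring.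
rewrite RtoC_INR_S_inv; ring.
Qed.

(** The exponents j - 1, j and j + 1 all lie strictly between 0 and n + 1. At j = n the last one
    would wrap around to 0. *)
Lemma fejer_sum_mid n j : (2 <= j < n)%nat ->
  Csum_n (fun k => RtoC (fejer_weight n k) * (zeta n ^ j) ^ k)%C n = RtoC 0.
Proof.
intros Hj; rewrite fejer_sum.
replace (zeta n ^ (j + n))%C with (zeta n ^ (j - 1))%C.
2: { replace j with (S (j - 1)) at 2 by lia; symmetry; apply zeta_shift. }
rewrite !zeta_sum by (apply zeta_neq_1; lia).
ring.
Qed.

Lemma Csum_le p n M : (forall k, (k <= n)%nat -> Cmod (p k) <= M) -> Cmod (Csum_n p n) <= INR (S n) * M.
Proof.
intros H; induction n as [|n IH].
- rewrite Csum_O; simpl; rewrite Rmult_1_l; apply H; lia.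
- rewrite Csum_S, (S_INR (S n)); eapply Rle_trans; [apply Cmod_triangle|].
  specialize (IH ltac:(intros; apply H; lia)); specialize (H (S n) (Nat.le_refl _)); lra.
Qed.

Lemma fejer_sum_bound n j :
  Cmod (Csum_n (fun k => RtoC (fejer_weight n k) * (zeta n ^ j) ^ k)%C n) <= 2.
Proof.
assert (HN : 0 < INR (S n)) by (apply lt_0_INR; lia).
replace 2 with (INR (S n) * (2 / INR (S n))) by (field; lra).
apply Csum_le; intros k _.
rewrite Cmod_mult, !Cmod_pow, zeta_mod, !pow1, Rmult_1_r, Cmod_R.
unfold fejer_weight, Rdiv; rewrite Rabs_mult, (Rabs_pos_eq (/ _)) by (apply Rlt_le, Rinv_0_lt_compat, HN).
apply Rmult_le_compat_r; [apply Rlt_le, Rinv_0_lt_compat, HN|].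
eapply Rle_trans; [apply Rabs_triang|]; rewrite Rabs_R1.
pose proof (re_le_Cmod (zeta n ^ k)%C) as H; rewrite Cmod_pow, zeta_mod, pow1 in H; lra.
Qed.

Lemma fejer_weight_nonneg n k : 0 <= fejer_weight n k.
Proof.
apply Rmult_le_pos; [|apply Rlt_le, Rinv_0_lt_compat, lt_0_INR; lia].
pose proof (re_le_Cmod (zeta n ^ k)%C) as H; rewrite Cmod_pow, zeta_mod, pow1 in H.
apply Rabs_le_between in H; lra.
Qed.

(** Only a_1 survives below index n. The aliased terms j >= n are at most 2 |a_j| |z|^j, and with
    |z| = q rho, rho < 1, their sum is O(q^n). *)
Lemma fejer_average_limit (a : nat -> C) (h : C -> C) (z : C) (eps : R) :
  PS a h -> a 0%nat = RtoC 0 -> inD z -> 0 < eps ->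
  exists n0, forall n, (n0 <= n)%nat -> (2 <= n)%nat ->
   Cmod (Csum_n (fun k => RtoC (fejer_weight n k) * h (zeta n ^ k * z))%C n
        - RtoC (/ 2) * (a 1%nat * z))%C < eps.
Proof.
intros Hh Ha0 Hz Heps; unfold inD in Hz; pose proof (Cmod_ge_0 z) as Hz0.
set (rho := (1 + Cmod z) / 2); assert (Hrho : 0 < rho < 1) by (unfold rho; lra).
destruct (PS_abs a h rho Hh ltac:(lra)) as [l Hl].
set (q := Cmod z / rho).
assert (Hqr : q * rho = Cmod z) by (unfold q; field; lra).
assert (Hq : 0 <= q < 1) by (unfold rho in *; split; nra).
destruct (pow_lt_1_zero q ltac:(rewrite Rabs_pos_eq; lra) (eps / (2 * (Rabs l + 1)))) as [n0 Hn0].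
{ pose proof (Rabs_pos l); apply Rdiv_lt_0_compat; lra. }
exists n0; intros n Hn Hn2.
specialize (Hn0 n Hn); rewrite Rabs_pos_eq in Hn0 by (apply pow_le; lra).
apply Rle_lt_trans with (2 * q ^ n * l).
2: { pose proof (Rabs_pos l); apply (Rmult_lt_compat_r (2 * (Rabs l + 1))) in Hn0; [|lra].
     replace (eps / (2 * (Rabs l + 1)) * (2 * (Rabs l + 1))) with eps in Hn0 by (field; lra).
     pose proof (Rle_abs l); pose proof (pow_le q n (proj1 Hq)); nra. }
assert (HPS := PS_average a h (fun k => RtoC (fejer_weight n k)) (zeta n) n Hh (zeta_mod n) z Hz).
assert (Hd := csum_minus _ _ _ _ HPS (csum_single 1 (RtoC (/ 2) * (a 1%nat * z))%C)).
apply (csum_le _ (fun k => 2 * q ^ n * (Cmod (a k) * rho ^ k)) _ _ Hd).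
2: apply (is_series_scal (V := R_NormedModule)), Hl.
intros j; cbv beta.
assert (Hpos : 0 <= 2 * q ^ n * (Cmod (a j) * rho ^ j)).
{ apply Rmult_le_pos; apply Rmult_le_pos; try lra; try apply Cmod_ge_0; apply pow_le; lra. }
destruct (le_lt_dec n j) as [Hj|Hj].
- destruct (Nat.eqb_spec j 1) as [|_]; [lia|].
  unfold Cminus; rewrite Copp_0, Cplus_0_r, !Cmod_mult, Cmod_pow.
  rewrite <- Hqr, Rpow_mult_distr.
  assert (Hqj : q ^ j <= q ^ n).
  { replace j with (n + (j - n))%nat by lia; rewrite pow_add.
    rewrite <- (Rmult_1_r (q ^ n)) at 2; apply Rmult_le_compat_l; [apply pow_le; lra|].
    rewrite <- (pow1 (j - n)); apply pow_incr; lra. }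
  replace (2 * q ^ n * (Cmod (a j) * rho ^ j)) with (Cmod (a j) * 2 * (q ^ n * rho ^ j)) by ring.
  apply Rmult_le_compat.
  + apply Rmult_le_pos; apply Cmod_ge_0.
  + apply Rmult_le_pos; apply pow_le; lra.
  + apply Rmult_le_compat_l; [apply Cmod_ge_0|apply fejer_sum_bound].
  + apply Rmult_le_compat_r; [apply pow_le; lra|exact Hqj].
- match goal with |- Cmod ?x <= _ => replace x with (RtoC 0); [rewrite Cmod_0; exact Hpos|] end.
  destruct j as [|[|j]]; simpl Nat.eqb; cbv iota.
  + rewrite Ha0; ring.
  + rewrite fejer_sum_1 by exact Hn2; simpl; ring.
  + rewrite fejer_sum_mid by lia; ring.
Qed.

(* Averaging f over zeta^k z with the weights (1 + Re zeta^k) / (n + 1) leaves z / 2 up to a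
   tail that vanishes as n grows. *)
Lemma half_disk_dense (a b : nat -> C) (h g : C -> C) (w : C) (eps : R) :
  SHC0 a b h g -> Cmod w < / 2 -> 0 < eps ->
  exists s, image_D (fun z => h z + Cconj (g z))%C s /\ Cmod (s - w)%C < eps.
Proof.
intros (Hh & Hg & Ha0 & Ha1 & Hb0 & Hb1 & Hsp & _ & Hst) Hw Heps.
(* The average tends to z / 2 for h and to 0 for g, since b_1 = 0; so z = 2 w aims at w, and |w| <
   1/2 is what puts z in the disk. *)
set (z := (RtoC 2 * w)%C).
assert (Hz : inD z).
{ unfold inD, z; rewrite Cmod_mult, Cmod_R, Rabs_pos_eq; lra. }
destruct (fejer_average_limit a h z (eps / 2) Hh Ha0 Hz ltac:(lra)) as [n1 H1].
destruct (fejer_average_limit b g z (eps / 2) Hg Hb0 Hz ltac:(lra)) as [n2 H2].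
set (n := max 2 (max n1 n2)).
specialize (H1 n ltac:(unfold n; lia) ltac:(unfold n; lia)).
specialize (H2 n ltac:(unfold n; lia) ltac:(unfold n; lia)).
rewrite Ha1 in H1; rewrite Hb1 in H2.
set (f := fun z => (h z + Cconj (g z))%C).
exists (Csum_n (fun k => RtoC (fejer_weight n k) * f (zeta n ^ k * z))%C n); split.
- apply (convex_combination (image_D f) (fejer_weight n) (fun k => f (zeta n ^ k * z)%C)).
  + apply convex_image_set.
    intros z1 z2 t Hz1 Hz2 Ht.
    destruct (proj2 (Hst (RtoC 1) Cmod_1) z1 z2 t Hz1 Hz2 Ht) as (z3 & Hz3 & Heq).
    exists z3; split; [exact Hz3|]; unfold f; rewrite !Cmult_1_l in Heq; exact Heq.
  + unfold fejer_weight; simpl (zeta n ^ 0)%C; apply Rdiv_lt_0_compat; [simpl; lra|].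
    apply lt_0_INR; lia.
  + intros; apply fejer_weight_nonneg.
  + intros k _; exists (zeta n ^ k * z)%C; split; [|reflexivity].
    unfold inD; rewrite Cmod_mult, Cmod_pow, zeta_mod, pow1, Rmult_1_l; exact Hz.
  + apply fejer_sum_0; unfold n; lia.
- rewrite (Csum_ext _ (fun k => RtoC (fejer_weight n k) * h (zeta n ^ k * z)
       + Cconj (RtoC (fejer_weight n k) * g (zeta n ^ k * z)))%C).
  2: { intros k _; unfold f; rewrite Cmult_conj, Cconj_R; ring. }
  rewrite Csum_plus, <- Csum_conj.
  match type of H1 with Cmod (?x - _)%C < _ => set (X := x) in * end.
  match type of H2 with Cmod (?y - _)%C < _ => set (Y := y) in * end.
  replace (X + Cconj Y - w)%C
    with ((X - RtoC (/ 2) * (RtoC 1 * z)) + Cconj (Y - RtoC (/ 2) * (RtoC 0 * z)))%C.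
  2: { rewrite Cmult_0_l, Cmult_0_r; unfold z.
       replace (Y - RtoC 0)%C with Y by ring.
       rewrite RtoC_inv by lra; field; intros H; apply RtoC_inj in H; lra. }
  eapply Rle_lt_trans; [apply Cmod_triangle|]; rewrite Cmod_conj; lra.
Qed.

(** Density alone does not place w in the set. Three points of the set near the vertices of a
    triangle around w do, together with a whole neighbourhood of w. *)
Lemma triangle_fill (S0 : C -> Prop) (w : C) (d : R) :
  convex_set S0 -> 0 < d ->
  (forall v, Cmod (v - w)%C <= 2 * d -> forall eps, 0 < eps -> exists s, S0 s /\ Cmod (s - v)%C < eps) ->
  interior_C S0 w.
Proof.
intros Hconv Hd Hdense.
assert (Hvert : forall x y, Rabs x + Rabs y <= 2 ->
   exists s, S0 s /\ Rabs (Re s - Re w - d * x) < d / 20 /\ Rabs (Im s - Im w - d * y) < d / 20).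
{ intros x y Hxy.
  destruct (Hdense (w + (d * x, d * y)%R)%C) with (eps := d / 20) as (s & Hs & Hsd).
  - replace (w + (d * x, d * y)%R - w)%C with ((d * x, d * y)%R : C)
      by (apply Re_Im_eq; unfold Re, Im; simpl; ring).
    eapply Rle_trans; [apply Cmod_le_Re_Im|]; unfold Re, Im; simpl.
    rewrite !Rabs_mult, (Rabs_pos_eq d) by lra; nra.
  - lra.
  - exists s; split; [exact Hs|].
    pose proof (re_le_Cmod (s - (w + (d * x, d * y)%R))%C) as H1.
    pose proof (im_le_Cmod (s - (w + (d * x, d * y)%R))%C) as H2.
    unfold Re, Im in *; simpl in H1, H2.
    split; [eapply Rle_lt_trans; [|exact (Rle_lt_trans _ _ _ H1 Hsd)]
           |eapply Rle_lt_trans; [|exact (Rle_lt_trans _ _ _ H2 Hsd)]];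
      apply Req_le, f_equal; ring. }
(* In units of d the ideal vertices are (1, 0), (-1, 1) and (-1, -1). Errors of 1/20 in the vertices
   and 1/20 in s add up to 1/10, which keeps all three barycentric determinants, ideally 2, 1 and 1,
   positive. *)
destruct (Hvert 1 0) as (p0 & Hp0 & Hx0 & Hy0); [rewrite Rabs_R1, Rabs_R0; lra|].
destruct (Hvert (-1) 1) as (p1 & Hp1 & Hx1 & Hy1).
{ rewrite Rabs_R1; replace (-1) with (- (1)) by ring; rewrite Rabs_Ropp, Rabs_R1; lra. }
destruct (Hvert (-1) (-1)) as (p2 & Hp2 & Hx2 & Hy2).
{ replace (-1) with (- (1)) by ring; rewrite Rabs_Ropp, Rabs_R1; lra. }
exists (d / 20); split; [lra|]; intros s Hs.
pose proof (Rle_lt_trans _ _ _ (re_le_Cmod (s - w)%C) Hs) as Hsx.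
pose proof (Rle_lt_trans _ _ _ (im_le_Cmod (s - w)%C) Hs) as Hsy.
change (Re (s - w)) with (Re s + - Re w) in Hsx; change (Im (s - w)) with (Im s + - Im w) in Hsy.
(* Coordinates are taken relative to s, so that s becomes the origin of the triangle. *)
assert (Hcoord : forall p u v x : R, Rabs (p - u - d * x) < d / 20 -> Rabs (v + - u) < d / 20 ->
  exists xi, p = v + d * xi /\ x - / 10 < xi < x + / 10).
{ intros p u v x Hp Hv; exists ((p - v) / d); split; [field; lra|].
  apply Rabs_def2 in Hp; apply Rabs_def2 in Hv.
  split; apply (Rmult_lt_reg_r d); try lra; unfold Rdiv;
    rewrite Rmult_assoc, Rinv_l, Rmult_1_r by lra; lra. }
destruct (Hcoord _ _ _ _ Hx0 Hsx) as (x0 & Ex0 & Bx0).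
destruct (Hcoord _ _ _ _ Hy0 Hsy) as (y0 & Ey0 & By0).
destruct (Hcoord _ _ _ _ Hx1 Hsx) as (x1 & Ex1 & Bx1).
destruct (Hcoord _ _ _ _ Hy1 Hsy) as (y1 & Ey1 & By1).
destruct (Hcoord _ _ _ _ Hx2 Hsx) as (x2 & Ex2 & Bx2).
destruct (Hcoord _ _ _ _ Hy2 Hsy) as (y2 & Ey2 & By2).
(* barycentric coordinates of s in the triangle p0 p1 p2 *)
set (c0 := x1 * y2 - y1 * x2); set (c1 := x2 * y0 - y2 * x0); set (c2 := x0 * y1 - y0 * x1).
assert (Hc0 : 0 < c0) by (unfold c0; nra).
assert (Hc1 : 0 < c1) by (unfold c1; nra).
assert (Hc2 : 0 < c2) by (unfold c2; nra).
set (T := c0 + c1 + c2); assert (HT : 0 < T) by (unfold T; lra).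
assert (H := convex_combination S0
  (fun k => match k with 0%nat => c0 / T | 1%nat => c1 / T | _ => c2 / T end)
  (fun k => match k with 0%nat => p0 | 1%nat => p1 | _ => p2 end) 2 Hconv).
cbv beta iota in H.
rewrite !Csum_S, !Csum_O in H.
replace s with (RtoC (c0 / T) * p0 + RtoC (c1 / T) * p1 + RtoC (c2 / T) * p2)%C.
- apply H.
  + now apply Rdiv_lt_0_compat.
  + intros [|[|k]] _; apply Rlt_le; now apply Rdiv_lt_0_compat.
  + intros [|[|k]] _; assumption.
  + rewrite <- !RtoC_plus; f_equal; unfold T; field; unfold T in HT; lra.
- assert (HT0 : T <> 0) by lra.
  apply Re_Im_eq.
  + transitivity (c0 / T * Re p0 + c1 / T * Re p1 + c2 / T * Re p2); [unfold Re; simpl; ring|].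
    rewrite Ex0, Ex1, Ex2.
    replace (c0 / T * (Re s + d * x0) + c1 / T * (Re s + d * x1) + c2 / T * (Re s + d * x2))
      with (T / T * Re s + d * (c0 * x0 + c1 * x1 + c2 * x2) / T) by (unfold T; field; exact HT0).
    replace (c0 * x0 + c1 * x1 + c2 * x2) with 0 by (unfold c0, c1, c2; ring).
    field; exact HT0.
  + transitivity (c0 / T * Im p0 + c1 / T * Im p1 + c2 / T * Im p2); [unfold Im; simpl; ring|].
    rewrite Ey0, Ey1, Ey2.
    replace (c0 / T * (Im s + d * y0) + c1 / T * (Im s + d * y1) + c2 / T * (Im s + d * y2))
      with (T / T * Im s + d * (c0 * y0 + c1 * y1 + c2 * y2) / T) by (unfold T; field; exact HT0).
    replace (c0 * y0 + c1 * y1 + c2 * y2) with 0 by (unfold c0, c1, c2; ring).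
    field; exact HT0.
Qed.

Lemma PS_at_0 (a : nat -> C) (h : C -> C) : PS a h -> h (RtoC 0) = a 0%nat.
Proof.
intros Hh; assert (HD : inD (RtoC 0)) by (unfold inD; rewrite Cmod_0; lra).
eapply csum_unique; [apply (Hh _ HD)|].
eapply csum_ext; [|apply (csum_single 0 (a 0%nat))].
intros [|k]; simpl; ring.
Qed.

(** A boundary point of modulus below 1/2 would be interior by density and convexity. Arguing
    through lower bounds also covers an empty boundary. *)
Lemma SHC0_dist (a b : nat -> C) (h g : C -> C) :
  SHC0 a b h g -> Rbar_le (Finite (/ 2)) (dist_bd (fun z => h z + Cconj (g z))%C).
Proof.
intros HS; unfold dist_bd.
match goal with |- Rbar_le _ (Glb_Rbar ?E) => destruct (Glb_Rbar_correct E) as [_ Hglb] end.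
apply Hglb; intros x (w & [_ Hint] & ->); simpl.
apply Rnot_lt_le; intros Hlt; apply Hint.
assert (Hconv : convex_image_D (fun z => h z + Cconj (g z))%C).
{ intros z1 z2 t Hz1 Hz2 Ht; destruct HS as (_ & _ & _ & _ & _ & _ & _ & _ & Hst).
  destruct (proj2 (Hst (RtoC 1) Cmod_1) z1 z2 t Hz1 Hz2 Ht) as (z3 & Hz3 & Heq).
  exists z3; split; [exact Hz3|]; rewrite !Cmult_1_l in Heq; exact Heq. }
assert (Hw : Cmod w < / 2).
{ destruct HS as (Hh & Hg & Ha0 & _ & Hb0 & _).
  rewrite (PS_at_0 a h Hh), (PS_at_0 b g Hg), Ha0, Hb0 in Hlt.
  replace (w - (RtoC 0 + Cconj (RtoC 0)))%C with w in Hlt by (rewrite Cconj_R; ring); exact Hlt. }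
(* The radius 2 d is half of the room 1/2 - |w|, so the approximated points stay in the disk of
   radius 1/2. *)
apply (triangle_fill _ w ((/ 2 - Cmod w) / 4)).
- apply convex_image_set, Hconv.
- lra.
- intros v Hv eps Heps; apply (half_disk_dense a b h g v eps HS); [|exact Heps].
  replace v with (w + (v - w))%C by ring.
  eapply Rle_lt_trans; [apply Cmod_triangle|]; lra.
Qed.

(** * The second-order operators *)

(** The Euler derivative z h' keeps each coefficient at its index, which makes iteration plain. *)
Lemma PS_deriv (a : nat -> C) (h : C -> C) :
  PS a h ->
  PS (fun n => RtoC (INR n) * a n)%C (fun z => z * fz h z)%C /\
  forall z, inD z -> hjet h z (fz h z) (RtoC 0).
Proof.
intros Hh.
assert (H : forall z, inD z -> csum (fun n => a n * pd1 z n)%C (fz h z) /\ hjet h z (fz h z) (RtoC 0)).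
{ intros z Hz; destruct (PS_jet2 a h z Hh Hz) as (A & B & HA & HJ).
  apply jet2_hjet in HJ; destruct (hjet_fz _ _ _ _ HJ) as [-> _]; auto. }
split; intros z Hz; [|apply H, Hz].
eapply csum_ext; [|apply csum_scal, (proj1 (H z Hz))].
intros n; cbv beta.
replace (z * (a n * pd1 z n))%C with (a n * (z * pd1 z n))%C by ring.
rewrite pd1_mult; ring.
Qed.

(* [s = -1] for [Dop] and [s = 1] for [scrD]. *)
Definition euler_op (Op : (C -> C) -> C -> C) (s : C) : Prop :=
  forall (F h g : C -> C) (a b : nat -> C), PS a h -> PS b g ->
    (forall z, inD z -> F z = h z + Cconj (g z))%C ->
    forall z, inD z -> Op F z = (z * fz h z + Cconj (s * (z * fz g z)))%C.

Lemma pair_fz (F h g : C -> C) (a b : nat -> C) : PS a h -> PS b g ->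
  (forall z, inD z -> F z = h z + Cconj (g z))%C ->
  forall z, inD z -> fz F z = fz h z /\ fzbar F z = Cconj (fz g z).
Proof.
intros Hh Hg HF z Hz.
destruct (PS_deriv a h Hh) as [_ Hjh]; destruct (PS_deriv b g Hg) as [_ Hjg].
assert (HJ := hjet_plus _ _ _ _ _ _ _ (Hjh z Hz) (hjet_conj _ _ _ _ (Hjg z Hz))).
rewrite Cconj_R, Cplus_0_r, Cplus_0_l in HJ.
apply hjet_fz, (hjet_ext (fun w => h w + Cconj (g w))%C); [|exact Hz|exact HJ].
intros w Hw; symmetry; apply HF, Hw.
Qed.

Lemma Dop_euler : euler_op Dop (- RtoC 1)%C.
Proof.
intros F h g a b Hh Hg HF z Hz; unfold Dop.
destruct (pair_fz F h g a b Hh Hg HF z Hz) as [-> ->].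
rewrite Cmult_conj, Cmult_conj, Copp_conj, Cconj_R; ring.
Qed.

Lemma scrD_euler : euler_op scrD (RtoC 1).
Proof.
intros F h g a b Hh Hg HF z Hz; unfold scrD.
destruct (pair_fz F h g a b Hh Hg HF z Hz) as [-> ->].
rewrite Cmult_conj, Cmult_conj, Cconj_R; ring.
Qed.

(** Each application sends (h, g) to (z h', s z g'), so the sign enters as s^2 = 1 and both
    operators agree at second order. Since [euler_op] asks for the decomposition on the disk only,
    [Op F] can be fed back in. *)
Lemma euler_op_twice (Op : (C -> C) -> C -> C) (s : C) (F h g : C -> C) (a b : nat -> C) :
  euler_op Op s -> (s * s)%C = RtoC 1 -> PS a h -> PS b g ->
  (forall z, inD z -> F z = h z + Cconj (g z))%C ->
  exists h2 g2, PS (fun n => RtoC (INR n ^ 2) * a n)%C h2 /\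
    PS (fun n => RtoC (INR n ^ 2) * b n)%C g2 /\
    forall z, inD z -> Op (Op F) z = (h2 z + Cconj (g2 z))%C.
Proof.
intros HOp Hs Hh Hg HF.
assert (H1 := HOp F h g a b Hh Hg HF).
destruct (PS_deriv a h Hh) as [Hh1 _]; destruct (PS_deriv b g Hg) as [Hg1 _].
set (h1 := fun z => (z * fz h z)%C) in *.
set (g1 := fun z => (s * (z * fz g z))%C).
assert (Hg1' : PS (fun n => s * (RtoC (INR n) * b n))%C g1).
{ intros z Hz; eapply csum_ext; [|apply (csum_scal s), (Hg1 z Hz)].
  intros n; cbv beta; ring. }
assert (H2 := HOp (Op F) h1 g1 _ _ Hh1 Hg1' H1).
destruct (PS_deriv _ _ Hh1) as [Hh2 _]; destruct (PS_deriv _ _ Hg1') as [Hg2 _].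
exists (fun z => (z * fz h1 z)%C), (fun z => (s * (z * fz g1 z))%C).
split; [|split; [|exact H2]].
- intros z Hz; eapply csum_ext; [|apply (Hh2 z Hz)].
  intros n; cbv beta; simpl pow; rewrite !RtoC_mult; ring.
- intros z Hz; eapply csum_ext; [|apply (csum_scal s), (Hg2 z Hz)].
  intros n; cbv beta; simpl pow; rewrite !RtoC_mult.
  replace (s * (RtoC (INR n) * (s * (RtoC (INR n) * b n)) * z ^ n))%C
    with (s * s * (RtoC (INR n) * (RtoC (INR n) * b n) * z ^ n))%C by ring.
  rewrite Hs; ring.
Qed.

(** * The geometric series and the sum of n^2 x^n *)

Lemma PS_geom : PS (fun _ => RtoC 1) (fun z => / (RtoC 1 - z))%C.
Proof.
intros z Hz; unfold inD in Hz; pose proof (Cmod_ge_0 z).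
destruct (csum_ex (fun n => RtoC 1 * z ^ n)%C (fun n => Cmod z ^ n)) as [l Hl].
{ intros n; rewrite Cmult_1_l, Cmod_pow; lra. }
{ exists (/ (1 - Cmod z)); apply is_series_geom; rewrite Rabs_pos_eq; lra. }
assert (Hl' : csum (fun n => RtoC 1 * z ^ n)%C (RtoC 1 + z * l)%C).
{ apply (is_series_decr_1 (V := C_NormedModule)).
  match goal with |- is_series _ ?x => replace x with (z * l)%C end.
  - eapply csum_ext; [|apply (csum_scal z), Hl]; intros n; cbv beta; simpl; ring.
  - change (z * l = (RtoC 1 + z * l) + - (RtoC 1 * z ^ 0))%C; simpl; ring. }
assert (Heq := csum_unique _ _ _ Hl Hl').
assert (Hn : (RtoC 1 - z)%C <> RtoC 0).
{ intros H0; assert (Hz1 : z = RtoC 1) by (replace z with (RtoC 1 - (RtoC 1 - z))%C by ring; rewrite H0; ring).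
  rewrite Hz1, Cmod_1 in Hz; lra. }
replace (/ (RtoC 1 - z))%C with l; [exact Hl|].
replace l with ((l - z * l) / (RtoC 1 - z))%C by (field; exact Hn).
rewrite Heq at 1; field; exact Hn.
Qed.

Definition sq_sum (x : R) : R := x * (1 + x) / (1 - x) ^ 3.

(** Convergence comes from applying the Euler derivative twice to the geometric series. Shifting the
    index, with (k + 1)^2 = k^2 + 2 k + 1, gives linear equations that determine the sums. *)
Lemma is_series_sq (x : R) : 0 <= x < 1 -> is_series (fun n => INR n ^ 2 * x ^ n) (sq_sum x).
Proof.
intros Hx.
destruct (PS_deriv _ _ PS_geom) as [P1 _]; destruct (PS_deriv _ _ P1) as [P2 _].
assert (E0 : is_series (fun n => x ^ n) (/ (1 - x))) by (apply is_series_geom; rewrite Rabs_pos_eq; lra).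
assert (E1 : ex_series (fun n => INR n * x ^ n)).
{ eapply ex_series_ext; [|apply (PS_abs _ _ x P1 Hx)]; intros n.
  match goal with |- ?u = ?v => change (@eq R u v); cbv beta end.
  rewrite Cmod_mult, Cmod_1, Cmod_R, Rabs_pos_eq by apply pos_INR; ring. }
assert (E2 : ex_series (fun n => INR n ^ 2 * x ^ n)).
{ eapply ex_series_ext; [|apply (PS_abs _ _ x P2 Hx)]; intros n.
  match goal with |- ?u = ?v => change (@eq R u v); cbv beta end.
  rewrite !Cmod_mult, Cmod_1, Cmod_R, Rabs_pos_eq by apply pos_INR; ring. }
destruct (E1 : exists l : R, is_series _ l) as [T1 E1'].
destruct (E2 : exists l : R, is_series _ l) as [T2 E2'].
clear E1 E2; rename E1' into E1, E2' into E2.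
assert (S1 : T1 = x * (T1 + / (1 - x))).
{ assert (A1 : is_series (fun k => INR (S k) * x ^ S k) T1).
  { apply (is_series_incr_1 (V := R_NormedModule) (fun k => INR k * x ^ k)).
    match goal with |- is_series _ ?u => replace u with T1 end; [exact E1|].
    change (T1 = T1 + INR 0 * x ^ 0); simpl; ring. }
  assert (A2 : is_series (fun k => INR (S k) * x ^ S k) (x * (T1 + / (1 - x)))).
  { eapply is_series_ext;
      [|apply (is_series_scal (V := R_NormedModule) x), (is_series_plus _ _ _ _ E1 E0)].
    intros n; rewrite S_INR; unfold plus, scal; simpl; unfold mult; simpl.
    match goal with |- ?u = ?v => change (@eq R u v) end; ring. }
  apply is_series_unique in A1, A2; congruence. }
assert (S2 : T2 = x * (T2 + (2 * T1 + / (1 - x)))).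
{ assert (A1 : is_series (fun k => INR (S k) ^ 2 * x ^ S k) T2).
  { apply (is_series_incr_1 (V := R_NormedModule) (fun k => INR k ^ 2 * x ^ k)).
    match goal with |- is_series _ ?u => replace u with T2 end; [exact E2|].
    change (T2 = T2 + INR 0 ^ 2 * x ^ 0); simpl; ring. }
  assert (A2 : is_series (fun k => INR (S k) ^ 2 * x ^ S k) (x * (T2 + (2 * T1 + / (1 - x))))).
  { eapply is_series_ext;
      [|apply (is_series_scal (V := R_NormedModule) x), (is_series_plus _ _ _ _ E2
           (is_series_plus _ _ _ _ (is_series_scal (V := R_NormedModule) 2 _ _ E1) E0))].
    intros n; rewrite S_INR; unfold plus, scal; simpl; unfold mult; simpl.
    match goal with |- ?u = ?v => change (@eq R u v) end; ring. }
  apply is_series_unique in A1, A2; congruence. }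
assert (T1v : T1 = x / (1 - x) ^ 2).
{ apply (Rmult_eq_reg_r (1 - x)); [|lra]; replace (T1 * (1 - x)) with (T1 - x * T1) by ring.
  rewrite S1 at 1; field; lra. }
replace (sq_sum x) with T2; [exact E2|].
apply (Rmult_eq_reg_r (1 - x)); [|lra]; replace (T2 * (1 - x)) with (T2 - x * T2) by ring.
rewrite S2 at 1; rewrite T1v; unfold sq_sum; field; lra.
Qed.

Lemma second_order_bound (Op : (C -> C) -> C -> C) (s : C) (a b : nat -> C) (h g : C -> C) (w : C) :
  euler_op Op s -> (s * s)%C = RtoC 1 -> SHC0 a b h g -> inD w ->
  Cmod (Op (Op (fun z => h z + Cconj (g z))%C) w) <= sq_sum (Cmod w).
Proof.
intros HOp Hs HS Hw.
assert (Hab := fun n => SHC0_coeff_bound a b h g n HS).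
destruct HS as (Hh & Hg & _).
destruct (euler_op_twice Op s _ h g a b HOp Hs Hh Hg (fun z _ => eq_refl)) as (h2 & g2 & H1 & H2 & ->);
  [|exact Hw].
assert (Hx : 0 <= Cmod w < 1) by (split; [apply Cmod_ge_0|exact Hw]).
assert (Hc : csum (fun n => RtoC (INR n ^ 2) * a n * w ^ n +
   Cconj (RtoC (INR n ^ 2) * b n * w ^ n))%C (h2 w + Cconj (g2 w))%C).
{ apply csum_plus; [apply H1, Hw|].
  assert (H := H2 w Hw); rewrite csum_Re_Im in H |- *; destruct H as [HR HI]; split.
  - eapply is_series_ext; [|exact HR]; intros n; now rewrite re_conj.
  - rewrite im_conj; eapply is_series_ext; [|apply (is_series_opp _ _ HI)].
    intros n; now rewrite im_conj. }
apply (csum_le _ _ _ _ Hc) with (2 := is_series_sq _ Hx); intros n.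
eapply Rle_trans; [apply Cmod_triangle|].
rewrite Cmod_conj, !Cmod_mult, Cmod_pow, Cmod_R, Rabs_pos_eq by apply pow2_ge_0.
replace (INR n ^ 2 * Cmod (a n) * Cmod w ^ n + INR n ^ 2 * Cmod (b n) * Cmod w ^ n)
  with (INR n ^ 2 * Cmod w ^ n * (Cmod (a n) + Cmod (b n))) by ring.
rewrite <- (Rmult_1_r (INR n ^ 2 * Cmod w ^ n)) at 2; apply Rmult_le_compat_l; [|apply Hab].
apply Rmult_le_pos; [apply pow2_ge_0|apply pow_le, Cmod_ge_0].
Qed.

(** * Bounds for the inner maps and the equation of the radius *)

Lemma inB_schwarz (m : nat) (w : C -> C) (z : C) :
  (1 <= m)%nat -> inB m w -> inD z -> Cmod (w z) <= Cmod z ^ m.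
Proof.
intros Hm (c & Hc & Hb & Hlow & _) Hz.
destruct (PS_order c w m Hc Hlow) as (K & HK & HO).
apply (schwarz w m K (/ 2)); try assumption; try lra.
- intros u Hu; apply HO; lra.
- intros u Hu; destruct (PS_jet2 c w u Hc Hu) as (A & B & _ & H); exists A, B; exact H.
Qed.

Lemma is_series_geom_tail (y : R) (N : nat) :
  0 <= y < 1 -> is_series (fun k => y ^ (k + N)) (y ^ N / (1 - y)).
Proof.
intros Hy; eapply is_series_ext;
  [|apply (is_series_scal (V := R_NormedModule) (y ^ N)), (is_series_geom y)].
- intros n; unfold scal; simpl; unfold mult; simpl; rewrite pow_add.
  match goal with |- ?u = ?v => change (@eq R u v) end; ring.
- rewrite Rabs_pos_eq; lra.
Qed.

Lemma sq_sum_le (x y : R) : 0 <= x <= y -> y < 1 -> sq_sum x <= sq_sum y.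
Proof.
intros Hx Hy; unfold sq_sum, Rdiv; apply Rmult_le_compat.
- nra.
- apply Rlt_le, Rinv_0_lt_compat, pow_lt; lra.
- nra.
- apply Rinv_le_contravar; [apply pow_lt; lra|apply pow_incr; lra].
Qed.

Lemma sq_sum_lt (x y : R) : 0 <= x < y -> y < 1 -> sq_sum x < sq_sum y.
Proof.
intros Hx Hy; apply Rlt_le_trans with (y * (1 + y) / (1 - x) ^ 3).
- apply Rmult_lt_compat_r; [apply Rinv_0_lt_compat, pow_lt; lra|nra].
- apply Rmult_le_compat_l; [nra|].
  apply Rinv_le_contravar; [apply pow_lt; lra|apply pow_incr; lra].
Qed.

Lemma geom_tail_le (x y : R) (N : nat) :
  0 <= x <= y -> y < 1 -> x ^ N / (1 - x) <= y ^ N / (1 - y).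
Proof.
intros Hx Hy; apply Rmult_le_compat.
- apply pow_le; lra.
- apply Rlt_le, Rinv_0_lt_compat; lra.
- apply pow_incr; lra.
- apply Rinv_le_contravar; lra.
Qed.

Lemma pow_unit (r : R) (n : nat) : (1 <= n)%nat -> 0 <= r < 1 -> 0 <= r ^ n < 1.
Proof.
intros Hn Hr; split; [apply pow_le; lra|].
destruct n as [|n]; [lia|]; simpl; rewrite <- (Rmult_1_r 1).
apply Rle_lt_trans with (r * 1); [|lra].
apply Rmult_le_compat_l; [lra|]; rewrite <- (pow1 n); apply pow_incr; lra.
Qed.

Lemma Phi8_eq (m p N : nat) (r : R) :
  Phi8 m p N r = sq_sum (r ^ m) + (r ^ p) ^ N / (1 - r ^ p) - / 2.
Proof. unfold Phi8, sq_sum; rewrite pow_mult; reflexivity. Qed.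

Lemma pow_lt_mono (x y : R) (n : nat) : (1 <= n)%nat -> 0 <= x < y -> x ^ n < y ^ n.
Proof.
intros Hn Hxy; destruct n as [|n]; [lia|]; simpl.
apply Rle_lt_trans with (x * y ^ n).
- apply Rmult_le_compat_l; [lra|apply pow_incr; lra].
- apply Rmult_lt_compat_r; [apply pow_lt|]; lra.
Qed.

Lemma Phi8_lt (m p N : nat) (x y : R) :
  (1 <= m)%nat -> (1 <= p)%nat -> 0 <= x < y -> y < 1 -> Phi8 m p N x < Phi8 m p N y.
Proof.
intros Hm Hp Hxy Hy; rewrite !Phi8_eq.
assert (H1 : sq_sum (x ^ m) < sq_sum (y ^ m)).
{ apply sq_sum_lt; [|apply pow_unit; [exact Hm|lra]].
  split; [apply pow_le; lra|now apply pow_lt_mono]. }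
assert (H2 : (x ^ p) ^ N / (1 - x ^ p) <= (y ^ p) ^ N / (1 - y ^ p)).
{ apply geom_tail_le; [|apply pow_unit; [exact Hp|lra]].
  split; [apply pow_le; lra|apply Rlt_le; now apply pow_lt_mono]. }
lra.
Qed.

Lemma Phi8_root (m p N : nat) :
  (1 <= m)%nat -> (1 <= p)%nat -> (2 <= N)%nat ->
  exists r, 0 < r < 1 /\ Phi8 m p N r = 0.
Proof.
intros Hm Hp HN.
(* A right end point away from the pole at 1: where s^m >= 1/2, the first term is at least
   [sq_sum (/ 2)] = 6 and already exceeds 1/2. *)
destruct (exists_pow_ge_half m) as (s & Hs & Hpow).
assert (H0 : Phi8 m p N 0 < 0).
{ rewrite Phi8_eq, !pow_i by lia; unfold sq_sum.
  replace (0 * (1 + 0) / (1 - 0) ^ 3 + 0 / (1 - 0) - / 2) with (- / 2) by field; lra. }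
assert (H1 : 0 < Phi8 m p N s).
{ rewrite Phi8_eq.
  pose proof (pow_unit s m Hm ltac:(lra)) as Hsm; pose proof (pow_unit s p Hp ltac:(lra)) as Hsp.
  specialize (Hpow s (Rle_refl s)).
  assert (A1 : 3 / 4 <= sq_sum (s ^ m)).
  { apply Rle_trans with (sq_sum (/ 2)); [unfold sq_sum; lra|apply sq_sum_le; lra]. }
  assert (A2 : 0 <= (s ^ p) ^ N / (1 - s ^ p)).
  { apply Rmult_le_pos; [apply pow_le; lra|apply Rlt_le, Rinv_0_lt_compat; lra]. }
  lra. }
destruct (Ranalysis5.IVT_interv (Phi8 m p N) 0 s) as (r & Hr & Hr0); try assumption; try lra.
{ intros x Hx; apply continuity_pt_filterlim, (ex_derive_continuous (K := R_AbsRing) (V := R_NormedModule)).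
  pose proof (pow_unit x m Hm ltac:(lra)); pose proof (pow_unit x p Hp ltac:(lra)).
  assert (0 < (1 - x ^ m) ^ 3) by (apply pow_lt; lra).
  unfold Phi8; auto_derive; repeat split; try lra. }
exists r; split; [|exact Hr0].
split; [|lra]; destruct Hr as [[Hr|<-] _]; [exact Hr|lra].
Qed.

(** * The inequality and its sharpness *)

Lemma bohr_ineq_holds (Op : (C -> C) -> C -> C) (s : C) (m p N : nat) (r : R)
    (a b : nat -> C) (h g wm wp : C -> C) (z : C) :
  (1 <= m)%nat -> (1 <= p)%nat -> 0 < r < 1 -> Phi8 m p N r = 0 ->
  euler_op Op s -> (s * s)%C = RtoC 1 ->
  SHC0 a b h g -> inB m wm -> inB p wp -> Cmod z <= r ->
  bohr_ineq Op a b (fun w => h w + Cconj (g w))%C wm wp N z.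
Proof.
intros Hm Hp Hr HPhi HOp Hs HS Hwm Hwp Hz.
assert (Hz1 : inD z) by (unfold inD; lra).
pose proof (Cmod_ge_0 z) as Hz0.
assert (Hx : 0 <= Cmod (wm z) <= r ^ m).
{ split; [apply Cmod_ge_0|]; eapply Rle_trans; [apply (inB_schwarz m); assumption|].
  apply pow_incr; lra. }
assert (Hy : 0 <= Cmod (wp z) <= r ^ p).
{ split; [apply Cmod_ge_0|]; eapply Rle_trans; [apply (inB_schwarz p); assumption|].
  apply pow_incr; lra. }
pose proof (pow_unit r m Hm ltac:(lra)) as Hrm; pose proof (pow_unit r p Hp ltac:(lra)) as Hrp.
rewrite Phi8_eq in HPhi.
set (y := Cmod (wp z)) in *.
assert (Htail := is_series_geom_tail y N ltac:(lra)).
assert (Hterm : forall k, 0 <= (Cmod (a (k + N)%nat) + Cmod (b (k + N)%nat)) * y ^ (k + N) <= y ^ (k + N)).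
{ intros k; assert (0 <= y ^ (k + N)) by (apply pow_le; lra).
  pose proof (SHC0_coeff_bound a b h g (k + N) HS).
  pose proof (Cmod_ge_0 (a (k + N)%nat)); pose proof (Cmod_ge_0 (b (k + N)%nat)).
  split; [apply Rmult_le_pos; lra|].
  rewrite <- (Rmult_1_l (y ^ (k + N))) at 2; apply Rmult_le_compat_r; lra. }
assert (Hex : ex_series (fun k => (Cmod (a (k + N)%nat) + Cmod (b (k + N)%nat)) * y ^ (k + N))).
{ apply (ex_series_le (V := R_CompleteNormedModule) _ (fun k => y ^ (k + N))).
  - intros k; unfold norm; simpl; unfold abs; simpl; rewrite Rabs_pos_eq; apply Hterm.
  - eexists; exact Htail. }
eexists; split; [apply Series_correct, Hex|].
(* The pivot 1/2 is where the two halves meet: the root equation says that the bounds on the left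
   side add up to it. *)
apply Rbar_le_trans with (Finite (/ 2)); [|apply (SHC0_dist a b h g HS)].
simpl.
assert (T1 : Cmod (Op (Op (fun w => h w + Cconj (g w))%C) (wm z)) <= sq_sum (r ^ m)).
{ eapply Rle_trans; [apply (second_order_bound Op s a b h g); try assumption; unfold inD; lra|].
  apply sq_sum_le; lra. }
assert (T2 : Series (fun k => (Cmod (a (k + N)%nat) + Cmod (b (k + N)%nat)) * y ^ (k + N))
             <= (r ^ p) ^ N / (1 - r ^ p)).
{ apply Rle_trans with (Series (fun k => y ^ (k + N))).
  - apply Series_le; [exact Hterm|eexists; exact Htail].
  - rewrite (is_series_unique _ _ Htail); apply geom_tail_le; lra. }
fold y; lra.
Qed.

(** * The extremal half-plane map *)

Definition a_ext (n : nat) : C := match n with O => RtoC 0 | S _ => RtoC 1 end.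
(** The map z / (1 - z), written so that series and image reduce to the geometric series and to an
    inversion. *)
Definition h_ext (z : C) : C := (/ (RtoC 1 - z) - RtoC 1)%C.
Definition zero_seq (_ : nat) : C := RtoC 0.
Definition zero_fun (_ : C) : C := RtoC 0.

Lemma inD_neq_1 (z : C) : inD z -> (RtoC 1 - z)%C <> RtoC 0.
Proof.
intros Hz H; unfold inD in Hz.
assert (Hz1 : z = RtoC 1) by (replace z with (RtoC 1 - (RtoC 1 - z))%C by ring; rewrite H; ring).
rewrite Hz1, Cmod_1 in Hz; lra.
Qed.

Lemma PS_h_ext : PS a_ext h_ext.
Proof.
intros z Hz; eapply csum_ext; [|apply (csum_minus _ _ _ _ (PS_geom z Hz) (csum_single 0 (RtoC 1)))].
intros [|n]; simpl; ring.
Qed.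

Lemma PS_zero : PS zero_seq zero_fun.
Proof.
intros z Hz; eapply csum_ext; [|apply (csum_single 0 (RtoC 0))].
intros [|n]; unfold zero_seq; simpl; ring.
Qed.

(** Both sides say |v|^2 < 2 Re v: inversion takes the disk |1 - v| < 1 to the half-plane Re >
    1/2. *)
Lemma Cinv_half_plane (v : C) : v <> RtoC 0 ->
  (Cmod (RtoC 1 - v)%C < 1 <-> / 2 < Re (/ v)%C).
Proof.
intros Hv; pose proof (proj1 (Cmod_gt_0 v) Hv) as Hv0.
assert (Hq : 0 < Cmod v ^ 2) by (apply pow_lt; lra).
assert (H1 : Cmod (RtoC 1 - v)%C ^ 2 = 1 - 2 * Re v + Cmod v ^ 2).
{ rewrite !Cmod2_alt; unfold Re, Im; simpl; ring. }
assert (H2 : Re (/ v)%C = Re v / Cmod v ^ 2).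
{ rewrite Cmod2_alt; unfold Re, Im; simpl; reflexivity. }
rewrite H2; pose proof (Cmod_ge_0 (RtoC 1 - v)%C) as Hp.
assert (H3 : / 2 < Re v / Cmod v ^ 2 <-> Cmod v ^ 2 < 2 * Re v).
{ split; intros H.
  - apply (Rmult_lt_compat_r (Cmod v ^ 2)) in H; [|exact Hq].
    unfold Rdiv in H; rewrite Rmult_assoc, Rinv_l in H by lra; lra.
  - apply (Rmult_lt_reg_r (Cmod v ^ 2)); [exact Hq|].
    unfold Rdiv; rewrite Rmult_assoc, Rinv_l by lra; lra. }
rewrite H3; split; intros H.
- assert (Cmod (RtoC 1 - v)%C ^ 2 < 1) by (simpl; nra); lra.
- apply Rnot_le_lt; intros Hle; assert (1 <= Cmod (RtoC 1 - v)%C ^ 2) by (simpl; nra); lra.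
Qed.

Lemma h_ext_image (w : C) : image_D h_ext w <-> - / 2 < Re w.
Proof.
split.
- intros (z & Hz & <-); unfold h_ext.
  assert (H : / 2 < Re (/ (RtoC 1 - z))%C).
  { apply Cinv_half_plane; [apply inD_neq_1, Hz|].
    replace (RtoC 1 - (RtoC 1 - z))%C with z by ring; exact Hz. }
  change (Re (/ (RtoC 1 - z) - RtoC 1)%C) with (Re (/ (RtoC 1 - z))%C + - (1)); lra.
- intros Hw; set (u := (w + RtoC 1)%C).
  assert (Hu : / 2 < Re u) by (change (Re u) with (Re w + 1); lra).
  assert (Hun : u <> RtoC 0) by (intros H; rewrite H in Hu; unfold Re in Hu; simpl in Hu; lra).
  assert (Huin : (/ u)%C <> RtoC 0).
  { intros H; apply Hun; replace u with (u * (u * / u))%C by (field; exact Hun); rewrite H; ring. }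
  exists (RtoC 1 - / u)%C; split.
  + apply Cinv_half_plane; [exact Huin|].
    replace (/ / u)%C with u by (field; split; [exact Hun|apply C1_nz] || (field; exact Hun)); exact Hu.
  + unfold h_ext; replace (RtoC 1 - (RtoC 1 - / u))%C with (/ u)%C by ring.
    replace (/ / u)%C with u by (field; split; [exact Hun|apply C1_nz] || (field; exact Hun)).
    unfold u; ring.
Qed.

Lemma h_ext_injective : univalent_D h_ext.
Proof.
intros z1 z2 Hz1 Hz2 H; apply inD_neq_1 in Hz1, Hz2; unfold h_ext in H.
assert (H' : (/ (RtoC 1 - z1) = / (RtoC 1 - z2))%C).
{ replace (/ (RtoC 1 - z1))%C with (/ (RtoC 1 - z1) - RtoC 1 + RtoC 1)%C by ring; rewrite H; ring. }
assert (H'' : (RtoC 1 - z1 = RtoC 1 - z2)%C).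
{ replace (RtoC 1 - z1)%C with ((RtoC 1 - z1) * ((RtoC 1 - z2) * / (RtoC 1 - z2)))%C
    by (field; exact Hz2).
  rewrite <- H'; field; exact Hz1. }
replace z1 with (RtoC 1 - (RtoC 1 - z1))%C by ring; rewrite H''; ring.
Qed.

Lemma h_ext_hjet (z : C) : inD z -> hjet h_ext z (/ (RtoC 1 - z) ^ 2)%C (RtoC 0).
Proof.
intros Hz; pose proof (inD_neq_1 z Hz) as Hn; unfold inD in Hz.
set (v := (RtoC 1 - z)%C) in *; pose proof (proj1 (Cmod_gt_0 v) Hn) as Hv.
exists (2 / Cmod v ^ 3), (Cmod v / 2).
assert (Hv3 : 0 < Cmod v ^ 3) by (apply pow_lt; lra).
split; [apply Rlt_le, Rdiv_lt_0_compat; lra|]; split; [lra|]; intros t Ht.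
assert (Hvt : Cmod v / 2 <= Cmod (v - t)%C).
{ pose proof (Cmod_triangle (v - t)%C t) as H; replace (v - t + t)%C with v in H by ring; lra. }
assert (Hvtn : (v - t)%C <> RtoC 0) by (apply Cmod_gt_0; lra).
unfold h_ext; replace (RtoC 1 - (z + t))%C with (v - t)%C by (unfold v; ring); fold v.
replace (/ (v - t) - RtoC 1 - (/ v - RtoC 1 + / v ^ 2 * t + RtoC 0 * Cconj t))%C
  with (t ^ 2 / (v ^ 2 * (v - t)))%C by (field; split; assumption).
rewrite Cmod_div, Cmod_mult, !Cmod_pow by (apply Cmult_neq_0; [now apply Cpow_nz|exact Hvtn]).
unfold Rdiv; rewrite Rmult_comm; apply Rmult_le_compat_r; [apply pow2_ge_0|].
assert (Hv2 : 0 < Cmod v ^ 2) by (apply pow_lt; lra).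
apply Rle_trans with (/ (Cmod v ^ 2 * (Cmod v / 2))).
- apply Rinv_le_contravar; [apply Rmult_lt_0_compat; lra|apply Rmult_le_compat_l; lra].
- apply Req_le; field; lra.
Qed.

Lemma plus_conj_zero (c mu z : C) : (c + mu * Cconj (zero_fun z) = c)%C.
Proof. unfold zero_fun; rewrite Cconj_R; ring. Qed.

Lemma plus_conj_zero1 (c z : C) : (c + Cconj (zero_fun z) = c)%C.
Proof. unfold zero_fun; rewrite Cconj_R; ring. Qed.

(** With g = 0 every rotation h + mu conj(g) is the same map, so stability reduces to injectivity of
    [h_ext] and convexity of a half-plane. *)
Lemma SHC0_ext : SHC0 a_ext zero_seq h_ext zero_fun.
Proof.
assert (Hconv : forall F, (forall z, F z = h_ext z) -> univalent_convex_D F).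
{ intros F HF; split.
  - intros z1 z2 Hz1 Hz2 H; rewrite !HF in H; now apply h_ext_injective.
  - intros z1 z2 t Hz1 Hz2 Ht; rewrite !HF.
    assert (H1 : - / 2 < Re (h_ext z1)) by (apply h_ext_image; exists z1; auto).
    assert (H2 : - / 2 < Re (h_ext z2)) by (apply h_ext_image; exists z2; auto).
    destruct (proj2 (h_ext_image (RtoC (1 - t) * h_ext z1 + RtoC t * h_ext z2)%C)) as (z3 & Hz3 & H).
    { replace (Re (RtoC (1 - t) * h_ext z1 + RtoC t * h_ext z2)%C)
        with ((1 - t) * Re (h_ext z1) + t * Re (h_ext z2)) by (unfold Re; simpl; ring).
      destruct (Rle_lt_dec t (/ 2)); nra. }
    exists z3; rewrite HF; auto. }
repeat split; try reflexivity.
- apply PS_h_ext.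
- apply PS_zero.
- intros z Hz.
  assert (HJ : hjet (fun z => h_ext z + Cconj (zero_fun z))%C z (/ (RtoC 1 - z) ^ 2)%C (RtoC 0)).
  { apply (hjet_ext h_ext); [intros w _; now rewrite plus_conj_zero1|exact Hz|apply h_ext_hjet, Hz]. }
  destruct (hjet_fz _ _ _ _ HJ) as [-> ->].
  rewrite Cmod_0; apply Cmod_gt_0; intros H.
  pose proof (Cpow_nz _ 2 (inD_neq_1 z Hz)) as Hn.
  apply C1_nz; rewrite <- (Cinv_r _ Hn), H; ring.
- intros z1 z2; rewrite !plus_conj_zero1; apply h_ext_injective.
- apply Hconv; intros z; apply plus_conj_zero.
- apply Hconv; intros z; apply plus_conj_zero.
Qed.

Lemma dist_bd_ext : Rbar_le (dist_bd (fun z => h_ext z + Cconj (zero_fun z))%C) (Finite (/ 2)).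
Proof.
set (F := fun z => (h_ext z + Cconj (zero_fun z))%C).
assert (HF : forall w, image_D F w <-> - / 2 < Re w).
{ intros w; rewrite <- h_ext_image; unfold F; split; intros (z & Hz & H); exists z; split; auto;
    rewrite plus_conj_zero1 in *; auto. }
unfold dist_bd.
match goal with |- Rbar_le (Glb_Rbar ?E) _ => destruct (Glb_Rbar_correct E) as [Hlb _] end.
(* The point of the line Re w = -1/2 nearest to the origin. *)
apply Hlb; exists (RtoC (- / 2)); split; [split|].
- intros eps Heps; exists (RtoC (- / 2 + eps / 2)); split.
  + apply HF; unfold Re; simpl; lra.
  + rewrite <- RtoC_minus, Cmod_R, Rabs_pos_eq; lra.
- intros (eps & Heps & H).
  specialize (H (RtoC (- / 2 - eps / 2))); rewrite <- RtoC_minus, Cmod_R in H.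
  assert (Hin : image_D F (RtoC (- / 2 - eps / 2))).
  { apply H; rewrite Rabs_left; lra. }
  apply HF in Hin; unfold Re in Hin; simpl in Hin; lra.
- unfold F; rewrite plus_conj_zero1.
  replace (h_ext (RtoC 0)) with (RtoC 0).
  + rewrite <- RtoC_minus, Cmod_R, Rabs_left; lra.
  + unfold h_ext; field.
Qed.

Lemma inB_pow (n : nat) : inB n (fun z => z ^ n)%C.
Proof.
exists (fun k => if Nat.eqb k n then RtoC 1 else RtoC 0); repeat split.
- intros z Hz; eapply csum_ext; [|apply (csum_single n (z ^ n)%C)].
  intros k; cbv beta; destruct (Nat.eqb_spec k n) as [->|]; ring.
- intros z Hz; rewrite Cmod_pow, <- (pow1 n); apply pow_incr.
  split; [apply Cmod_ge_0|apply Rlt_le, Hz].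
- intros k Hk; destruct (Nat.eqb_spec k n); [lia|reflexivity].
- rewrite Nat.eqb_refl; apply C1_nz.
Qed.

Lemma csum_RtoC (u : nat -> R) (l : R) : is_series u l -> csum (fun n => RtoC (u n)) (RtoC l).
Proof.
intros H; apply csum_Re_Im; split; [exact H|].
apply (is_series_ext (fun n => 0 * u n)); [intros n; simpl; unfold Im; simpl; ring|].
replace (Im (RtoC l)) with (0 * l) by (unfold Im; simpl; ring).
apply (is_series_scal (V := R_NormedModule) 0 _ _ H).
Qed.

(** On the nonnegative axis all terms n^2 x^n are nonnegative, so the triangle inequality behind
    [second_order_bound] is an equality. *)
Lemma second_order_ext (Op : (C -> C) -> C -> C) (s : C) (x : R) :
  euler_op Op s -> (s * s)%C = RtoC 1 -> 0 <= x < 1 ->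
  Op (Op (fun z => h_ext z + Cconj (zero_fun z))%C) (RtoC x) = RtoC (sq_sum x).
Proof.
intros HOp Hs Hx.
assert (HD : inD (RtoC x)) by (unfold inD; rewrite Cmod_R, Rabs_pos_eq; lra).
destruct (euler_op_twice Op s _ h_ext zero_fun a_ext zero_seq HOp Hs PS_h_ext PS_zero (fun z _ => eq_refl))
  as (h2 & g2 & H1 & H2 & ->); [|exact HD].
replace (g2 (RtoC x)) with (RtoC 0).
2: { eapply csum_unique; [|apply (H2 _ HD)].
     eapply csum_ext; [|apply (csum_single 0 (RtoC 0))].
     intros [|n]; unfold zero_seq; simpl; ring. }
rewrite Cconj_R, Cplus_0_r.
eapply csum_unique; [apply (H1 _ HD)|].
eapply csum_ext; [|apply csum_RtoC, is_series_sq, Hx].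
intros [|n]; cbv beta.
- simpl a_ext; rewrite Cmult_0_r, Cmult_0_l; f_equal; simpl; ring.
- simpl a_ext; rewrite RtoC_mult, (RtoC_pow x); ring.
Qed.

(** At z = r the left side equals Phi8 + 1/2, which exceeds 1/2, an upper bound for the distance.
    The sum S in [bohr_ineq] is unique, so no other choice of it can rescue the inequality. *)
Lemma bohr_ineq_sharp (Op : (C -> C) -> C -> C) (s : C) (m p N : nat) (r : R) :
  (1 <= m)%nat -> (1 <= p)%nat -> (2 <= N)%nat -> 0 < r < 1 -> 0 < Phi8 m p N r ->
  euler_op Op s -> (s * s)%C = RtoC 1 ->
  exists (a b : nat -> C) (h g wm wp : C -> C) (z : C),
    SHC0 a b h g /\ inB m wm /\ inB p wp /\ Cmod z = r /\
    ~ bohr_ineq Op a b (fun w => h w + Cconj (g w))%C wm wp N z.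
Proof.
intros Hm Hp HN Hr HPhi HOp Hs.
exists a_ext, zero_seq, h_ext, zero_fun, (fun z => z ^ m)%C, (fun z => z ^ p)%C, (RtoC r).
split; [apply SHC0_ext|]; split; [apply inB_pow|]; split; [apply inB_pow|].
split; [rewrite Cmod_R, Rabs_pos_eq; lra|].
intros (S0 & HS0 & Hle).
pose proof (pow_unit r m Hm ltac:(lra)) as Hrm; pose proof (pow_unit r p Hp ltac:(lra)) as Hrp.
rewrite <- !RtoC_pow in Hle, HS0.
rewrite (second_order_ext Op s (r ^ m) HOp Hs Hrm) in Hle.
assert (H := Rbar_le_trans _ _ _ Hle dist_bd_ext); simpl in H.
assert (HS1 : is_series (fun k => (r ^ p) ^ (k + N)) S0).
{ eapply is_series_ext; [|exact HS0]; intros k; cbv beta.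
  (* N is positive, so every index k + N is a successor and the coefficient there is 1. *)
  destruct N as [|N']; [lia|]; rewrite Nat.add_succ_r; unfold zero_seq; simpl a_ext.
  rewrite Cmod_0, Cmod_1, Cmod_R, Rabs_pos_eq by lra.
  match goal with |- ?u = ?v => change (@eq R u v) end; ring. }
apply is_series_unique in HS1.
rewrite (is_series_unique _ _ (is_series_geom_tail (r ^ p) N Hrp)) in HS1.
rewrite Phi8_eq, HS1 in HPhi.
assert (Hsq : 0 <= sq_sum (r ^ m)).
{ apply Rmult_le_pos; [nra|apply Rlt_le, Rinv_0_lt_compat, pow_lt; lra]. }
rewrite Cmod_R, Rabs_pos_eq in H by exact Hsq; lra.
Qed.

Theorem theorem4p4 (m p N : nat) :
  (1 <= m)%nat -> (1 <= p)%nat -> (2 <= N)%nat ->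
  exists r8 : R,
    (0 < r8 < 1 /\ Phi8 m p N r8 = 0 /\
     (forall r, 0 < r < 1 -> Phi8 m p N r = 0 -> r = r8)) /\
    (* the inequalities hold for |z| = r <= r8 *)
    (forall (a b : nat -> C) (h g wm wp : C -> C) (z : C),
       SHC0 a b h g -> inB m wm -> inB p wp -> Cmod z <= r8 ->
       let f := fun w => Cplus (h w) (Cconj (g w)) in
       bohr_ineq Dop a b f wm wp N z /\ bohr_ineq scrD a b f wm wp N z) /\
    (* sharpness *)
    (forall r, r8 < r < 1 ->
       (exists (a b : nat -> C) (h g wm wp : C -> C) (z : C),
          SHC0 a b h g /\ inB m wm /\ inB p wp /\ Cmod z = r /\
          ~ bohr_ineq Dop a b (fun w => Cplus (h w) (Cconj (g w))) wm wp N z) /\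
       (exists (a b : nat -> C) (h g wm wp : C -> C) (z : C),
          SHC0 a b h g /\ inB m wm /\ inB p wp /\ Cmod z = r /\
          ~ bohr_ineq scrD a b (fun w => Cplus (h w) (Cconj (g w))) wm wp N z)).
Proof.
intros Hm Hp HN.
destruct (Phi8_root m p N Hm Hp HN) as (r8 & Hr8 & HPhi).
assert (Hs1 : (- RtoC 1 * - RtoC 1)%C = RtoC 1) by ring.
assert (Hs2 : (RtoC 1 * RtoC 1)%C = RtoC 1) by ring.
exists r8; split; [|split].
- split; [exact Hr8|]; split; [exact HPhi|]; intros r Hr H0.
  destruct (Rtotal_order r r8) as [Hlt|[Heq|Hlt]]; [|exact Heq|].
  + pose proof (Phi8_lt m p N r r8 Hm Hp ltac:(lra) ltac:(lra)); lra.
  + pose proof (Phi8_lt m p N r8 r Hm Hp ltac:(lra) ltac:(lra)); lra.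
- intros a b h g wm wp z HS Hwm Hwp Hz f; split.
  + apply (bohr_ineq_holds Dop (- RtoC 1)%C m p N r8); auto using Dop_euler.
  + apply (bohr_ineq_holds scrD (RtoC 1) m p N r8); auto using scrD_euler.
- intros r Hr.
  assert (HPr : 0 < Phi8 m p N r).
  { rewrite <- HPhi; apply Phi8_lt; try assumption; lra. }
  split.
  + apply (bohr_ineq_sharp Dop (- RtoC 1)%C); auto using Dop_euler; lra.
  + apply (bohr_ineq_sharp scrD (RtoC 1)); auto using scrD_euler; lra.
Qed.
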